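(* Let $T:[0,1]^d\to[0,1]^d$ be a piecewise expanding map, and suppose that the absolutely continuous (with respect to $m_d$) $T$-invariant probability measure $\mu$ is exponentially mixing. Let $f:[0,1]^d\to[0,1]^d$ be a piecewise Lipschitz vector function. Assume that one of the following conditions holds. (1) There exist an open set $V$ with $\mu(V)=1$ and a constant $\mathfrak c\ge1$ such that the density $h$ of $\mu$, when restricted to $V$, is bounded from above by $\mathfrak c$ and from below by $\mathfrak c^{-1}$; and $\mu\circ f^{-1}\ll\mu$. (2) There is $\mathfrak c\ge1$ such that the density $h$ of $\mu$ satisfies $\mathfrak c^{-1}\le h(\mathbf x)\le\mathfrak c$ for all $\mathbf x\in[0,1]^d$. Then for every sequence of non-negative real numbers $\{\delta_n\}$ with $\lim_{n\to\infty}\delta_n=0$, $$\mu\left(\mathcal R^{f\times}(\{\delta_n\})\right)=\begin{cases}0&\text{if }\sum_{n=1}^\infty\delta_n(-\log\delta_n)^{d-1}<\infty,\\ 1&\text{if }\sum_{n=1}^\infty\delta_n(-\log\delta_n)^{d-1}=\infty.\end{cases}$$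
   Context: Notation. $d\ge1$; $[0,1]^d$ carries the maximum norm $|\mathbf x|=\max_i|x_i|$; $m_d$ is $d$-dimensional Lebesgue measure. For $A\subset\mathbb R^d$, $A(\varepsilon)$ is its $\varepsilon$-neighbourhood and $M^{*(d-1)}(A)=\limsup_{\varepsilon\to0^+}m_d(A(\varepsilon))/\varepsilon$. The expression $\delta(-\log\delta)^{d-1}$ is taken to be $0$ when $\delta=0$. Piecewise expanding map. $T:[0,1]^d\to[0,1]^d$ is piecewise expanding if there is a finite family $(U_i)_{i=1}^Q$ of non-empty, pairwise disjoint, connected open subsets of $[0,1]^d$ with $\bigcup_{i=1}^Q\overline{U_i}=[0,1]^d$ such that: (i) $T$ is injective on each $U_i$ and can be extended to a $C^1$ map on each $\overline{U_i}$, and there is a constant $L>1$ with $\inf_i\inf_{\mathbf x\in U_i}\|D_{\mathbf x}T\|\ge L$, where $D_{\mathbf x}T$ is the derivative of $T$ at $\mathbf x$ and $\|D_{\mathbf x}T\|=\sup_{\mathbf z\in\mathbb R^d}|(D_{\mathbf x}T)(\mathbf z)|/|\mathbf z|$; (ii) the boundary of each $U_i$ is included in a $C^1$ piecewise embedded compact submanifold of codimension one; in particular there is a constant $K$ with $\max_{1\le i\le Q}M^{*(d-1)}(\partial U_i)\le K$. Exponential mixing. $\mu$ is exponentially mixing if for every collection $\mathcal C$ of subsets $E$ of $[0,1]^d$ with $\sup_{E\in\mathcal C}M^{*(d-1)}(\partial E)<\infty$ there are constants $c,\tau>0$ such that $|\mu(F\cap T^{-n}G)-\mu(F)\mu(G)|\le\mu(G)\phi(n)$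 for all $F,G\in\mathcal C$ and $n\in\mathbb N$, where $\phi(n)=ce^{-\tau n}$. Functions $f$. $f$ is assumed Borel measurable. $f$ is piecewise Lipschitz if there are $p>0$ and finitely many measurable subsets $U_j$ ($j\in\mathcal I$) of $[0,1]^d$ with $\mu([0,1]^d\setminus\bigcup_jU_j)=0$ such that each restriction $f|_{U_j}:U_j\to[0,1]^d$ is Lipschitz: $|f(\mathbf x)-f(\mathbf y)|\le p|\mathbf x-\mathbf y|$ for $\mathbf x,\mathbf y\in U_j$. $\mu\circ f^{-1}\ll\mu$ means: $\mu(A)=0$ implies $\mu(f^{-1}(A))=0$ for every measurable $A\subset[0,1]^d$ ($f^{-1}$ is the preimage). Sets. $H(f(\mathbf x),\delta)=f(\mathbf x)+\{\mathbf z\in[-1,1]^d:|z_1\cdots z_d|<\delta\}$ and $\mathcal R^{f\times}(\{\delta_n\})=\{\mathbf x\in[0,1]^d:T^n\mathbf x\in H(f(\mathbf x),\delta_n)\text{ for infinitely many }n\in\mathbb N\}$. *)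

(* Defs.v *)
From HB Require Import structures.
From mathcomp Require Import all_boot all_order all_algebra.
From mathcomp Require Import all_classical all_reals all_analysis.
From mathcomp Require Import measurable_realfun.
Set Implicit Arguments.
Unset Strict Implicit.
Unset Printing Implicit Defensive.
Import Order.TTheory GRing.Theory Num.Theory.
Import numFieldNormedType.Exports.
Local Open Scope classical_set_scope.
Local Open Scope ring_scope.

Section borel_mx.
Context (R : realType) (m n : nat).

HB.instance Definition _ := @isMeasurable.Build
  (sigma_display (@open 'M[R]_(m, n))) 'M[R]_(m, n) <<s @open 'M[R]_(m, n) >>
  (@sigma_algebra0 _ _ _) (@sigma_algebraC _ _) (@sigma_algebra_bigcup _ _ _).

Lemma open_measurable_mx (A : set 'M[R]_(m, n)) : open A -> measurable A.
Proof. exact: sub_sigma_algebra. Qed.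

End borel_mx.

Section row_cons.
Context (R : realType) (n : nat).

Definition row_cons (p : measurableTypeR R * 'rV[R]_n) : 'rV[R]_n.+1 :=
  \row_i oapp (fun j => p.2 ord0 j) p.1 (unlift ord0 i).

Lemma row_cons_ball (c p : measurableTypeR R * 'rV[R]_n) (e : R) :
  ball (row_cons c) e (row_cons p) <-> ball c.1 e p.1 /\ ball c.2 e p.2.
Proof.
rewrite /row_cons /ball /= /mx_ball; split.
- move=> [e0 H]; split; last split => // i j.
    by have := H ord0 ord0; rewrite !mxE unlift_none.
  by have := H ord0 (lift ord0 j); rewrite !mxE liftK /= (ord1 i).
- move=> [H1 [e0 H2]]; split => // i j.
  by rewrite !mxE; case: unliftP => [k|] _ //=; exact: H2.
Qed.

Lemma dense_rat_rV k (x : 'rV[R]_k) (e : R) : 0 < e ->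
  exists q : 'rV[rat]_k, ball (map_mx (@ratr R) q) e x.
Proof.
move=> e0.
have H (i : 'I_k) : exists q : rat, ball (ratr q : R) e (x ord0 i).
  have [//||y [xy [q _ qy]]] := @dense_rat R (ball (x ord0 i) e).
  - by exists (x ord0 i); exact: ballxx.
  - exact: ball_open.
  by exists q; rewrite qy; exact: ball_sym.
have [g gP] := choice H.
exists (\row_i g i); split => // i j.
by rewrite !mxE (ord1 i); exact: gP.
Qed.

Lemma measurable_row_cons : measurable_fun [set: measurableTypeR R * 'rV[R]_n] row_cons.
Proof.
apply: (@measurability _ _ _ _ _ _ (@open 'rV[R]_n.+1)) => //.
move=> _ [A oA <-]; rewrite setTI.
pose D := [set t : rat * 'rV[rat]_n * nat |
  ball (row_cons (ratr t.1.1 : R, map_mx (@ratr R) t.1.2)) t.2.+1%:R^-1 `<=` A].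
have -> : row_cons @^-1` A = \bigcup_(t in D)
    (ball (ratr t.1.1 : R) t.2.+1%:R^-1 `*`
     ball (map_mx (@ratr R) t.1.2) t.2.+1%:R^-1).
  apply/seteqP; split => [p Ap|p [t Dt [p1 p2]]]; last first.
    by apply: Dt; exact/row_cons_ball.
  have /nbhs_ballP[e /= e0 eA] : nbhs (row_cons p) A by apply: open_nbhs_nbhs.
  have [k ke] : exists k : nat, k.+1%:R^-1 < e / 2.
    have e20 : 0 < e / 2 by rewrite divr_gt0.
    by have [k _ /(_ k (leqnn k))] := near_infty_natSinv_lt (PosNum e20); exists k.
  have k0 : 0 < k.+1%:R^-1 :> R by rewrite invr_gt0.
  have [||y [py [q _ qy]]] := @dense_rat R (ball (p.1 : R) k.+1%:R^-1).
  - by exists p.1; exact: ballxx.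
  - exact: ball_open.
  have [q' q'p] := dense_rat_rV p.2 k0.
  have cp : ball (ratr q : R) k.+1%:R^-1 p.1 by rewrite qy; exact: ball_sym.
  exists (q, q', k); last by split.
  move=> z cz; apply: eA; rewrite [e]splitr.
  apply: (@ball_triangle _ _ (row_cons (ratr q : R, map_mx (@ratr R) q'))).
    apply: ball_sym; apply: (le_ball (ltW ke)).
    exact/row_cons_ball.
  exact: (le_ball (ltW ke)).
rewrite bigcup_mkcond; apply: countable_bigcupT_measurable => // t.
case: ifPn => // _; apply: measurableX.
  by apply: open_measurable; exact: ball_open.
by apply: open_measurable_mx; exact: ball_open.
Qed.

Definition row_uncons (v : 'rV[R]_n.+1) : measurableTypeR R * 'rV[R]_n :=
  (v ord0 ord0, \row_j v ord0 (lift ord0 j)).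

Lemma row_consK : cancel row_cons row_uncons.
Proof.
move=> [x v]; rewrite /row_uncons /row_cons !mxE unlift_none; congr pair.
by apply/rowP => j; rewrite !mxE liftK.
Qed.

Lemma measurable_row_uncons : measurable_fun [set: 'rV[R]_n.+1] row_uncons.
Proof.
apply/measurable_fun_pairP; split.
  apply: (measurability _ (RGenOpens.measurableE R)).
  move=> _ [_ [a [b ->] <-]]; rewrite setTI; apply: open_measurable_mx.
  apply: open_comp; last exact: interval_open.
  by move=> x _; exact: coord_continuous.
apply: (@measurability _ _ _ _ _ _ (@open 'rV[R]_n)) => //.
move=> _ [A oA <-]; rewrite setTI; apply: open_measurable_mx.
apply: open_comp => // v _ B /nbhs_ballP[e /= e0 eB].
apply/nbhs_ballP; exists e => //= w [_ vw]; apply: eB; split => // i j.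
by rewrite !mxE.
Qed.

End row_cons.

Section row_cons_measure.
Context (R : realType) (n : nat).
Variable m : {sigma_finite_measure set 'rV[R]_n -> \bar R}.
Local Open Scope ereal_scope.

Definition row_cons_measure : set 'rV[R]_n.+1 -> \bar R :=
  pushforward (lebesgue_measure \x m) (@row_cons R n).

Let mrow := @measurable_row_cons R n.
Let p : {measure set 'rV[R]_n.+1 -> \bar R} :=
  measure_function_pushforward__canonical__measure_function_Measure
    (lebesgue_measure \x m) mrow.

Let row_cons_measure0 : row_cons_measure set0 = 0.
Proof. exact: (measure0 p). Qed.

Let row_cons_measure_ge0 A : 0 <= row_cons_measure A.
Proof. exact: (measure_ge0 p). Qed.

Let row_cons_measure_sigma_additive : semi_sigma_additive row_cons_measure.
Proof. exact: (@measure_semi_sigma_additive _ _ _ p). Qed.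

HB.instance Definition _ := isMeasure.Build _ _ _ row_cons_measure
  row_cons_measure0 row_cons_measure_ge0 row_cons_measure_sigma_additive.

Let row_cons_measure_sigma_finite : sigma_finite setT row_cons_measure.
Proof.
have /sigma_finiteP[F [TF ndF Foo]] := @sigma_finiteT _ _ R (@lebesgue_measure R).
have /sigma_finiteP[G [TG ndG Goo]] := sigma_finiteT m.
exists (fun k => @row_uncons R n @^-1` (F k `*` G k)).
  rewrite -preimage_bigcup [X in _ @^-1` X](_ : _ = setT) ?preimage_setT //.
  apply/seteqP; split => // -[x y] _.
  have [i _ Fx] : (\bigcup_i F i) x by rewrite -TF.
  have [j _ Gy] : (\bigcup_i G i) y by rewrite -TG.
  exists (maxn i j) => //; split.
    by move: x Fx; exact/subsetPset/ndF/leq_maxl.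
  by move: y Gy; exact/subsetPset/ndG/leq_maxr.
move=> k; have [mF Fk] := Foo k; have [mG Gk] := Goo k; split.
  rewrite -[X in measurable X]setTI; apply: measurable_row_uncons => //.
  exact: measurableX.
rewrite /row_cons_measure /pushforward -comp_preimage.
rewrite (_ : _ \o _ = id); last by apply/funext => x; exact: row_consK.
by rewrite preimage_id product_measure1E// lte_mul_pinfty// ge0_fin_numE.
Qed.

HB.instance Definition _ := Measure_isSigmaFinite.Build _ _ _ row_cons_measure
  row_cons_measure_sigma_finite.

End row_cons_measure.

Fixpoint lebesgue_rV (R : realType) (d : nat) :
    {sigma_finite_measure set 'rV[R]_d -> \bar R} :=
  match d with
  | 0 => \d_(0 : 'rV[R]_0)
  | d'.+1 => row_cons_measure (lebesgue_rV R d')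
  end.

Lemma lebesgue_rV_box (R : realType) (d : nat) (a b : 'rV[R]_d) :
  (forall i, a ord0 i <= b ord0 i) ->
  lebesgue_rV R d [set x | forall i, a ord0 i <= x ord0 i <= b ord0 i] =
  (\prod_i (b ord0 i - a ord0 i))%:E.
Proof.
elim: d a b => [|d IH] a b ab.
  by rewrite big_ord0 /= diracE mem_set // => -[].
pose a' : 'rV[R]_d := \row_j a ord0 (lift ord0 j).
pose b' : 'rV[R]_d := \row_j b ord0 (lift ord0 j).
pose B : set 'rV[R]_d := [set x | forall i, a' ord0 i <= x ord0 i <= b' ord0 i].
transitivity ((lebesgue_measure \x lebesgue_rV R d)%E
    (`[a ord0 ord0, b ord0 ord0]%classic `*` B)).
  rewrite /= /row_cons_measure /pushforward; congr (_ _).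
  apply/seteqP; split => [[x v] /= H|[x v] [/= H1 H2] i].
    split; first by have := H ord0; rewrite !mxE unlift_none /= in_itv.
    by move=> i; have := H (lift ord0 i); rewrite !mxE liftK.
  rewrite /row_cons !mxE; case: unliftP => [j|] -> //=.
  by have := H2 j; rewrite !mxE.
have mB : measurable B.
  rewrite [B](_ : _ = \bigcap_(i in [set: 'I_d]) ((fun x : 'rV[R]_d => x ord0 i)
      @^-1` `[a' ord0 i, b' ord0 i]%classic)); last first.
    apply/seteqP; split => x /= H i.
      by move=> _; have := H i; rewrite /= in_itv.
    by have := H i Logic.I; rewrite /= in_itv.
  apply: fin_bigcap_measurable => // i _.
  rewrite -[X in measurable X]setCK; apply: measurableC.
  apply: open_measurable_mx; rewrite preimage_setC; apply: open_comp.
    by move=> x _; exact: coord_continuous.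
  by rewrite openC; exact: interval_closed.
rewrite product_measure1E // IH; last by move=> i; rewrite !mxE.
rewrite /= lebesgue_measure_itv /= big_ord_recl lte_fin; case: ltP => [_|ba].
  rewrite -EFinB -EFinM; congr (_ * _)%:E.
  by apply: eq_bigr => i _; rewrite !mxE.
have -> : b ord0 ord0 = a ord0 ord0 by apply/eqP; rewrite eq_le ba ab.
by rewrite subrr mul0r mul0e.
Qed.

Section minkowski_content.
Context (R : realType) (d : nat).

Definition cube : set 'rV[R]_d := [set x | forall i, 0 <= x ord0 i <= 1].

Definition frontier (A : set 'rV[R]_d) : set 'rV[R]_d :=
  closure A `\` interior A.

(* The norm of ['rV[R]_d] is the maximum norm. *)
Definition neighbourhood (A : set 'rV[R]_d) (e : R) : set 'rV[R]_d :=
  [set x | exists2 a, A a & `|x - a| < e].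

Definition upper_content (A : set 'rV[R]_d) : \bar R :=
  limf_esup (fun e : R => lebesgue_rV R d (neighbourhood A e) * (e^-1)%:E)%E
    (0^'+).

End minkowski_content.
Arguments cube : clear implicits.

Section piecewise_expanding.
Context (R : realType) (d : nat).
Implicit Types (T S phi : 'rV[R]_d -> 'rV[R]_d) (U W M : set 'rV[R]_d).

Definition C1_on W S :=
  forall x, W x -> differentiable S x /\ {for x, continuous (jacobian S)}.

Definition C1_chart W phi :=
  [/\ open W, set_inj W phi, C1_on W phi &
      forall x, W x -> jacobian phi x \in unitmx].

(* Every point of M is in the domain of a chart that flattens M to the
   hyperplane [y_i = 0], or to the half-hyperplane [y_i = 0 <= y_j]: boundary
   points are allowed. *)
Definition C1_hypersurface M :=
  forall p, M p -> exists W phi, [/\ C1_chart W phi, W p & exists i : 'I_d,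
    (forall x, W x -> (M x <-> phi x ord0 i = 0)) \/
    (exists2 j : 'I_d, j != i & forall x, W x ->
      (M x <-> phi x ord0 i = 0 /\ 0 <= phi x ord0 j))].

Definition piecewise_C1_hypersurface M :=
  exists (N : nat) (P : 'I_N -> set 'rV[R]_d),
    (forall k, compact (P k) /\ C1_hypersurface (P k)) /\
    M = \bigcup_k P k.

Definition opnorm_diff T (x : 'rV[R]_d) : \bar R :=
  ereal_sup [set (`|'d T x z| / `|z|)%:E | z in [set z : 'rV[R]_d | z != 0]].

Definition piecewise_expanding T :=
  exists (Q : nat) (U : 'I_Q -> set 'rV[R]_d),
  [/\ [/\ forall i, [/\ U i !=set0, open (U i), connected (U i) &
                        U i `<=` cube R d],
          trivIset setT U &
          \bigcup_i closure (U i) = cube R d],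
      (forall i, set_inj (U i) T /\
         exists W S, [/\ open W, closure (U i) `<=` W, C1_on W S &
                         forall x, U i x -> S x = T x]) /\
      (exists2 L : R, 1 < L &
         forall i x, U i x -> (L%:E <= opnorm_diff T x)%E) &
      (forall i, exists2 M, piecewise_C1_hypersurface M &
                            frontier (U i) `<=` M) /\
      exists K : R, forall i, (upper_content (frontier (U i)) <= K%:E)%E].

End piecewise_expanding.

Section measure_properties.
Context (R : realType) (d : nat).
Variable mu : probability 'rV[R]_d R.
Implicit Types (T f : 'rV[R]_d -> 'rV[R]_d).

(* The completion of mu.  The values of T on the boundaries of the pieces and
   the sets in the definition of mixing below are arbitrary up to null sets, so
   the sets built from them are measurable for the completion only. *)
Definition completion : set 'rV[R]_d -> \bar R :=
  @completed_measure_extension _ _ R mu.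

Definition completion_measurable (A : set 'rV[R]_d) : Prop :=
  (mu^*)%mu.-cara.-measurable A.

Definition is_density (h : 'rV[R]_d -> R) :=
  [/\ measurable_fun (cube R d) h,
      forall x, cube R d x -> 0 <= h x &
      forall A, measurable A -> A `<=` cube R d ->
        mu A = (\int[lebesgue_rV R d]_(x in A) (h x)%:E)%E].

Definition invariant_measure T := forall A, measurable A -> A `<=` cube R d ->
  completion_measurable (cube R d `&` T @^-1` A) /\
  completion (cube R d `&` T @^-1` A) = mu A.

Definition exponentially_mixing T := forall C : set (set 'rV[R]_d),
  (forall E, C E -> E `<=` cube R d) ->
  (ereal_sup [set upper_content (frontier E) | E in C] < +oo)%E ->
  exists c tau : R, [/\ 0 < c, 0 < tau &
    forall F G, C F -> C G -> forall n : nat,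
      (`|completion (F `&` (cube R d `&` iter n T @^-1` G))
          - completion F * completion G|
        <= completion G * (c * expR (- (tau * n%:R)))%:E)%E].

Definition piecewise_lipschitz f :=
  exists (p : R) (N : nat) (U : 'I_N -> set 'rV[R]_d),
  [/\ 0 < p,
      forall j, completion_measurable (U j) /\ U j `<=` cube R d,
      completion (cube R d `\` \bigcup_j U j) = 0%E &
      forall j x y, U j x -> U j y -> `|f x - f y| <= p * `|x - y|].

Definition null_preimages f := forall A, measurable A -> A `<=` cube R d ->
  mu A = 0%E -> mu (cube R d `&` f @^-1` A) = 0%E.

End measure_properties.

Section recurrence.
Context (R : realType) (d : nat).
Implicit Types (T f : 'rV[R]_d -> 'rV[R]_d) (delta : nat -> R).

Definition hyperboloid (y : 'rV[R]_d) (r : R) : set 'rV[R]_d :=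
  [set y + z | z in [set z : 'rV[R]_d |
    (forall i, -1 <= z ord0 i <= 1) /\ `|\prod_i z ord0 i| < r]].

Definition recurrence_set T f delta : set 'rV[R]_d :=
  [set x | cube R d x /\
    infinite_set [set n | (0 < n)%N /\ hyperboloid (f x) (delta n) (iter n T x)]].

(* [ln 0 = 0], hence the value 0 at [r = 0]. *)
Definition log_weight (r : R) : R := r * (- ln r) ^+ d.-1.

End recurrence.

(* Main.v *)
Require Import Defs.
From HB Require Import structures.
From mathcomp Require Import all_boot all_order all_algebra.
From mathcomp Require Import all_classical all_reals all_analysis.
From mathcomp Require Import measurable_realfun.
From mathcomp Require Import ring lra zify.
Set Implicit Arguments.
Unset Strict Implicit.
Unset Printing Implicit Defensive.
Import Order.TTheory GRing.Theory Num.Theory.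
Import numFieldNormedType.Exports.
Local Open Scope classical_set_scope.
Local Open Scope ring_scope.

(** Write [pdist x y] for the product of the [|x_i - y_i|].  Inside the cube,
    [T^n x] lies in the hyperboloid around [f x] if and only if
    [pdist (T^n x) (f x) < delta n], and the set of the [y] in the cube with
    [pdist y v < t] has Lebesgue measure comparable to [log_weight d t]
    ([hyper_le], [corner_hyper_ge]).  The theorem is a Borel-Cantelli lemma for
    the events [E_n] that this happens at time [n].

    Reductions.  [T] is continuous on the open pieces, and these carry [mu]
    because their frontiers have finite content; so [T] has a Borel version, with
    the same orbits almost everywhere ([borel_map]), and the completion of [mu]
    disappears.  Each of the two conditions gives an open set of full measure
    where the density is bounded above and below and which contains [f x] for
    almost every [x].  It remains to treat separately the countably many sets
    [A] of points of one piece of [f] whose image is the vertex of a box of a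
    given size inside that open set.

    Mixing.  The dyadic cells have frontiers of bounded content, so the mixing
    hypothesis applies to them; its bound is additive in the second set, hence
    it extends from cells to all Borel sets ([mixing_measurable]):
    [|mu (Q :&: T^-n G) - mu Q mu G| <= c rho^n mu G] for every cell [Q].  On a
    cell of exponentially small side [f] is almost constant on [A], and there
    [E_n] is almost the event [T^n x \in G] for a fixed hyperbolic set [G].
    Summing over the cells gives [mu E_n] up to a factor [1 + o(1)].  Its upper
    bound and the first Borel-Cantelli lemma settle the convergent case
    ([negligible_infinitely_many_returns]).

    Divergent case.  Let [X_n] be the indicator of the [n]-th event minus the
    measure of the target of its cell, and [u n] a bound for the measures of the
    targets at time [n].  It suffices that the correlations of [X_m] and [X_n],
    [m <= n], are at most [u n] times errors with bounded sums over [m]: then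
    the sum of the [X_n] has a second moment of the order of the sum of the
    [u n], and by Chebyshev's inequality almost no point of [A] can miss almost
    all its targets ([negligible_never_hit]).  There are two ranges of times.
    - If [n] is less than a fixed multiple of [m], the cells used at time [n] are
      few compared with [rho^-m].  Decorrelate each cell from the pair of targets
      at times [m] and [n], then the targets from each other; for the latter,
      cover a hyperbolic set by cells: the excess is contained in a thin shell,
      and shells have small measure ([shell_le], [hyper_mixing]).
    - If [n] is larger, the [m]-th event is resolved by cells that are much finer
      and still few compared with [rho^-n].  Indeed [T] is Lipschitz on the
      pieces, so [m] iterations expand distances at most exponentially along
      the orbits that keep away from the frontiers of the pieces, and the other
      orbits have exponentially small measure since the frontiers have finite
      content ([unresolved_straddle], [pr_unresolved]).  Each fine cell then
      decorrelates from the target at time [n].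
    The levels of the cells are chosen in [level] so that the two ranges cover
    all pairs of times. *)

(** * Expectations of bounded functions *)

Section expectation.
Context d (X : measurableType d) (R : realType) (mu : probability X R).
Implicit Types (A B : set X) (F G : X -> R).

Definition pr A : R := fine (mu A).

Lemma prE A : measurable A -> mu A = (pr A)%:E.
Proof. by move=> mA; rewrite /pr fineK//; exact: fin_num_measure. Qed.

Lemma pr_ge0 A : 0 <= pr A.
Proof. exact: fine_ge0. Qed.

Lemma pr0 : pr set0 = 0. Proof. by rewrite /pr measure0. Qed.

Lemma le_pr A B : measurable A -> measurable B -> A `<=` B -> pr A <= pr B.
Proof.
move=> mA mB AB; rewrite -lee_fin -!prE//.
by apply: le_measure => //; rewrite inE.
Qed.

Lemma pr_le1 A : measurable A -> pr A <= 1.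
Proof. by move=> mA; rewrite -lee_fin -prE// probability_le1. Qed.

Lemma pr_setU A B : measurable A -> measurable B ->
  pr (A `|` B) <= pr A + pr B.
Proof.
move=> mA mB; rewrite -lee_fin EFinD -!prE//; last exact: measurableU.
exact: measureU2.
Qed.

Definition esp F : R := \int[mu]_x F x.

Definition bounded_mfun F :=
  measurable_fun setT F /\ exists K, forall x, `|F x| <= K.

Lemma bounded_mfun_integrable F : bounded_mfun F ->
  mu.-integrable setT (EFin \o F).
Proof.
move=> [mF [K FK]]; apply: measurable_bounded_integrable => //.
  by rewrite ltey_eq fin_num_measure.
exists K; split; first exact: num_real.
by move=> M KM x _ /=; exact: (le_trans (FK x) (ltW KM)).
Qed.

Lemma bounded_mfun_cst r : bounded_mfun (fun=> r).
Proof. by split => //; exists `|r|. Qed.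

Lemma bounded_mfunD F G : bounded_mfun F -> bounded_mfun G ->
  bounded_mfun (fun x => F x + G x).
Proof.
move=> [mF [K FK]] [mG [L GL]]; split; first exact: measurable_funD.
by exists (K + L) => x; rewrite (le_trans (ler_normD _ _))// lerD.
Qed.

Lemma bounded_mfunM F G : bounded_mfun F -> bounded_mfun G ->
  bounded_mfun (fun x => F x * G x).
Proof.
move=> [mF [K FK]] [mG [L GL]]; split; first exact: measurable_funM.
by exists (K * L) => x; rewrite normrM ler_pM.
Qed.

Lemma bounded_mfunB F G : bounded_mfun F -> bounded_mfun G ->
  bounded_mfun (fun x => F x - G x).
Proof.
move=> [mF [K FK]] [mG [L GL]]; split; first exact: measurable_funB.
by exists (K + L) => x; rewrite (le_trans (ler_normB _ _))// lerD.
Qed.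

Lemma bounded_mfun_indic A : measurable A -> bounded_mfun (\1_A).
Proof.
move=> mA; split; first exact: measurable_indic.
by exists 1 => x; rewrite indicE; case: (_ \in _); rewrite ?normr1 ?normr0.
Qed.

Lemma bounded_mfun_sum (J : Type) (s : seq J) (P : pred J) (F : J -> X -> R) :
  (forall j, bounded_mfun (F j)) ->
  bounded_mfun (fun x => \sum_(j <- s | P j) F j x).
Proof.
move=> bF; elim: s => [|j s IH].
  by under eq_fun do rewrite big_nil; exact: bounded_mfun_cst.
under eq_fun do rewrite big_cons; case: (P j) => //.
exact: bounded_mfunD.
Qed.

Lemma espD F G : bounded_mfun F -> bounded_mfun G ->
  esp (fun x => F x + G x) = esp F + esp G.
Proof. by move=> bF bG; rewrite /esp RintegralD//; exact: bounded_mfun_integrable. Qed.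

Lemma espB F G : bounded_mfun F -> bounded_mfun G ->
  esp (fun x => F x - G x) = esp F - esp G.
Proof. by move=> bF bG; rewrite /esp RintegralB//; exact: bounded_mfun_integrable. Qed.

Lemma espZ r F : bounded_mfun F -> esp (fun x => r * F x) = r * esp F.
Proof. by move=> bF; rewrite /esp RintegralZl//; exact: bounded_mfun_integrable. Qed.

Lemma esp_cst r : esp (fun=> r) = r.
Proof.
rewrite /esp Rintegral_cst// (_ : fine _ = 1) ?mulr1//.
by rewrite -[1]/(fine 1%E); congr fine; exact: probability_setT.
Qed.

Lemma esp_le F G : bounded_mfun F -> bounded_mfun G ->
  (forall x, F x <= G x) -> esp F <= esp G.
Proof.
by move=> bF bG FG; apply: le_Rintegral => //; exact: bounded_mfun_integrable.
Qed.

Lemma esp_indic A : measurable A -> esp (\1_A) = pr A.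
Proof. by move=> mA; rewrite /esp /Rintegral integral_indic// setIT. Qed.

Lemma esp_sum (J : Type) (s : seq J) (P : pred J) (F : J -> X -> R) :
  (forall j, bounded_mfun (F j)) ->
  esp (fun x => \sum_(j <- s | P j) F j x) = \sum_(j <- s | P j) esp (F j).
Proof.
move=> bF; elim: s => [|j s IH].
  rewrite big_nil; under eq_fun do rewrite big_nil.
  exact: esp_cst.
rewrite big_cons; under eq_fun do rewrite big_cons.
case: (P j) => //; rewrite espD//; last exact: bounded_mfun_sum.
by rewrite IH.
Qed.

Lemma esp_partition (J : finType) (g : X -> J) F :
  (forall j, measurable [set x | g x = j]) -> bounded_mfun F ->
  esp F = \sum_j esp (fun x => \1_[set x | g x = j] x * F x).
Proof.
move=> mg bF; rewrite -esp_sum; last first.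
  by move=> j; apply: bounded_mfunM => //; exact: bounded_mfun_indic.
congr esp; apply/funext => x; rewrite (bigD1 (g x))//= indicE mem_set//= mul1r.
rewrite big1 ?addr0// => j jx; rewrite indicE memNset ?mul0r//= => e.
by rewrite e eqxx in jx.
Qed.

Lemma pr_partition (J : finType) (g : X -> J) A :
  (forall j, measurable [set x | g x = j]) -> measurable A ->
  pr A = \sum_j pr ([set x | g x = j] `&` A).
Proof.
move=> mg mA; rewrite -esp_indic// (esp_partition mg); last exact: bounded_mfun_indic.
apply: eq_bigr => j _; rewrite -esp_indic; last exact: measurableI.
by congr esp; apply/funext => x; rewrite indicI.
Qed.

Lemma pr_le_esp_square F (t : R) A : bounded_mfun F -> 0 < t -> measurable A ->
  (forall x, A x -> t <= `|F x|) ->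
  pr A <= esp (fun x => F x * F x) / t ^+ 2.
Proof.
move=> bF t0 mA At; rewrite ler_pdivlMr ?exprn_gt0// mulrC -esp_indic//.
rewrite -espZ; last exact: bounded_mfun_indic.
apply: esp_le; [|exact: bounded_mfunM|].
  apply: bounded_mfunM; first exact: bounded_mfun_cst.
  exact: bounded_mfun_indic.
move=> x; rewrite indicE; case: (boolP (x \in A)) => xA; last first.
  by rewrite mulr0 -expr2 sqr_ge0.
rewrite mulr1 -expr2 -[leRHS]real_normK ?num_real// lerXn2r ?nnegrE//.
- exact: ltW.
- by apply: At; rewrite inE in xA.
Qed.

End expectation.

(** * Bounded partial sums *)

Section summable_real.
Context (R : realType).
Implicit Types u v : nat -> R.

Definition bounded_sums u := exists B, forall N, \sum_(0 <= n < N) u n <= B.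

Lemma bounded_sumsD u v : bounded_sums u -> bounded_sums v ->
  bounded_sums (fun n => u n + v n).
Proof.
move=> [B uB] [C vC]; exists (B + C) => N.
by rewrite big_split lerD.
Qed.

Lemma bounded_sumsZ (c : R) u : 0 <= c -> bounded_sums u ->
  bounded_sums (fun n => c * u n).
Proof.
move=> c0 [B uB]; exists (c * B) => N.
by rewrite -mulr_sumr ler_wpM2l.
Qed.

Lemma bounded_sums_le u v : (forall n, u n <= v n) -> bounded_sums v ->
  bounded_sums u.
Proof.
by move=> uv [B vB]; exists B => N; rewrite (le_trans _ (vB N))// ler_sum.
Qed.

Lemma bounded_sums_eventually u v M :
  (forall n, (M <= n)%N -> u n <= v n) -> bounded_sums v -> bounded_sums u.
Proof.
move=> uv [B vB]; exists (\sum_(0 <= n < M) (`|u n| + `|v n|) + `|B|) => N.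
have [NM|MN] := leqP N M.
  apply: ler_wpDr => //; rewrite [leRHS](@big_cat_nat _ _ _ N)//=.
  apply: ler_wpDr; first by apply: sumr_ge0 => i _; rewrite addr_ge0.
  by apply: ler_sum => i _; apply: ler_wpDr => //; exact: ler_norm.
have h1 : \sum_(M <= n < N) u n <= \sum_(M <= n < N) v n.
  rewrite !big_seq; apply: ler_sum => i.
  by rewrite mem_index_iota => /andP[Mi _]; exact: uv.
have h2 := le_trans (vB N) (ler_norm B); move: h2.
rewrite (@big_cat_nat _ _ _ M)//= ?(ltnW MN)// => h2.
rewrite (@big_cat_nat _ _ _ M)//= ?(ltnW MN)//.
have h3 : \sum_(0 <= n < M) u n <= \sum_(0 <= n < M) `|u n|.
  by apply: ler_sum => i _; exact: ler_norm.
have h4 : - \sum_(0 <= n < M) v n <= \sum_(0 <= n < M) `|v n|.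
  by rewrite -sumrN; apply: ler_sum => i _; rewrite -normrN ler_norm.
rewrite big_split /=; lra.
Qed.

Lemma bounded_sums_geometric (q : R) : 0 <= q < 1 -> bounded_sums (fun n => q ^+ n).
Proof.
move=> /andP[q0 q1]; exists ((1 - q)^-1) => N.
rewrite -[leRHS]div1r ler_pdivlMr ?subr_gt0//.
have := subrX1 q N; have := exprn_ge0 N q0.
by rewrite big_mkord; move: (q ^+ N) (\sum_(i < N) _) => a b a0 ab; lra.
Qed.

Lemma bounded_sums_floor (q : R) (l : nat) : (0 < l)%N -> 0 <= q < 1 ->
  bounded_sums (fun n => q ^+ (n %/ l)).
Proof.
case: l => // l _ q01.
have [B qB] := bounded_sums_geometric q01.
exists (l.+1%:R * B) => N; have /andP[q0 _] := q01.
apply: (@le_trans _ _ (\sum_(0 <= n < N * l.+1) q ^+ (n %/ l.+1))).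
  rewrite [leRHS](@big_cat_nat _ _ _ N)//=; last by rewrite leq_pmulr.
  by rewrite lerDl sumr_ge0// => i _; rewrite exprn_ge0.
have -> : \sum_(0 <= n < N * l.+1) q ^+ (n %/ l.+1) =
    \sum_(0 <= n < N) l.+1%:R * q ^+ n.
  elim: N => [|N IH]; first by rewrite mul0n !big_nil.
  rewrite (@big_cat_nat _ _ _ (N * l.+1))//=; last by rewrite leq_mul2r leqnSn orbT.
  rewrite IH [RHS]big_nat_recr//=; congr (_ + _).
  rewrite -{1}[(N * l.+1)%N]add0n big_addn mulSn addnK.
  rewrite (eq_big_nat _ _ (F2 := fun=> q ^+ N)); last first.
    by move=> i /andP[_ il]; rewrite addnC divnMDl// divn_small// addn0.
  by rewrite big_const_nat subn0 iter_addr addr0 mulr_natl.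
by rewrite -mulr_sumr ler_wpM2l.
Qed.

End summable_real.

(** * Second moments of counting functions of a mixing transformation *)

Section second_moment.
Context d (X : measurableType d) (R : realType) (mu : probability X R).
Variable T : X -> X.
Hypothesis mT : measurable_fun setT T.
Hypothesis muT : forall A, measurable A -> mu (T @^-1` A) = mu A.

Lemma measurable_iter n : measurable_fun setT (iter n T).
Proof.
elim: n => [|n IH]; first exact: measurable_id.
exact: (measurableT_comp mT IH).
Qed.

Lemma measurable_iter_preimage n A : measurable A ->
  measurable (iter n T @^-1` A).
Proof. by move=> mA; rewrite -[X in measurable X]setTI; exact: measurable_iter. Qed.

Lemma mu_iter n A : measurable A -> mu (iter n T @^-1` A) = mu A.
Proof.
elim: n A => [//|n IH] A mA.
have -> : iter n.+1 T @^-1` A = iter n T @^-1` (T @^-1` A) by [].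
rewrite IH ?muT//.
by rewrite -[X in measurable X]setTI; exact: mT.
Qed.

Variable I : nat -> finType.
Variable cell : forall k, X -> I k.
Arguments cell : clear implicits.
Hypothesis mcell : forall k q, measurable [set x | cell k x = q].
Hypothesis cell_refine : forall k K x y, (k <= K)%N ->
  cell K x = cell K y -> cell k x = cell k y.

Lemma sum_pr_cells K : \sum_(q : I K) pr mu [set x | cell K x = q] = 1.
Proof.
have := pr_partition mu (@mcell K) measurableT; rewrite {1}/pr probability_setT /= => ->.
by apply: eq_bigr => q _; rewrite setIT.
Qed.

(** Mixing concerns one cell at a time.  In a sum over the cells the errors add up,
    and [e n] bounds their total when the level is low compared with the time. *)
Variables phi e : nat -> R.
Hypothesis phi_ge0 : forall n, 0 <= phi n.
Hypothesis mixing : forall k (q : I k) n A, measurable A ->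
  `|pr mu ([set x | cell k x = q] `&` iter n T @^-1` A) -
    pr mu [set x | cell k x = q] * pr mu A| <= phi n * pr mu A.
Variables r b : nat.
Hypothesis card_cells : forall k n, (r * k <= n)%N -> #|I k|%:R * phi n <= e n.
Hypothesis e_ge0 : forall n, 0 <= e n.

(** The targets move with [x], but they are constant on cells, so that the mixing
    hypothesis applies to each cell with a fixed target. *)
Variable G : nat -> X -> set X.
Variable k : nat -> nat.
Hypothesis k_mono : {homo k : m n / (m <= n)%N >-> (m <= n)%N}.
Hypothesis k_near : forall m n, (n < r * b * m)%N -> (r * k n <= m)%N.
Hypothesis k_small : forall n, (r * k n <= n)%N.
Hypothesis k_b : forall n, (k n <= b * n)%N.
Hypothesis mG : forall n x, measurable (G n x).
Hypothesis G_cell : forall n x y, cell (k n) x = cell (k n) y -> G n x = G n y.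
Variables u psi a : nat -> R.
Hypothesis G_le : forall n x, pr mu (G n x) <= u n.
Hypothesis psi_ge0 : forall n, 0 <= psi n.
Hypothesis psi_mixing : forall m x n A, measurable A ->
  pr mu (G m x `&` iter n T @^-1` A) <= (pr mu (G m x) + psi n) * pr mu A.
(** Points of a cell of level [b * m] can disagree on the [m]-th event only inside
    the small set [B m]; away from it the event is a union of cells. *)
Variable D : set X.
Hypothesis mD : measurable D.
Hypothesis D_full : pr mu (~` D) = 0.
Variable B : nat -> set X.
Hypothesis mB : forall m, measurable (B m).
Hypothesis B_le : forall m, pr mu (B m) <= a m.

Definition hit n := [set x | G n x (iter n T x)].

Hypothesis B_straddle : forall K m x y, (b * m <= K)%N -> cell K x = cell K y ->
  D x -> D y -> hit m x -> ~ hit m y -> B m x /\ B m y.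

Let Q K q := [set x | cell K x = q].

Let u_ge0 n : 0 <= u n.
Proof. exact: (le_trans (pr_ge0 mu _) (G_le n point)). Qed.

(** The common target of the points of a cell; arbitrary if the cell is empty. *)
Let Gc n K (q : I K) : set X := G n (xget point (Q q)).

Let GcE n K (q : I K) x : (k n <= K)%N -> Q q x -> G n x = Gc n q.
Proof.
move=> nK qx; apply: G_cell; apply: (cell_refine nK).
have := @xgetPex _ point (Q q); rewrite /Q /= => ->; first exact: qx.
by exists x.
Qed.

Let hit_cell n K (q : I K) : (k n <= K)%N ->
  Q q `&` hit n = Q q `&` iter n T @^-1` Gc n q.
Proof.
by move=> nK; apply/seteqP; split => x [qx]; rewrite /hit /= (GcE nK qx).
Qed.

Lemma measurable_hit n : measurable (hit n).
Proof.
have -> : hit n = \bigcup_(q in [set: I (k n)]) (Q q `&` iter n T @^-1` Gc n q).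
  apply/seteqP; split => [x hx|x [q _]].
    by exists (cell (k n) x) => //; rewrite -hit_cell.
  by rewrite -hit_cell// => -[].
apply: fin_bigcup_measurable => //= q _; apply: measurableI; first exact: mcell.
by apply: measurable_iter_preimage; exact: mG.
Qed.

Let bounded_G n : bounded_mfun (fun x => pr mu (G n x)).
Proof.
have -> : (fun x => pr mu (G n x)) =
    (fun x => \sum_(q : I (k n)) \1_(Q q) x * pr mu (Gc n q)).
  apply/funext => x; rewrite (bigD1 (cell (k n) x))//= indicE mem_set//= mul1r.
  rewrite big1 ?addr0; last first.
    move=> q qx; rewrite indicE memNset ?mul0r//= => e'.
    by rewrite -e' eqxx in qx.
  by rewrite -(@GcE n (k n) _ x).
apply: bounded_mfun_sum => q; apply: bounded_mfunM.
  by apply: bounded_mfun_indic; exact: mcell.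
exact: bounded_mfun_cst.
Qed.

Definition centred n x := \1_(hit n) x - pr mu (G n x).

Lemma bounded_centred n : bounded_mfun (centred n).
Proof.
apply: bounded_mfunB => //; apply: bounded_mfun_indic; exact: measurable_hit.
Qed.

Let cov m n K (q : I K) :=
  pr mu (Q q `&` (hit m `&` hit n)) - pr mu (Gc n q) * pr mu (Q q `&` hit m)
  - pr mu (Gc m q) * pr mu (Q q `&` hit n)
  + pr mu (Gc m q) * pr mu (Gc n q) * pr mu (Q q).

Let esp_centred m n K : (k m <= K)%N -> (k n <= K)%N ->
  esp mu (fun x => centred m x * centred n x) = \sum_(q : I K) cov m n q.
Proof.
move=> mK nK; rewrite (esp_partition mu (@mcell K)); last exact: bounded_mfunM (bounded_centred _) (bounded_centred _).
apply: eq_bigr => q _.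
have mQ := mcell q; have mh := measurable_hit.
have b1 := bounded_mfun_indic R (measurableI _ _ mQ (measurableI _ _ (mh m) (mh n))).
have b2 := bounded_mfun_indic R (measurableI _ _ mQ (mh m)).
have b3 := bounded_mfun_indic R (measurableI _ _ mQ (mh n)).
have b4 := bounded_mfun_indic R mQ.
have bc c := @bounded_mfun_cst _ X R c.
rewrite /cov; set gm := pr mu (Gc m q); set gn := pr mu (Gc n q).
rewrite -!esp_indic; [|exact: mQ|exact: measurableI|exact: measurableI|
  by apply: measurableI => //; exact: measurableI].
rewrite -!espZ// -!espB -?espD//;
  do ?[exact: b1|exact: bounded_mfunM|apply: bounded_mfunB|apply: bounded_mfunD].
congr esp; apply/funext => x; rewrite /centred !indicI /= !indicE.
case: (boolP (x \in Q q)) => qx; last by rewrite /=; ring.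
rewrite inE in qx; rewrite (GcE mK qx) (GcE nK qx) -/gm -/gn.
by move: (_ \in hit m) (_ \in hit n) => [] []; ring.
Qed.


Let pr_hit n K (q : I K) : (k n <= K)%N ->
  `|pr mu (Q q `&` hit n) - pr mu (Q q) * pr mu (Gc n q)| <= phi n * pr mu (Gc n q).
Proof. by move=> nK; rewrite hit_cell//; apply: mixing; exact: mG. Qed.

Let prM_le n (x y : R) K (q : I K) : 0 <= x <= y -> x * pr mu (Gc n q) <= y * u n.
Proof.
move=> /andP[x0 xy]; apply: ler_pM => //; first exact: pr_ge0.
exact: G_le.
Qed.

(** Sum over the cells: the mixing errors add up to at most [e n]. *)
Lemma pr_hit_le n : pr mu (hit n) <= (1 + e n) * u n.
Proof.
have h0 := measurable_hit n.
rewrite (pr_partition mu (@mcell (k n)))//.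
apply: (@le_trans _ _ (\sum_(q : I (k n)) (pr mu (Q q) + phi n) * u n)).
  apply: ler_sum => q _.
  apply: (@le_trans _ _ ((pr mu (Q q) + phi n) * pr mu (Gc n q))).
    by have := pr_hit q (leqnn (k n)) => /ler_normlP[_]; lra.
  by apply: prM_le; rewrite lexx andbT addr_ge0// pr_ge0.
rewrite -mulr_suml; apply: ler_wpM2r => //.
rewrite big_split/= sum_pr_cells sumr_const -[_ *+ _]mulr_natl lerD2l.
exact: card_cells.
Qed.

Variable Psi : R.
Hypothesis psi_le : forall n, psi n <= Psi.

(** The case of close times: the two targets are first decorrelated from each
    other, and the pair is then decorrelated from the cell. *)
Let cov_near m n (q : I (k n)) : (m <= n)%N ->
  cov m n q <= (pr mu (Q q) * psi (n - m) + phi m * (2 + Psi) + phi n) * u n.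
Proof.
move=> mn; have km := k_mono mn.
have mQ := mcell q; have mGm := mG m (xget point (Q q)).
have mGn := mG n (xget point (Q q)).
rewrite -/(Gc m q) -/(Gc n q) in mGm mGn.
set A := Gc m q `&` iter (n - m) T @^-1` Gc n q.
have mA : measurable A by apply: measurableI => //; exact: measurable_iter_preimage.
have eA : Q q `&` (hit m `&` hit n) = Q q `&` iter m T @^-1` A.
  rewrite setIIr hit_cell// hit_cell// -setIIr /A preimage_setI; congr (_ `&` (_ `&` _)).
  by apply/funext => x; rewrite /= -iterD subnK.
have h1 := mixing q m mA; rewrite -/(Q q) -eA in h1.
have h2 : pr mu A <= _ := psi_mixing m (xget point (Q q)) (n - m) mGn.
rewrite -/(Gc m q) in h2.
have h3 := pr_hit q km.
have h4 := pr_hit q (leqnn (k n)).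
have p0 := pr_ge0 mu (Q q); have pm0 := pr_ge0 mu (Gc m q).
have pm1 := pr_le1 mu mGm; have pn0 := pr_ge0 mu (Gc n q).
have fm := phi_ge0 m; have fn := phi_ge0 n.
have s0 := psi_ge0 (n - m); have s1 := psi_le (n - m).
apply: (@le_trans _ _ ((pr mu (Q q) * psi (n - m) + phi m * (2 + Psi) + phi n)
    * pr mu (Gc n q))); last first.
  apply: ler_wpM2l; last exact: G_le.
  by rewrite !addr_ge0 ?mulr_ge0// addr_ge0// (le_trans s0).
rewrite /cov; move: h1 h2 h3 h4 => /ler_normlP[_ h1] h2 /ler_normlP[h3 _] /ler_normlP[h4 _].
set gm := pr mu (Gc m q) in h1 h2 h3 h4 pm0 pm1 *.
set gn := pr mu (Gc n q) in h1 h2 h3 h4 pn0 *.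
set p := pr mu (Q q) in h1 h2 h3 h4 p0 *.
set s := psi _ in h2 s0 s1 *.
have k1 : (p + phi m) * pr mu A <= (p + phi m) * ((gm + s) * gn).
  by apply: ler_wpM2l => //; exact: addr_ge0.
have k3 : gn * (p * gm - phi m * gm) <= gn * pr mu (Q q `&` hit m).
  by apply: ler_wpM2l => //; lra.
have k4 : gm * (p * gn - phi n * gn) <= gm * pr mu (Q q `&` hit n).
  by apply: ler_wpM2l => //; lra.
have k5 : phi m * gm * gn <= phi m * 1 * gn.
  by apply: ler_wpM2r => //; apply: ler_wpM2l.
have k6 : phi m * s * gn <= phi m * Psi * gn.
  by apply: ler_wpM2r => //; apply: ler_wpM2l.
have k7 : gm * (phi n * gn) <= 1 * (phi n * gn).
  by apply: ler_wpM2r => //; exact: mulr_ge0.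
lra.
Qed.

(** The case of distant times: the earlier event is a union of cells, up to
    the exceptional set [B m]. *)
Let cov_far m n K (q : I K) : (b * m <= K)%N -> (k n <= K)%N ->
  cov m n q <= (pr mu (Q q `&` B m) + 2 * phi n) * u n.
Proof.
move=> bmK nK; have mK : (k m <= K)%N := leq_trans (k_b m) bmK.
have mQ := mcell q; have mGm := mG m (xget point (Q q)).
have mGn := mG n (xget point (Q q)).
rewrite -/(Gc m q) -/(Gc n q) in mGm mGn.
have h4 := pr_hit q nK.
have p0 := pr_ge0 mu (Q q); have pm0 := pr_ge0 mu (Gc m q).
have pm1 := pr_le1 mu mGm; have pn0 := pr_ge0 mu (Gc n q).
have fn := phi_ge0 n; have pB0 := pr_ge0 mu (Q q `&` B m).
apply: (@le_trans _ _ ((pr mu (Q q `&` B m) + 2 * phi n) * pr mu (Gc n q))); last first.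
  by apply: ler_wpM2l; [rewrite addr_ge0// mulr_ge0|exact: G_le].
have mhm := measurable_hit m; have mhn := measurable_hit n.
have key : pr mu (Q q `&` (hit m `&` hit n)) - pr mu (Gc n q) * pr mu (Q q `&` hit m)
    <= (pr mu (Q q `&` B m) + phi n) * pr mu (Gc n q).
  move: h4 => /ler_normlP[_ h4].
  have offD A : measurable A -> (forall x, A x -> ~ D x) -> pr mu A = 0.
    move=> mA AD; apply/eqP; rewrite eq_le pr_ge0 andbT -D_full.
    by apply: le_pr => //; exact: measurableC.
  have mQmn : measurable (Q q `&` (hit m `&` hit n)).
    by apply: measurableI => //; exact: measurableI.
  have mQm : measurable (Q q `&` hit m) by exact: measurableI.
  have [[x [qx [Dx hx]]]|noh] := pselect (exists x, Q q x /\ D x /\ hit m x); last first.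
    rewrite (offD (Q q `&` (hit m `&` hit n)))//; last first.
      by move=> x [qx [hx _]] Dx; apply: noh; exists x.
    rewrite sub0r (@le_trans _ _ 0)//.
      by rewrite oppr_le0 mulr_ge0// pr_ge0.
    by rewrite mulr_ge0// addr_ge0.
  have [[y [qy [Dy hy]]]|allh] := pselect (exists y, Q q y /\ D y /\ ~ hit m y); last first.
    have sub : pr mu (Q q) <= pr mu (Q q `&` hit m).
      apply: (@le_trans _ _ (pr mu ((Q q `&` hit m) `|` ~` D))).
        apply: le_pr => //; first by apply: measurableU => //; exact: measurableC.
        move=> y qy; have [Dy|Dy] := pselect (D y); [left|by right]; split => //.
        by apply: contrapT => hy; apply: allh; exists y.
      by rewrite (le_trans (pr_setU _ _ _))// ?D_full ?addr0//; exact: measurableC.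
    have : pr mu (Q q `&` (hit m `&` hit n)) <= pr mu (Q q `&` hit n).
      by apply: le_pr => //; [exact: measurableI|move=> z [qz [_ ?]]].
    have : 0 <= pr mu (Q q `&` B m) * pr mu (Gc n q) by apply: mulr_ge0.
    have : pr mu (Gc n q) * pr mu (Q q) <= pr mu (Gc n q) * pr mu (Q q `&` hit m).
      exact: ler_wpM2l.
    lra.
  have sub : pr mu (Q q) <= pr mu (Q q `&` B m).
    apply: (@le_trans _ _ (pr mu ((Q q `&` B m) `|` ~` D))).
      apply: le_pr => //; first by apply: measurableU; [exact: measurableI|exact: measurableC].
      move=> z qz; have [Dz|Dz] := pselect (D z); [left|by right]; split => //.
      have [hz|hz] := pselect (hit m z).
        by case: (B_straddle (x := z) (y := y) bmK _ Dz Dy hz hy) => //; rewrite qz qy.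
      by case: (B_straddle (x := x) (y := z) bmK _ Dx Dz hx hz) => //; rewrite qz qx.
    by rewrite (le_trans (pr_setU _ _ _))// ?D_full ?addr0//;
      [exact: measurableI|exact: measurableC].
  have : pr mu (Q q) * pr mu (Gc n q) <= pr mu (Q q `&` B m) * pr mu (Gc n q).
    exact: ler_wpM2r.
  have : pr mu (Q q `&` (hit m `&` hit n)) <= pr mu (Q q `&` hit n).
    by apply: le_pr => //; [exact: measurableI|move=> z [qz [_ ?]]].
  have : 0 <= pr mu (Gc n q) * pr mu (Q q `&` hit m) by rewrite mulr_ge0// pr_ge0.
  lra.
have k4 : pr mu (Gc m q) * (pr mu (Q q) * pr mu (Gc n q) - phi n * pr mu (Gc n q))
    <= pr mu (Gc m q) * pr mu (Q q `&` hit n).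
  by apply: ler_wpM2l => //; move: h4 => /ler_normlP[]; lra.
have k7 : pr mu (Gc m q) * (phi n * pr mu (Gc n q)) <= 1 * (phi n * pr mu (Gc n q)).
  by apply: ler_wpM2r => //; exact: mulr_ge0.
rewrite /cov; lra.
Qed.

Let a_ge0 m : 0 <= a m.
Proof. exact: (le_trans (pr_ge0 mu (B m)) (B_le m)). Qed.

Let Psi_ge0 : 0 <= Psi.
Proof. exact: (le_trans (psi_ge0 0) (psi_le 0)). Qed.

Let esp_pair m n : (m <= n)%N ->
  esp mu (fun x => centred m x * centred n x) <=
  (psi (n - m) + (2 + Psi) * e m + a m + 2 * e n) * u n.
Proof.
move=> mn; have [near|far] := ltnP n (r * b * m).
  rewrite (esp_centred (K := k n))//; last exact: k_mono.
  apply: (@le_trans _ _ (\sum_(q : I (k n))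
      (pr mu (Q q) * psi (n - m) + phi m * (2 + Psi) + phi n) * u n)).
    by apply: ler_sum => q _; exact: cov_near.
  rewrite -mulr_suml; apply: ler_wpM2r => //.
  have -> : \sum_(q : I (k n)) (pr mu (Q q) * psi (n - m) + phi m * (2 + Psi) + phi n) =
      psi (n - m) + #|I (k n)|%:R * phi m * (2 + Psi) + #|I (k n)|%:R * phi n.
    rewrite !big_split/= -mulr_suml sum_pr_cells mul1r !sumr_const.
    by rewrite -mulrA !mulr_natl.
  have := card_cells (k_near near); have := card_cells (k_small n).
  have : 0 <= 2 + Psi by rewrite addr_ge0.
  move=> P2 hn hm.
  have : #|I (k n)|%:R * phi m * (2 + Psi) <= e m * (2 + Psi) by exact: ler_wpM2r.
  have := a_ge0 m; have := e_ge0 n.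
  lra.
pose K := maxn (b * m) (k n).
have rK : (r * K <= n)%N by rewrite /K maxnMr geq_max mulnA far k_small.
have bmK : (b * m <= K)%N by rewrite leq_maxl.
have nK : (k n <= K)%N by rewrite leq_maxr.
rewrite (esp_centred (K := K))//; last exact: leq_trans (k_b m) bmK.
apply: (@le_trans _ _ (\sum_(q : I K) (pr mu (Q q `&` B m) + 2 * phi n) * u n)).
  by apply: ler_sum => q _; exact: cov_far.
rewrite -mulr_suml; apply: ler_wpM2r => //.
rewrite big_split/= -(pr_partition mu (@mcell K))// sumr_const -[_ *+ _]mulr_natl.
have := card_cells rK; have := B_le m; have := e_ge0 m; have := psi_ge0 (n - m).
have : 0 <= (2 + Psi) * e m by rewrite mulr_ge0// addr_ge0.
lra.
Qed.

Let esp_square n : esp mu (fun x => centred n x * centred n x) <= (2 + e n) * u n.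
Proof.
have h0 := measurable_hit n.
apply: (@le_trans _ _ (esp mu (fun x => \1_(hit n) x + u n))).
  apply: esp_le; [exact: bounded_mfunM (bounded_centred _) (bounded_centred _)| |].
    apply: bounded_mfunD; [exact: bounded_mfun_indic|exact: bounded_mfun_cst].
  move=> x; rewrite /centred indicE; have := G_le n x; have := pr_ge0 mu (G n x).
  have := pr_le1 mu (mG n x).
  by case: (x \in hit n) => /= p1 p0 pu; nra.
rewrite espD; [|exact: bounded_mfun_indic|exact: bounded_mfun_cst].
rewrite esp_indic// esp_cst.
by have := pr_hit_le n; lra.
Qed.

Variables (Bpsi Be Ba En : R).
Hypothesis sum_psi : forall N, \sum_(0 <= n < N) psi n <= Bpsi.
Hypothesis sum_e : forall N, \sum_(0 <= n < N) e n <= Be.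
Hypothesis sum_a : forall N, \sum_(0 <= n < N) a n <= Ba.
Hypothesis ne_le : forall n, n%:R * e n <= En.

Let sub_sum (v : nat -> R) N n V : (forall i, 0 <= v i) ->
  \sum_(0 <= i < n) v i <= V -> \sum_(N <= i < n) v i <= V.
Proof.
move=> v0; apply: le_trans; have [nN|Nn] := leqP n N.
  by rewrite [leLHS]big_geq// sumr_ge0.
rewrite [leRHS](@big_cat_nat _ _ _ N)//= ?(ltnW Nn)// lerDr.
by apply: sumr_ge0.
Qed.

Definition centred_sum N M x := \sum_(N <= n < M) centred n x.

Lemma bounded_centred_sum N M : bounded_mfun (centred_sum N M).
Proof. by apply: bounded_mfun_sum => n; exact: bounded_centred. Qed.

Let C := 2 * (Bpsi + (2 + Psi) * Be + Ba + 2 * En) + (2 + Be).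

Let esp_sum_centred N n : (N <= n)%N ->
  esp mu (fun x => centred_sum N n x * centred n x) <=
  (Bpsi + (2 + Psi) * Be + Ba + 2 * En) * u n.
Proof.
move=> Nn.
have -> : (fun x => centred_sum N n x * centred n x) =
    (fun x => \sum_(N <= m < n) centred m x * centred n x).
  by apply/funext => x; rewrite mulr_suml.
rewrite esp_sum; last first.
  by move=> j; exact: bounded_mfunM (bounded_centred _) (bounded_centred _).
apply: (@le_trans _ _ (\sum_(N <= m < n)
   (psi (n - m) + (2 + Psi) * e m + a m + 2 * e n) * u n)).
  rewrite !big_nat; apply: ler_sum => m /andP[_ mn]; exact/esp_pair/ltnW.
rewrite -mulr_suml; apply: ler_wpM2r => //.
rewrite !big_split/= -mulr_sumr.
have : \sum_(N <= m < n) psi (n - m) <= Bpsi.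
  apply: (sub_sum (v := fun m => psi (n - m))) => //.
  rewrite big_nat_rev /= add0n.
  apply: (@le_trans _ _ (\sum_(0 <= m < n.+1) psi m)) => //.
  rewrite [leRHS]big_nat_recl// ler_wpDl// !big_nat; apply: ler_sum => m /andP[_ mn].
  by rewrite subKn.
have : (2 + Psi) * \sum_(N <= m < n) e m <= (2 + Psi) * Be.
  by apply: ler_wpM2l; [rewrite addr_ge0|exact: sub_sum].
have : \sum_(N <= m < n) a m <= Ba by exact: sub_sum.
have : \sum_(N <= m < n) 2 * e n <= 2 * En.
  rewrite -mulr_sumr; apply: ler_wpM2l => //.
  rewrite sumr_const_nat -mulr_natl (le_trans _ (ne_le n))//.
  by apply: ler_wpM2r => //; rewrite ler_nat leq_subr.
lra.
Qed.

Lemma esp_square_centred_sum N M : (N <= M)%N ->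
  esp mu (fun x => centred_sum N M x * centred_sum N M x) <=
  C * \sum_(N <= n < M) u n.
Proof.
move=> /subnKC <-; elim: (M - N)%N => [|j IH].
  rewrite addn0 /centred_sum; under eq_fun do rewrite big_geq// mul0r.
  by rewrite esp_cst big_geq// mulr0.
set n := (N + j)%N in IH *.
have Nn : (N <= n)%N by rewrite leq_addr.
rewrite addnS -/n [in leRHS]big_nat_recr//= mulrDr.
have bs := bounded_centred_sum N n; have bn := bounded_centred n.
have -> : (fun x => centred_sum N n.+1 x * centred_sum N n.+1 x) =
   (fun x => centred_sum N n x * centred_sum N n x +
     (2 * (centred_sum N n x * centred n x) + centred n x * centred n x)).
  by apply/funext => x; rewrite {1 2}/centred_sum big_nat_recr//= -/(centred_sum N n x); ring.
rewrite !espD ?espZ//; do ?[exact: bounded_mfunM|apply: bounded_mfunD];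
  try by apply: bounded_mfunM; [exact: bounded_mfun_cst|exact: bounded_mfunM].
rewrite lerD// /C.
have h1 := esp_sum_centred Nn; have h2 := esp_square n.
have h3 : e n <= Be.
  by apply: (le_trans _ (sum_e n.+1)); rewrite big_nat_recr//= lerDr sumr_ge0.
have h4 : e n * u n <= Be * u n by exact: ler_wpM2r.
lra.
Qed.

(** On [Z] the centred sum is minus the sum of the measures of the targets, hence
    at least [kappa * S] in absolute value, where [S] is the sum of the [u n],
    whereas its second moment is [O(S)]; let [S] tend to infinity in Chebyshev's
    inequality. *)
Lemma negligible_never_hit (Z : set X) (kappa : R) N : 0 < kappa ->
  ~ bounded_sums u ->
  (forall x n, Z x -> (N <= n)%N -> ~ hit n x /\ kappa * u n <= pr mu (G n x)) ->
  mu.-negligible Z.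
Proof.
move=> kappa0 uoo ZN.
have C0 : 0 <= C.
  have B0 : 0 <= Bpsi by have := sum_psi 0; rewrite big_nil.
  have B1 : 0 <= Be by have := sum_e 0; rewrite big_nil.
  have B2 : 0 <= Ba by have := sum_a 0; rewrite big_nil.
  have B3 : 0 <= En by have := ne_le 0; rewrite mul0r.
  have B4 : 0 <= (2 + Psi) * Be by rewrite mulr_ge0// addr_ge0.
  by rewrite /C; lra.
pose S M := \sum_(N <= n < M) u n.
pose W M := [set x | kappa * S M <= `|centred_sum N M x|].
have mW M : measurable (W M).
  rewrite -[X in measurable X]setTI.
  apply: (@measurable_fun_le _ _ _ setT (fun=> kappa * S M) (fun x => `|centred_sum N M x|)) => //.
  by apply: measurableT_comp => //; have [] := bounded_centred_sum N M.
have ZW M : Z `<=` W M.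
  move=> x Zx; rewrite /W /= /centred_sum.
  have -> : \sum_(N <= n < M) centred n x = - \sum_(N <= n < M) pr mu (G n x).
    rewrite -sumrN !big_nat; apply: eq_bigr => n /andP[Nn _].
    by rewrite /centred indicE memNset ?sub0r//; have [] := ZN _ _ Zx Nn.
  rewrite normrN ger0_norm; last by apply: sumr_ge0 => *; exact: pr_ge0.
  rewrite /S mulr_sumr !big_nat; apply: ler_sum => n /andP[Nn _].
  by have [] := ZN _ _ Zx Nn.
exists (\bigcap_M W M); split => //; first exact: bigcapT_measurable.
  apply/eqP; rewrite eq_le measure_ge0 andbT; apply/lee_addgt0Pr => eps eps0.
  rewrite add0e.
  have [M NM SM] : exists2 M, (N <= M)%N & C / (kappa ^+ 2 * eps) + 1 <= S M.
    apply: contrapT => H; apply: uoo.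
    exists (\sum_(0 <= n < N) u n + (C / (kappa ^+ 2 * eps) + 1)) => M.
    have h1 : 0 <= C / (kappa ^+ 2 * eps) + 1.
      by rewrite addr_ge0// divr_ge0// mulr_ge0 ?exprn_ge0 ?ltW.
    have [MN|NM] := leqP M N.
      rewrite [in leRHS](@big_cat_nat _ _ _ M)//= -addrA lerDl addr_ge0//.
      exact: sumr_ge0.
    rewrite (@big_cat_nat _ _ _ N)//= ?(ltnW NM)// lerD2l leNgt; apply/negP => h2.
    by apply: H; exists M; rewrite ?(ltnW NM)// ltW.
  have S0 : 0 < S M.
    by apply: (lt_le_trans _ SM); rewrite ltr_wpDl// divr_ge0// mulr_ge0 ?exprn_ge0 ?ltW.
  apply: (@le_trans _ _ (mu (W M))).
    apply: le_measure; rewrite ?inE//; first exact: bigcapT_measurable.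
    by move=> x; exact.
  rewrite (prE mu)// lee_fin.
  have kS : 0 < kappa * S M by exact: mulr_gt0.
  have cheb : pr mu (W M) <= _ := pr_le_esp_square mu (bounded_centred_sum N M) kS (mW M) (fun x Wx => Wx).
  apply: (le_trans cheb).
  rewrite ler_pdivrMr ?exprn_gt0//; apply: (le_trans (esp_square_centred_sum NM)).
  rewrite exprMn -/(S M) [S M ^+ 2]expr2 !mulrA; apply: ler_wpM2r; first exact: ltW.
  have : C / (kappa ^+ 2 * eps) <= S M by lra.
  rewrite ler_pdivrMr; last by rewrite mulr_gt0// exprn_gt0.
  lra.
by move=> x Zx M _; exact: ZW.
Qed.

End second_moment.

(** * From cells to measurable sets *)

Section approximation.
Context d (X : measurableType d) (R : realType) (mu : probability X R).
Variable I : nat -> finType.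
Variable cell : forall k, X -> I k.
Arguments cell : clear implicits.
Hypothesis mcell : forall k q, measurable [set x | cell k x = q].
Hypothesis cell_refine : forall k K x y, (k <= K)%N ->
  cell K x = cell K y -> cell k x = cell k y.

Definition saturated k (A : set X) :=
  forall x y, cell k x = cell k y -> A x -> A y.

Lemma saturated_mono k K A : (k <= K)%N -> saturated k A -> saturated K A.
Proof. by move=> kK sA x y xy; apply: sA; exact: (cell_refine kK). Qed.

Lemma saturated_measurable k A : saturated k A -> measurable A.
Proof.
move=> sA.
have -> : A = \bigcup_(q in [set q | exists2 x, A x & cell k x = q])
    [set x | cell k x = q].
  apply/seteqP; split => [x Ax|y [q [x Ax <-]] /= yx]; last exact: sA Ax.
  by exists (cell k x) => //; exists x.
by apply: fin_bigcup_measurable => [|q _]; [exact: finite_finset|exact: mcell].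
Qed.

(** With an exceptional set instead of a symmetric difference, the same witness
    serves for complements, unions and preimages. *)
Definition approximable (A : set X) := measurable A /\
  forall eps : R, 0 < eps -> exists k C N, [/\ saturated k C, measurable N,
    pr mu N <= eps & forall x, ~ N x -> (A x <-> C x)].

Lemma approximableC A : approximable A -> approximable (~` A).
Proof.
move=> [mA Aeps]; split => [|eps /Aeps[k [C [N [sC mN Neps AC]]]]].
  exact: measurableC.
exists k, (~` C), N; split => //.
  by move=> x y xy Cx Cy; apply: Cx; exact: sC Cy.
by move=> x /AC; rewrite /setC /= => ->.
Qed.

Lemma approximableU A B : approximable A -> approximable B ->
  approximable (A `|` B).
Proof.
move=> [mA Aeps] [mB Beps]; split => [|eps eps0]; first exact: measurableU.
have eps20 : 0 < eps / 2 by rewrite divr_gt0.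
have [k [C [N [sC mN Ne AC]]]] := Aeps _ eps20.
have [l [D [M [sD mM Me BD]]]] := Beps _ eps20.
exists (maxn k l), (C `|` D), (N `|` M); split.
- move=> x y xy [Cx|Dx]; [left|right].
    exact: (saturated_mono (leq_maxl k l) sC) Cx.
  exact: (saturated_mono (leq_maxr k l) sD) Dx.
- exact: measurableU.
- by rewrite (le_trans (pr_setU _ _ _))// [eps]splitr lerD.
- move=> x NMx; have nN : ~ N x by move=> ?; apply: NMx; left.
  have nM : ~ M x by move=> ?; apply: NMx; right.
  by split => -[] H; [left; apply/AC|right; apply/BD|left; apply/AC|right; apply/BD].
Qed.

Lemma approximable_bigcup (A : (set X)^nat) : (forall n, approximable (A n)) ->
  approximable (\bigcup_n A n).
Proof.
move=> aA; have mA n : measurable (A n) by have [] := aA n.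
have mU : measurable (\bigcup_n A n) by exact: bigcupT_measurable.
split => // eps eps0; have eps20 : 0 < eps / 2 by rewrite divr_gt0.
pose U n := \big[setU/set0]_(i < n) A i.
have aU n : approximable (U n).
  elim: n => [|n IH]; last by rewrite /U big_ord_recr; exact: approximableU.
  rewrite /U big_ord0; split => // e e0; exists 0%N, set0, set0; split => //.
  by rewrite pr0 ltW.
pose D n := (\bigcup_n A n) `\` U n.
have mUn n : measurable (U n) by have [] := aU n.
have mD n : measurable (D n) by exact: measurableD.
have UE n : U n = \bigcup_(i < n) A i by rewrite /U -bigcup_mkord.
have cvgD : mu (D n) @[n --> \oo] --> mu (\bigcap_n D n).
  apply: nonincreasing_cvg_mu => //.
  - by rewrite ltey_eq fin_num_measure.
  - exact: bigcapT_measurable.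
  - move=> m n mn; apply/subsetPset => x [Ax Unx]; split => //.
    move=> Ux; apply: Unx; move: Ux; rewrite !UE => -[i /= im Aix].
    by exists i => //=; exact: leq_trans mn.
have D0 : \bigcap_n D n = set0.
  rewrite -subset0 => x Dx; have [[i _ Aix] _] := Dx 0%N Logic.I.
  by have [_] := Dx i.+1 Logic.I; apply; rewrite UE; exists i => /=.
rewrite D0 measure0 in cvgD.
have [n _ /(_ n (leqnn n)) /= /ltW Dn] := cvgr_lt _ (fine_cvg cvgD) _ eps20.
have [_ /(_ _ eps20)[k [C [N [sC mN Ne UC]]]]] := aU n.
exists k, C, (N `|` D n); split => //; first exact: measurableU.
  rewrite (le_trans (pr_setU _ _ _))// [eps]splitr lerD//.
move=> x ND; have nN : ~ N x by move=> ?; apply: ND; left.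
have nD : ~ D n x by move=> ?; apply: ND; right.
rewrite -(UC _ nN); split => [Ax|Ux]; last by move: Ux; rewrite UE => -[i _ ?]; exists i.
by apply: contrapT => Ux; apply: nD; split.
Qed.

Lemma approximable_sigma_algebra : sigma_algebra setT approximable.
Proof.
split; last exact: approximable_bigcup.
- split => // e e0; exists 0%N, set0, set0; split => //.
  by rewrite pr0 ltW.
- by move=> A aA; rewrite setTD; exact: approximableC.
Qed.

Lemma approximable_null A B N : measurable A -> approximable B ->
  measurable N -> pr mu N = 0 -> (forall x, ~ N x -> (A x <-> B x)) ->
  approximable A.
Proof.
move=> mA [mB Be] mN N0 AB; split => // eps /Be[k [C [M [sC mM Me BC]]]].
exists k, C, (N `|` M); split => //; first exact: measurableU.
  by rewrite (le_trans (pr_setU _ _ _))// N0 add0r.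
move=> x NM; have nN : ~ N x by move=> ?; apply: NM; left.
by rewrite (AB _ nN); apply: BC => ?; apply: NM; right.
Qed.

Lemma saturated_approximable k A : saturated k A -> approximable A.
Proof.
move=> sA; split; first exact: saturated_measurable sA.
by move=> eps eps0; exists k, A, set0; split => //; rewrite pr0 ltW.
Qed.

Variable T : X -> X.
Hypothesis mT : measurable_fun setT T.
Hypothesis muT : forall A, measurable A -> mu (T @^-1` A) = mu A.
Hypothesis all_approximable : forall A, measurable A -> approximable A.

Let mit n A : measurable A -> measurable (iter n T @^-1` A) :=
  @measurable_iter_preimage _ _ _ mT n A.

(** For fixed [F] the bound is additive over disjoint sets of the second kind,
    hence it passes from cells to unions of cells, and then to limits. *)
Lemma mixing_measurable (F : set X) n (t : R) : 0 <= t -> measurable F ->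
  (forall k q, `|pr mu (F `&` iter n T @^-1` [set x | cell k x = q]) -
    pr mu F * pr mu [set x | cell k x = q]| <= t * pr mu [set x | cell k x = q]) ->
  forall A, measurable A ->
  `|pr mu (F `&` iter n T @^-1` A) - pr mu F * pr mu A| <= t * pr mu A.
Proof.
move=> t0 mF mix.
have sat k C : saturated k C ->
    `|pr mu (F `&` iter n T @^-1` C) - pr mu F * pr mu C| <= t * pr mu C.
  move=> sC; have mC := saturated_measurable sC.
  have mg q : measurable [set x | cell k (iter n T x) = q].
    exact: mit (mcell q).
  rewrite (pr_partition mu mg (measurableI _ _ mF (mit _ mC))).
  rewrite (pr_partition mu (@mcell k) mC) !mulr_sumr -sumrB.
  apply: (le_trans (ler_norm_sum _ _ _)); apply: ler_sum => q _.
  have [[x [/= qx Cx]]|nq] := pselect (exists x, cell k x = q /\ C x).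
    rewrite (_ : _ `&` C = [set x | cell k x = q]); last first.
      apply/seteqP; split => [y [] //|y /= yq]; split => //.
      by apply: sC Cx; rewrite qx.
    rewrite (_ : _ `&` (F `&` _) = F `&` iter n T @^-1` [set x | cell k x = q]) //.
    apply/seteqP; split => [y [? []] //|y [Fy /= yq]]; split => //; split => //=.
    by apply: sC Cx; rewrite qx yq.
  rewrite (_ : _ `&` C = set0); last first.
    by rewrite -subset0 => y [/= yq Cy]; apply: nq; exists y.
  rewrite (_ : _ `&` (F `&` _) = set0); last first.
    by rewrite -subset0 => y [/= yq [_ Cy]]; apply: nq; exists (iter n T y).
  by rewrite pr0 !mulr0 subrr normr0.
move=> A mA; apply/ler_addgt0Pr => eps eps0.
have t2 : 0 < t + 2 by apply: ltr_wpDl.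
have [_ /(_ (eps / (t + 2)) (divr_gt0 eps0 t2))[k [C [N [sC mN Ne AC]]]]] :=
  all_approximable mA.
have mC := saturated_measurable sC.
set dl := eps / (t + 2) in Ne.
have close B D M : measurable B -> measurable D -> measurable M ->
    (forall x, ~ M x -> (B x <-> D x)) -> pr mu B <= pr mu D + pr mu M.
  move=> mB mD mM BD; apply: (le_trans _ (pr_setU _ mD mM)).
  apply: le_pr => //; first exact: measurableU.
  by move=> x Bx; have [|nM] := pselect (M x); [right|left; apply/BD].
have h1 : pr mu A <= pr mu C + dl.
  by apply: (le_trans (close _ _ N mA mC mN AC)); rewrite lerD2l.
have h2 : pr mu C <= pr mu A + dl.
  apply: (le_trans (close _ _ N mC mA mN _)); last by rewrite lerD2l.
  by move=> x /AC [].
have pN : pr mu (iter n T @^-1` N) <= dl.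
  by rewrite /pr mu_iter.
have mFA := measurableI _ _ mF (mit n mA).
have mFC := measurableI _ _ mF (mit n mC).
have h3 : pr mu (F `&` iter n T @^-1` A) <= pr mu (F `&` iter n T @^-1` C) + dl.
  apply: (le_trans (close _ _ _ mFA mFC (mit n mN) _)); last by rewrite lerD2l.
  by move=> x /AC e; split => -[Fx /e].
have h4 : pr mu (F `&` iter n T @^-1` C) <= pr mu (F `&` iter n T @^-1` A) + dl.
  apply: (le_trans (close _ _ _ mFC mFA (mit n mN) _)); last by rewrite lerD2l.
  by move=> x /AC e; split => -[Fx /e].
have edl : eps = t * dl + 2 * dl by rewrite -mulrDl /dl mulrCA divff ?mulr1// gt_eqF.
have dl0 : 0 <= dl by exact: (le_trans (pr_ge0 _ _) Ne).
have F0 := pr_ge0 mu F; have F1 := pr_le1 mu mF.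
have h5 : pr mu F * pr mu A <= pr mu F * (pr mu C + dl) by exact: ler_wpM2l.
have h6 : pr mu F * pr mu C <= pr mu F * (pr mu A + dl) by exact: ler_wpM2l.
have h7 : pr mu F * dl <= 1 * dl by exact: ler_wpM2r.
have h8 : t * pr mu C <= t * (pr mu A + dl) by exact: ler_wpM2l.
have /ler_normlP[h9 h10] := sat _ _ sC.
by apply/ler_normlP; split; lra.
Qed.

End approximation.

(** * The maximum norm and dyadic cells *)

Section max_norm.
Context (R : realType) (d : nat).
Implicit Types (x y : 'rV[R]_d) (A : set 'rV[R]_d).

Lemma norm_rV_le x e : 0 <= e -> (forall i, `|x ord0 i| <= e) -> `|x| <= e.
Proof.
move=> e0 xe; rewrite [`|x|]mx_normrE.
by apply: bigmax_le => //= -[i j] _ /=; rewrite (ord1 i).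
Qed.

Lemma norm_coord_le x i : `|x ord0 i| <= `|x|.
Proof.
rewrite [`|x|]mx_normrE.
exact: (le_bigmax _ (fun ij : 'I_1 * 'I_d => `|x ij.1 ij.2|) (ord0, i)).
Qed.

Lemma ball_rVE x e : ball x e = [set y | `|x - y| < e].
Proof. by rewrite -ball_normE. Qed.

Lemma open_neighbourhood A e : open (neighbourhood A e).
Proof.
have -> : neighbourhood A e = \bigcup_(a in A) ball a e.
  apply/seteqP; split => [x [a Aa ax]|x [a Aa]]; rewrite ?ball_rVE.
    by exists a => //; rewrite ball_rVE /= distrC.
  by move=> /= ax; exists a => //; rewrite distrC.
by apply: bigcup_open => a _; exact: ball_open.
Qed.


Lemma continuous_measurable_rV (f : 'rV[R]_d -> R) : continuous f ->
  measurable_fun setT f.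
Proof.
move=> cf; apply: (measurability _ (RGenOpens.measurableE R)).
move=> _ [_ [a [b ->] <-]]; rewrite setTI; apply: open_measurable_mx.
by apply: open_comp; [move=> x _; exact: cf|exact: interval_open].
Qed.

Lemma measurable_coord (i : 'I_d) :
  measurable_fun setT (fun x : 'rV[R]_d => x ord0 i).
Proof. by apply: continuous_measurable_rV => x; exact: coord_continuous. Qed.

Lemma measurable_cube : measurable (cube R d).
Proof.
have -> : cube R d = \bigcap_(i in [set: 'I_d])
    ((fun x : 'rV[R]_d => x ord0 i) @^-1` `[0, 1]%classic).
  apply/seteqP; split => x /= H i; first by move=> _; have := H i; rewrite /= in_itv.
  by have := H i Logic.I; rewrite /= in_itv.
apply: fin_bigcap_measurable => // i _; rewrite -[X in measurable X]setTI.
exact: measurable_coord.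
Qed.

End max_norm.

Section dyadic_cells.
Context (R : realType) (d : nat).
Implicit Types (x y : 'rV[R]_d).

(** Points outside the cube are moved to it, so that the cells partition the
    whole space and refine one another without exception. *)
Definition clamp (t : R) : R := Num.max 0 (Num.min 1 t).

Lemma clamp_itv t : 0 <= clamp t <= 1.
Proof. by rewrite /clamp le_max lexx ge_max ler01 ge_min lexx. Qed.

Lemma clamp_id t : 0 <= t <= 1 -> clamp t = t.
Proof. by move=> /andP[t0 t1]; rewrite /clamp (min_idPr t1) (max_idPr t0). Qed.

Definition cell_index k := {ffun 'I_d -> 'I_(2 ^ k).+1}.

Definition dyadic_cell k x : cell_index k :=
  [ffun i => inord (Num.truncn (2 ^+ k * clamp (x ord0 i)))].

Lemma dyadic_cellP k x (q : cell_index k) : dyadic_cell k x = q <->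
  forall i, (q i)%:R <= 2 ^+ k * clamp (x ord0 i) < (q i).+1%:R.
Proof.
have c0 i : 0 <= 2 ^+ k * clamp (x ord0 i).
  by rewrite mulr_ge0 ?exprn_ge0//; have /andP[] := clamp_itv (x ord0 i).
have ck i : (Num.truncn (2 ^+ k * clamp (x ord0 i)) < (2 ^ k).+1)%N.
  rewrite truncn_lt_nat// -(natr1 (2 ^ k)%N) ltr_pwDr// natrX ler_piMr ?exprn_ge0//.
  by have /andP[] := clamp_itv (x ord0 i).
split=> [<- i|H].
  by rewrite ffunE inordK// truncn_itv.
apply/ffunP => i; rewrite ffunE; apply: val_inj; rewrite /= inordK//.
exact: truncn_def.
Qed.

Lemma measurable_dyadic_cell k (q : cell_index k) :
  measurable [set x | dyadic_cell k x = q].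
Proof.
have -> : [set x | dyadic_cell k x = q] = \bigcap_(i in [set: 'I_d])
   ((fun x : 'rV[R]_d => 2 ^+ k * clamp (x ord0 i)) @^-1`
     `[(q i)%:R, (q i).+1%:R[%classic).
  apply/seteqP; split => x /=.
    by move=> /dyadic_cellP H i _; rewrite /= in_itv /=; exact: H.
  by move=> H; apply/dyadic_cellP => i; have := H i Logic.I; rewrite /= in_itv.
apply: fin_bigcap_measurable => // i _; rewrite -[X in measurable X]setTI.
have mf : measurable_fun setT (fun x : 'rV[R]_d => 2 ^+ k * clamp (x ord0 i)).
  apply: measurable_funM => //; apply: measurable_maxr => //.
  by apply: measurable_minr => //; exact: measurable_coord.
exact: mf.
Qed.

Lemma dyadic_cell_refine k K x y : (k <= K)%N ->
  dyadic_cell K x = dyadic_cell K y -> dyadic_cell k x = dyadic_cell k y.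
Proof.
move=> kK xy; apply/esym/dyadic_cellP => i.
have /dyadic_cellP/(_ i) := erefl (dyadic_cell k x).
have /dyadic_cellP/(_ i) := xy.
have /dyadic_cellP/(_ i) := erefl (dyadic_cell K y).
set n := dyadic_cell k x i; set m := dyadic_cell K y i.
have -> : 2 ^+ K = 2 ^+ (K - k) * 2 ^+ k :> R by rewrite -exprD subnK.
set s := clamp (y ord0 i); set t := clamp (x ord0 i); set J := (K - k)%N.
rewrite -!mulrA; move: (2 ^+ k * s) (2 ^+ k * t) => {}s {}t.
rewrite -natrX => /andP[ms sm] /andP[mt tm] /andP[nt tn].
have J0 : 0 < (2 ^ J)%:R :> R by rewrite ltr0n expn_gt0.
have h1 : (2 ^ J * n < m.+1)%N.
  by rewrite -(ltr_nat R) natrM; apply: le_lt_trans tm; rewrite ler_pM2l.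
have h2 : (m < 2 ^ J * n.+1)%N.
  by rewrite -(ltr_nat R) natrM; apply: (le_lt_trans mt); rewrite ltr_pM2l.
rewrite -(ler_pM2l J0) -(ltr_pM2l J0) -!natrM; apply/andP; split.
  by apply: le_trans ms; rewrite ler_nat -ltnS.
by apply: (lt_le_trans sm); rewrite ler_nat.
Qed.

Lemma card_cell_index k : #|cell_index k| = ((2 ^ k).+1 ^ d)%N.
Proof. by rewrite card_ffun !card_ord. Qed.

Lemma norm_dyadic_cell k x y : cube R d x -> cube R d y ->
  dyadic_cell k x = dyadic_cell k y -> `|x - y| <= 2 ^- k.
Proof.
move=> cx cy xy; apply: norm_rV_le => [|i]; first by rewrite invr_ge0 exprn_ge0.
have /dyadic_cellP/(_ i) := xy.
have /dyadic_cellP/(_ i) := erefl (dyadic_cell k y).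
rewrite !clamp_id// => /andP[a1 a2] /andP[b1 b2].
rewrite !mxE ler_norml -(@ler_pM2l _ (2 ^+ k)) ?exprn_gt0//.
rewrite -[X in _ && X](@ler_pM2l _ (2 ^+ k)) ?exprn_gt0//.
rewrite mulrN divff ?expf_neq0 ?pnatr_eq0// mulrBr.
rewrite -(natr1 (dyadic_cell k y i)) in a2 b2; lra.
Qed.

Variable mu : probability 'rV[R]_d R.
Hypothesis mu_cube : mu (cube R d) = 1%E.

Lemma pr_setC_cube : pr mu (~` cube R d) = 0.
Proof.
rewrite /pr probability_setC; last exact: measurable_cube.
by rewrite mu_cube subee.
Qed.

(** Inside the cube an open set is the union of the cells that it contains. *)
Lemma approximable_borel (A : set 'rV[R]_d) : measurable A ->
  approximable mu dyadic_cell A.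
Proof.
have sA := approximable_sigma_algebra mu dyadic_cell_refine.
apply: (smallest_sub sA) => O oO.
pose S k := [set x | forall y, cube R d y ->
  dyadic_cell k x = dyadic_cell k y -> O y].
have mc := @measurable_cube R d.
apply: (@approximable_null _ _ _ _ _ _ _ (\bigcup_k S k) (~` cube R d)).
- exact: open_measurable_mx.
- apply: approximable_bigcup => // [|k]; first exact: dyadic_cell_refine.
  apply: (@saturated_approximable _ _ _ _ _ _ measurable_dyadic_cell k).
  by move=> x y xy Sx z cz yz; apply: Sx => //; rewrite xy.
- exact: measurableC.
- exact: pr_setC_cube.
- move=> x; rewrite /setC /= => /contrapT cx; split => [Ox|[k _ Sx]]; last first.
    exact: Sx.
  have /nbhs_ballP[e /= e0 eO] : nbhs x O by apply: open_nbhs_nbhs.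
  have [k ke] : exists k, 2 ^- k < e.
    have := cvg_geometric (1 : R) (_ : `|2^-1| < 1).
    rewrite ger0_norm ?invr_ge0// invf_lt1 ?ltr1n// => /(_ isT) /cvgr_lt /(_ _ e0).
    by move=> [k _ /(_ k (leqnn k))]; rewrite /geometric /= mul1r exprVn; exists k.
  exists k => // y cy xy; apply: eO; rewrite ball_rVE /=.
  exact: le_lt_trans (norm_dyadic_cell cx cy xy) ke.
Qed.

End dyadic_cells.

(** * Contents of the frontiers of cells *)

Lemma measure_le_fin_cover d (X : measurableType d) (R : realType)
    (nu : {measure set X -> \bar R}) (J : finType) (A : J -> set X) (B : set X) :
  (forall j, measurable (A j)) -> measurable B -> B `<=` \bigcup_j A j ->
  (nu B <= \sum_j nu (A j))%E.
Proof.
move=> mA mB BA.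
have H (s : seq J) : measurable (\big[setU/set0]_(j <- s) A j) /\
    (nu (\big[setU/set0]_(j <- s) A j) <= \sum_(j <- s) nu (A j))%E.
  elim: s => [|j s [IH1 IH2]]; first by rewrite !big_nil measure0.
  rewrite !big_cons; split; first exact: measurableU.
  by apply: (le_trans (measureU2 _ _ _)) => //; exact: leeD2l.
have [mU Ule] := H (index_enum J).
apply: le_trans Ule; apply: le_measure; rewrite ?inE//.
move=> x /BA[j _ Ajx]; rewrite (bigD1 j)//=; by left.
Qed.

Section content.
Context (R : realType) (d : nat).
Implicit Types (A : set 'rV[R]_d).
Local Notation m := (lebesgue_rV R d).

Lemma upper_content_le A (K : R) : 0 <= K ->
  (forall e, 0 < e < 1 -> (m (neighbourhood A e) <= (K * e)%:E)%E) ->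
  (upper_content A <= K%:E)%E.
Proof.
move=> K0 AK; apply: ge_ereal_inf.
exists (ereal_sup [set (m (neighbourhood A e) * (e^-1)%:E)%E | e in `]0, 1[%classic]).
  exists `]0, 1[%classic => //; exists 1 => //= e /=.
  by rewrite sub0r normrN in_itv /= => e1 e0; rewrite e0 (le_lt_trans (ler_norm _) e1).
apply: ge_ereal_sup => _ [e /= e01 <-]; rewrite in_itv /= in e01.
have e0 : 0 < e by have /andP[] := e01.
rewrite -lee_pdivlMr ?invr_gt0// invrK -EFinM; exact: AK.
Qed.

Lemma upper_content_bound A (K : R) : (upper_content A <= K%:E)%E ->
  exists2 e0, 0 < e0 & forall e, 0 < e < e0 ->
    (m (neighbourhood A e) <= ((K + 1) * e)%:E)%E.
Proof.
move=> AK; have /ereal_inf_lt[_ [V FV <-] VK] : (upper_content A < (K + 1)%:E)%E.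
  by apply: (le_lt_trans AK); rewrite lte_fin ltrDl.
have [e0 /= e00 He] := FV.
exists e0 => // e /andP[e_gt0 ee0]; have Ve : V e.
  by apply: He => //=; rewrite sub0r normrN gtr0_norm.
have : (m (neighbourhood A e) * (e^-1)%:E <= (K + 1)%:E)%E.
  apply: le_trans (ltW VK); apply: ereal_sup_ubound; exists e => //.
by rewrite -lee_pdivlMr ?invr_gt0// -EFinM mulrC invrK mulrC.
Qed.

Lemma measurable_box (a b : 'I_d -> R) :
  measurable [set x : 'rV[R]_d | forall i, a i <= x ord0 i <= b i].
Proof.
have -> : [set x : 'rV[R]_d | forall i, a i <= x ord0 i <= b i] =
    \bigcap_(i in [set: 'I_d])
    ((fun x : 'rV[R]_d => x ord0 i) @^-1` `[a i, b i]%classic).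
  apply/seteqP; split => x /= H i; first by move=> _; have := H i; rewrite /= in_itv.
  by have := H i Logic.I; rewrite /= in_itv.
apply: fin_bigcap_measurable => // i _; rewrite -[X in measurable X]setTI.
exact: measurable_coord.
Qed.

Definition slab (i : 'I_d) (c e : R) := [set x : 'rV[R]_d |
  forall j, (if j == i then c - e else -1) <= x ord0 j <=
            (if j == i then c + e else 2)].

Lemma lebesgue_slab i c e : 0 <= e -> (m (slab i c e) <= (3 ^+ d * (2 * e))%:E)%E.
Proof.
move=> e0.
pose a : 'rV[R]_d := \row_j if j == i then c - e else -1.
pose b : 'rV[R]_d := \row_j if j == i then c + e else 2.
have -> : slab i c e = [set x | forall j, a ord0 j <= x ord0 j <= b ord0 j].
  by apply/seteqP; split => x /= H j; have := H j; rewrite !mxE.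
rewrite lebesgue_rV_box; last by move=> j; rewrite !mxE; case: eqP => _; lra.
rewrite lee_fin (bigD1 i)//= !mxE eqxx mulrC.
have -> : c + e - (c - e) = 2 * e by ring.
apply: ler_wpM2r; first by rewrite mulr_ge0.
apply: (@le_trans _ _ (\prod_(j < d | j != i) 3)).
  apply: ler_prod => j ji; rewrite !mxE (negbTE ji); lra.
rewrite prodr_const; apply: ler_weXn2l; first by rewrite ler1n.
by rewrite -[leqRHS](card_ord d) max_card.
Qed.

(** The frontier of a cell lies in the union of [2 * d] hyperplanes. *)
Lemma frontier_cell_content k (q : cell_index d k) :
  (upper_content (frontier (cube R d `&` [set x | dyadic_cell k x = q])) <=
   (4 * d%:R * 3 ^+ d)%:E)%E.
Proof.
set E := cube R d `&` _.
pose lo (i : 'I_d) : R := Num.max 0 ((q i)%:R / 2 ^+ k).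
pose hi (i : 'I_d) : R := Num.min 1 ((q i).+1%:R / 2 ^+ k).
have k0 : 0 < 2 ^+ k :> R by rewrite exprn_gt0.
have Ein (x : 'rV[R]_d) : (forall i, lo i <= x ord0 i < hi i) -> E x.
  move=> H; have cx : cube R d x.
    move=> i; have /andP[] := H i; rewrite /lo /hi ge_max lt_min.
    by move=> /andP[-> _] /andP[/ltW -> _].
  split => //=; apply/dyadic_cellP => i; rewrite clamp_id//.
  have /andP[] := H i; rewrite /lo /hi ge_max lt_min => /andP[_ h1] /andP[_ h2].
  by rewrite mulrC -ler_pdivrMr// h1 -ltr_pdivlMr.
have Esub : E `<=` [set x : 'rV[R]_d | forall i, lo i <= x ord0 i <= hi i].
  move=> x [cx /= /dyadic_cellP xq] i; have := xq i; rewrite clamp_id//.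
  rewrite mulrC -ler_pdivrMr// -ltr_pdivlMr// /lo /hi ge_max le_min.
  by have /andP[-> ->] := cx i => /andP[-> /ltW ->].
have cC : closed [set x : 'rV[R]_d | forall i, lo i <= x ord0 i <= hi i].
  have -> : [set x : 'rV[R]_d | forall i, lo i <= x ord0 i <= hi i] =
    \bigcap_(i in [set: 'I_d])
    ((fun x : 'rV[R]_d => x ord0 i) @^-1` `[lo i, hi i]%classic).
    apply/seteqP; split => x /= H i; first by move=> _; have := H i; rewrite /= in_itv.
    by have := H i Logic.I; rewrite /= in_itv.
  apply: closed_bigI => i _; apply: preimage_closed; last exact: interval_closed.
  by move=> x _; exact: coord_continuous.
have fr x : frontier E x -> exists i (b : bool),
    x ord0 i = (if b then lo i else hi i) /\ forall j, lo j <= x ord0 j <= hi j.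
  move=> [cx ix]; have Cx : forall j, lo j <= x ord0 j <= hi j.
    by have := closure_subset Esub cx; move/closure_id : cC => <-.
  apply: contrapT => no; apply: ix; rewrite /interior /=.
  suff : nbhs x (fun y : 'rV[R]_d => forall i, lo i <= y ord0 i < hi i).
    by apply: filterS => y; exact: Ein.
  apply: (@filter_forall _ 'I_d (fun i (y : 'rV[R]_d) => lo i <= y ord0 i < hi i) (nbhs x) (nbhs_filter x)) => i.
  have xi : x ord0 i \in `]lo i, hi i[.
    rewrite in_itv /= !lt_neqAle; have /andP[-> ->] := Cx i; rewrite !andbT.
    by apply/andP; split; apply/negP => /eqP e; apply: no; exists i;
      [exists true|exists false].
  have : \forall t \near x ord0 i, lo i <= t < hi i.
    have : nbhs (x ord0 i) `]lo i, hi i[%classic.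
      by apply: open_nbhs_nbhs; split; [exact: interval_open|].
    by apply: filterS => t; rewrite /= in_itv /= => /andP[/ltW -> ->].
  exact: (@coord_continuous _ _ _ ord0 i x).
apply: upper_content_le; first by rewrite !mulr_ge0 ?exprn_ge0.
move=> e /andP[e0 e1].
pose A (p : 'I_d * bool) := slab p.1 (if p.2 then lo p.1 else hi p.1) e.
have mA p : measurable (A p) by exact: measurable_box.
apply: (le_trans (measure_le_fin_cover _ mA _ _)).
- by apply: open_measurable_mx; exact: open_neighbourhood.
- move=> y [x /fr[i [b [xb xC]]] xy]; exists (i, b) => // j /=.
  have : `|y ord0 j - x ord0 j| < e.
    by apply: le_lt_trans xy; have := norm_coord_le (y - x) j; rewrite !mxE.
  rewrite ltr_norml => /andP[h1 h2]; case: eqP => [ji|_].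
    by rewrite ji in h1 h2 *; rewrite -xb; apply/andP; split; lra.
  have := xC j; rewrite /lo /hi ge_max le_min => /andP[/andP[h3 _] /andP[h4 _]].
  by apply/andP; split; lra.
apply: (@le_trans _ _ (\sum_(p : 'I_d * bool) (3 ^+ d * (2 * e))%:E)%E).
  by apply: lee_sum => p _; apply: lebesgue_slab; exact: ltW.
rewrite sumEFin lee_fin sumr_const card_prod card_ord card_bool.
by rewrite -[_ *+ (d * 2)]mulr_natr natrM; lra.
Qed.

End content.

(** * Passage to a Borel version of the map *)

Section completion.
Context (R : realType) (d : nat) (mu : probability 'rV[R]_d R).
Implicit Types A B N : set 'rV[R]_d.

Lemma completion_borel A : measurable A -> completion mu A = mu A.
Proof. by move=> mA; rewrite /completion /completed_measure_extension measurable_mu_extE. Qed.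

Lemma completion_ae A B N : measurable B -> measurable N -> mu N = 0%E ->
  (forall x, ~ N x -> (A x <-> B x)) ->
  completion_measurable mu A /\ completion mu A = mu B.
Proof.
move=> mB mN N0 AB.
have muN0 : mu^*%mu N = 0%E by rewrite measurable_mu_extE.
have le0 D : D `<=` N -> mu^*%mu D = 0%E.
  move=> DN; apply/eqP; rewrite eq_le outer_measure_ge0 andbT -muN0.
  exact: le_outer_measure.
have AE : A = (B `\` N) `|` (A `&` N).
  apply/seteqP; split => [x Ax|x [[Bx /AB]|[]//]]; last by move=> ->.
  by have [Nx|Nx] := pselect (N x); [right|left; split => //; apply/AB].
split.
  rewrite /completion_measurable AE; apply: caratheodory_measurable_setU.
    by apply: caratheodory_measurable_mu_ext; exact: measurableD.
  apply: le_caratheodory_measurable => X.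
  apply: (@le_trans _ _ (0 + mu^*%mu X)%E); last by rewrite add0e.
  apply: leeD; last exact: le_outer_measure.
  have h := le0 (X `&` (A `&` N)) (fun x H => proj2 (proj2 H)).
  by rewrite le_eqVlt; apply/orP; left; apply/eqP; exact: h.
rewrite /completion /completed_measure_extension -(measurable_mu_extE _ mB).
apply/eqP; rewrite eq_le; apply/andP; split.
  apply: (@le_trans _ _ (mu^*%mu (B `|` N))).
    apply: le_outer_measure => x Ax; have [Nx|Nx] := pselect (N x); first by right.
    by left; apply/AB.
  have h : (mu^*%mu (B `|` N) <= mu^*%mu B + mu^*%mu N)%E by exact: outer_measureU2.
  by rewrite muN0 adde0 in h.
apply: (@le_trans _ _ (mu^*%mu (A `|` N))).
  apply: le_outer_measure => x Ax; have [Nx|Nx] := pselect (N x); first by right.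
  by left; apply/AB.
have h : (mu^*%mu (A `|` N) <= mu^*%mu A + mu^*%mu N)%E by exact: outer_measureU2.
by rewrite muN0 adde0 in h.
Qed.

End completion.

Section borel_version.
Context (R : realType) (d : nat) (mu : probability 'rV[R]_d R).
Hypothesis mu_cube : mu (cube R d) = 1%E.
Variables (Q : nat) (U : 'I_Q -> set 'rV[R]_d) (T : 'rV[R]_d -> 'rV[R]_d).
Hypothesis T_cube : set_fun (cube R d) (cube R d) T.
Hypothesis U_open : forall i, open (U i).
Hypothesis U_cube : forall i, U i `<=` cube R d.
Hypothesis T_continuous : forall i x, U i x -> {for x, continuous T}.
Hypothesis U_full : mu (cube R d `\` \bigcup_i U i) = 0%E.

(** [T] is continuous on the open pieces, which carry [mu]: this version of [T] is
    Borel, and it preserves [mu]. *)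
Definition borel_map x : 'rV[R]_d := if x \in \bigcup_i U i then T x else 0.

Lemma borel_mapE i x : U i x -> borel_map x = T x.
Proof. by move=> Ux; rewrite /borel_map mem_set//; exists i. Qed.

Lemma borel_map_cube x : cube R d (borel_map x).
Proof.
rewrite /borel_map; case: ifPn => [|_ i]; last by rewrite mxE lexx ler01.
by rewrite inE => -[i _ /U_cube]; exact: T_cube.
Qed.

Let mU : measurable (\bigcup_i U i).
Proof. by apply: fin_bigcup_measurable => // i _; exact: open_measurable_mx. Qed.

Lemma measurable_borel_map : measurable_fun setT borel_map.
Proof.
apply: (@measurability _ _ _ _ _ _ (@open 'rV[R]_d)) => //.
move=> _ [A oA <-]; rewrite setTI.
have -> : borel_map @^-1` A = (\bigcup_i (U i `&` T @^-1` A)) `|`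
    (~` (\bigcup_i U i) `&` [set _ | A 0]).
  apply/seteqP; split => [x|x [[i _ [Ux Tx]]|[/= nU A0]]].
  - rewrite /preimage /= /borel_map; case: ifPn => [|/negP nU A0].
      by rewrite inE => -[i _ Ux] Tx; left; exists i.
    by right; split => //= UX; apply: nU; rewrite inE.
  - by rewrite /preimage /= (borel_mapE Ux).
  - by rewrite /preimage /= /borel_map memNset.
apply: measurableU; last first.
  apply: measurableI; first exact: measurableC.
  have [A0|nA0] := pselect (A 0).
    by rewrite (_ : [set _ | _] = setT)//; apply/seteqP; split.
  by rewrite (_ : [set _ | _] = set0)//; apply/seteqP; split.
apply: fin_bigcup_measurable => // i _; apply: open_measurable_mx.
rewrite openE => x [Ux Ax]; rewrite /interior /=.
apply: filterI; first by apply: open_nbhs_nbhs.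
by apply: (T_continuous Ux); apply: open_nbhs_nbhs.
Qed.

Hypothesis T_invariant : invariant_measure mu T.

Let N := ~` (cube R d `&` \bigcup_i U i).

Let mc := @measurable_cube R d.

Let mN : measurable N.
Proof. by apply: measurableC; exact: measurableI. Qed.

Let N0 : mu N = 0%E.
Proof.
apply/eqP; rewrite eq_le measure_ge0 andbT.
apply: (@le_trans _ _ (mu (~` cube R d `|` (cube R d `\` \bigcup_i U i)))).
  apply: le_measure; rewrite ?inE//.
    by apply: measurableU; [exact: measurableC|exact: measurableD].
  move=> x; rewrite /N setCI => -[nc|nU]; first by left.
  by have [cx|cx] := pselect (cube R d x); [right|left].
have h : (mu (~` cube R d `|` (cube R d `\` \bigcup_i U i)) <=
    mu (~` cube R d) + mu (cube R d `\` \bigcup_i U i))%E.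
  by apply: measureU2; [exact: measurableC|exact: measurableD].
by apply: (le_trans h); rewrite U_full adde0 probability_setC// mu_cube subee.
Qed.

Let borel_map_T x : ~ N x -> cube R d x /\ borel_map x = T x.
Proof. by move=> /contrapT[cx [i _ Ux]]; split => //; exact: borel_mapE Ux. Qed.

Lemma mu_borel_map A : measurable A -> mu (borel_map @^-1` A) = mu A.
Proof.
move=> mA.
have mAc : measurable (A `&` cube R d) by exact: measurableI.
have mT' B : measurable B -> measurable (borel_map @^-1` B).
  by move=> mB; rewrite -[X in measurable X]setTI; exact: measurable_borel_map.
have [_ inv] := T_invariant mAc (@subIsetr _ A (cube R d)).
have [|_ e1] := @completion_ae _ _ mu (cube R d `&` T @^-1` (A `&` cube R d))
  (borel_map @^-1` A) N (mT' _ mA) mN N0.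
  move=> x Nx; have [cx e] := borel_map_T Nx.
  rewrite /preimage /= e; split => [[_ []]//|Ax]; do ?split => //.
  exact: T_cube.
rewrite -e1 inv; apply/eqP; rewrite eq_le; apply/andP; split.
  by apply: le_measure; rewrite ?inE.
apply: (@le_trans _ _ (mu ((A `&` cube R d) `|` ~` cube R d))).
  apply: le_measure; rewrite ?inE//.
    by apply: measurableU => //; exact: measurableC.
  by move=> x Ax; have [cx|cx] := pselect (cube R d x); [left|right].
have h : (mu ((A `&` cube R d) `|` ~` cube R d) <=
    mu (A `&` cube R d) + mu (~` cube R d))%E.
  by apply: measureU2 => //; exact: measurableC.
by apply: (le_trans h); rewrite probability_setC// mu_cube subee// adde0.
Qed.

(** Outside this set the orbits under [T] and [borel_map] agree, and they stay
    in the pieces. *)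
Definition irregular := \bigcup_n (iter n borel_map @^-1` N).

Let mit n A : measurable A -> measurable (iter n borel_map @^-1` A) :=
  @measurable_iter_preimage _ _ _ measurable_borel_map n A.

Lemma measurable_irregular : measurable irregular.
Proof. by apply: bigcupT_measurable => n; exact: mit. Qed.

Lemma mu_irregular : mu irregular = 0%E.
Proof.
apply/eqP; rewrite eq_le measure_ge0 andbT.
have h := measure_sigma_subadditive mu (fun n => mit n mN) measurable_irregular
  (@subset_refl _ irregular).
apply: (le_trans h); rewrite eseries0// => n _ _ /=.
by rewrite (mu_iter measurable_borel_map mu_borel_map)// N0.
Qed.

Lemma iter_borel_map x n : ~ irregular x ->
  [/\ iter n T x = iter n borel_map x, cube R d (iter n borel_map x) &
      exists i, U i (iter n borel_map x)].
Proof.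
move=> nx; have reg k : ~ N (iter k borel_map x).
  by move=> Nk; apply: nx; exists k.
split; [|by have [] := borel_map_T (reg n)|].
  elim: n => [//|n IH]; rewrite /= IH.
  by have [_ ->] := borel_map_T (reg n).
by have := reg n => /contrapT[_ [i _ Ui]]; exists i.
Qed.

Hypothesis T_mixing : exponentially_mixing mu T.

(** The frontiers of the cells have bounded contents, so that the collection of
    all cells is admissible in the hypothesis. *)
Lemma mixing_borel_map : exists c rho : R, [/\ 0 < c, 0 < rho < 1 &
  forall k (q : cell_index d k) n A, measurable A ->
  `|pr mu ([set x | dyadic_cell k x = q] `&` iter n borel_map @^-1` A) -
    pr mu [set x | dyadic_cell k x = q] * pr mu A| <= c * rho ^+ n * pr mu A].
Proof.
pose C := [set E | exists k (q : cell_index d k),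
  E = cube R d `&` [set x | dyadic_cell k x = q]].
have C_cube E : C E -> E `<=` cube R d by move=> [k [q ->]] x [].
have C_content : (ereal_sup [set upper_content (frontier E) | E in C] < +oo)%E.
  apply: (@le_lt_trans _ _ (4 * d%:R * 3 ^+ d)%:E); last by rewrite ltry.
  by apply: ge_ereal_sup => _ [_ [k [q ->]] <-]; exact: frontier_cell_content.
have [c [tau [c0 tau0 mix]]] := T_mixing C_cube C_content.
exists c, (expR (- tau)); split => //.
  by rewrite expR_gt0 /= expR_lt1 oppr_lt0.
move=> k q n A mA.
have e0 : 0 <= c * expR (- tau) ^+ n by rewrite mulr_ge0 ?exprn_ge0 ?expR_ge0// ltW.
have mq := @measurable_dyadic_cell R d k q.
apply: (mixing_measurable (cell := @dyadic_cell R d)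
  (@measurable_dyadic_cell R d) measurable_borel_map mu_borel_map
  (approximable_borel mu_cube) e0 mq) => // l q'.
set E := [set x | dyadic_cell l x = q'].
have mE : measurable E by exact: measurable_dyadic_cell.
have := mix _ _ (ex_intro _ k (ex_intro _ q erefl))
  (ex_intro _ l (ex_intro _ q' erefl)) n.
have mcE := measurableI _ _ mc mE.
have mcq := measurableI _ _ mc mq.
have pE D : measurable D -> pr mu (cube R d `&` D) = pr mu D.
  move=> mD; apply/eqP; rewrite eq_le; apply/andP; split.
    by apply: le_pr => //; exact: measurableI.
  apply: (@le_trans _ _ (pr mu ((cube R d `&` D) `|` ~` cube R d))).
    apply: le_pr => //.
      by apply: measurableU; [exact: measurableI|exact: measurableC].
    by move=> x Dx; have [cx|cx] := pselect (cube R d x); [left|right].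
  apply: (le_trans (pr_setU _ _ _)); [exact: measurableI|exact: measurableC|].
  by rewrite (pr_setC_cube mu_cube) addr0.
move=> hmix; have [||_ ecpl] := @completion_ae _ _ mu (cube R d `&` [set x | dyadic_cell k x = q] `&`
    (cube R d `&` iter n T @^-1` (cube R d `&` E)))
  (cube R d `&` ([set x | dyadic_cell k x = q] `&` iter n borel_map @^-1` E))
  irregular _ measurable_irregular mu_irregular.
- by apply: measurableI => //; apply: measurableI => //; exact: mit.
- move=> x nx; have [e cx _] := iter_borel_map n nx.
  rewrite /preimage /= e; split; first by move=> [[? ?] [_ [_ ?]]].
  by move=> [? [? ?]].
have mqE := measurableI _ _ mq (mit n mE).
move: hmix; rewrite ecpl !completion_borel//.
rewrite (prE mu mcE) (prE mu mcq) (prE mu (measurableI _ _ mc mqE)).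
rewrite !pE// -!EFinM -EFinB lee_fin => h; apply: (le_trans h).
by rewrite mulrC -expRM_natl mulrN [n%:R * _]mulrC.
Qed.

End borel_version.

(** * Segments and densities *)

Section segments.
Context (R : realType) (d : nat).
Implicit Types (x y v : 'rV[R]_d) (A U W : set 'rV[R]_d).

Definition segment x y (t : R) := t *: (y - x) + x.

Lemma segment0 x y : segment x y 0 = x.
Proof. by rewrite /segment scale0r add0r. Qed.

Lemma segment1 x y : segment x y 1 = y.
Proof. by rewrite /segment scale1r subrK. Qed.

Lemma segment_dist x y t : 0 <= t <= 1 -> `|x - segment x y t| <= `|x - y|.
Proof.
move=> /andP[t0 t1]; rewrite /segment opprD addrCA subrr addr0 normrN normrZ.
by rewrite ger0_norm// distrC ler_piMl.
Qed.

Lemma continuous_segment x y : continuous (segment x y).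
Proof.
move=> t; apply: cvgD; last exact: cvg_cst.
by apply: cvgZr_tmp; exact: cvg_id.
Qed.

(** A segment is connected; if it missed the frontier, its intersection with [U]
    would be both open and closed in it. *)
Lemma segment_frontier U x y : open U -> U x -> ~ U y ->
  exists2 t, 0 <= t <= 1 & frontier U (segment x y t).
Proof.
move=> oU Ux Uy; apply: contrapT => no.
pose A := [set segment x y t | t in `[0, 1]%classic].
have cA : connected A.
  apply: connected_continuous_connected; first exact: segment_connected.
  exact/continuous_subspaceT/continuous_segment.
have Ay : A y by exists 1; rewrite ?segment1//= in_itv /= ler01 lexx.
suff e : A `&` U = A by apply: Uy; rewrite -e in Ay; case: Ay.
apply: cA.
- exists x; split => //; exists 0; rewrite ?segment0//= in_itv /= ler01 lexx //.
- by exists U.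
- exists (closure U); first exact: closed_closure.
  apply/seteqP; split => z [Az Uz]; split => //; first exact: subset_closure.
  apply: contrapT => nUz; apply: no; case: Az => t /= t01 tz; exists t.
    by rewrite in_itv in t01.
  by rewrite tz /frontier /setD /=; split => // /interior_subset.
Qed.

(** The jacobian is bounded on the compact set [A]; apply the mean value theorem
    to each coordinate along the segment. *)
Lemma lipschitz_along_segments W S A : C1_on W S -> A `<=` W -> compact A ->
  exists2 L : R, 0 <= L & forall x y,
    (forall t : R, 0 <= t <= 1 -> A (segment x y t)) -> `|S x - S y| <= L * `|x - y|.
Proof.
move=> C1 AW cA.
have cJ : {within A, continuous (jacobian S)}.
  by apply: continuous_in_subspaceT => z; rewrite inE => /AW /C1[].
have [M [_ HM]] := compact_bounded (continuous_compact cJ cA).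
pose K := `|M| + 1.
have K0 : 0 <= K by rewrite addr_ge0.
have JK z i j : A z -> `|jacobian S z i j| <= K.
  move=> Az; have : `|jacobian S z| <= K.
    by apply: (HM K); [rewrite ltr_pwDr// ler_norm|exists z].
  apply: le_trans; rewrite [leRHS]mx_normrE.
  exact: (le_bigmax _ (fun ij : 'I_d * 'I_d => `|jacobian S z ij.1 ij.2|) (i, j)).
exists (d%:R * K); first by rewrite mulr_ge0.
move=> x y Axy; rewrite distrC.
apply: norm_rV_le => [|j]; first by rewrite !mulr_ge0.
set v := y - x.
pose F (t : R) := S (segment x y t) ord0 j.
pose dF (t : R) := (v *m jacobian S (segment x y t)) ord0 j.
have dFP (t : R) : 0 <= t <= 1 -> is_derive t (1 : R) F (dF t).
  move=> t01; have [dS _] := C1 _ (AW _ (Axy _ t01)).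
  have e : (fun h : R => h^-1 *: (((fun s => S (segment x y s)) \o shift t) (h *: 1) -
       S (segment x y t))) =
     (fun h => h^-1 *: ((S \o shift (segment x y t)) (h *: v) - S (segment x y t))).
    apply/funext => h /=; congr (_ *: (S _ - _)).
    by rewrite /segment -/v [h *: 1]mulr1 scalerDl addrA.
  have d1 : derivable (fun s => S (segment x y s)) t 1.
    by rewrite /derivable e; exact: diff_derivable.
  have e1 : 'D_1 (fun s => S (segment x y s)) t = 'd S (segment x y t) v.
    by rewrite -deriveE// /derive e.
  apply: DeriveDef; first by move/derivable_mxP : d1 => /(_ ord0 j).
  have := derive_mx d1; rewrite e1 => /matrixP/(_ ord0 j); rewrite mxE => <-.
  by rewrite /dF mul_rV_lin1.
have [||c c01] := @MVT_segment R F dF 0 1 ler01.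
- by move=> t; rewrite in_itv /= => /andP[t0 t1]; apply: dFP; rewrite !ltW.
- apply: derivable_within_continuous => t; rewrite in_itv /= => t01.
  by have [] := dFP _ t01.
rewrite subr0 mulr1 /F segment0 segment1 => Fe.
rewrite !mxE Fe /dF mxE (le_trans (ler_norm_sum _ _ _))//.
apply: (@le_trans _ _ (\sum_(k < d) `|x - y| * K)).
  apply: ler_sum => k _; rewrite normrM; apply: ler_pM => //.
    by rewrite distrC; exact: norm_coord_le.
  by apply: JK; apply: Axy; rewrite in_itv in c01.
by rewrite sumr_const card_ord -[_ *+ d]mulr_natl; lra.
Qed.

Lemma compact_closure_cube U : U `<=` cube R d -> compact (closure U).
Proof.
move=> Uc; apply: bounded_closed_compact; last exact: closed_closure.
have cC : closed (cube R d).
  have -> : cube R d = \bigcap_(i in [set: 'I_d])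
    ((fun x : 'rV[R]_d => x ord0 i) @^-1` `[0, 1]%classic).
    apply/seteqP; split => x /= H i; first by move=> _; have := H i; rewrite /= in_itv.
    by have := H i Logic.I; rewrite /= in_itv.
  apply: closed_bigI => i _; apply: preimage_closed; last exact: interval_closed.
  by move=> x _; exact: coord_continuous.
exists 1; split; first exact: num_real.
move=> M M1 x Ux; have cx : cube R d x.
  by have := closure_subset Uc Ux; move/closure_id : cC => <-.
apply: norm_rV_le => [|i]; first by rewrite (le_trans ler01)// ltW.
by have /andP[x0 x1] := cx i; rewrite ger0_norm// (le_trans x1)// ltW.
Qed.

End segments.

Section density.
Context (R : realType) (d : nat) (mu : probability 'rV[R]_d R).
Hypothesis mu_cube : mu (cube R d) = 1%E.
Variables (h : 'rV[R]_d -> R) (V : set 'rV[R]_d) (c : R).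
Hypothesis h_density : is_density mu h.
Hypothesis V_open : open V.
Hypothesis mu_V : mu V = 1%E.
Hypothesis c_ge1 : 1 <= c.
Hypothesis h_V : forall x, V x -> cube R d x -> c^-1 <= h x <= c.

Let mV : measurable V. Proof. exact: open_measurable_mx. Qed.
Let mc := @measurable_cube R d.
Let c0 : 0 < c. Proof. exact: lt_le_trans c_ge1. Qed.

Let h_meas A : measurable A -> A `<=` cube R d ->
  measurable_fun A (fun x => (h x)%:E).
Proof.
move=> mA Ac; have [mh _ _] := h_density.
by apply/measurable_EFinP; exact: measurable_funS mh.
Qed.

Lemma density_le A : measurable A -> (mu A <= c%:E * lebesgue_rV R d A)%E.
Proof.
move=> mA; set B := A `&` (cube R d `&` V).
have mcV : measurable (cube R d `&` V) by exact: measurableI.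
have mB : measurable B by exact: measurableI.
have null D : measurable D -> mu D = 1%E -> mu (~` D) = 0%E.
  by move=> mD D1; rewrite probability_setC// D1 subee.
have AB : (mu A <= mu B)%E.
  apply: (@le_trans _ _ (mu (B `|` (~` cube R d `|` ~` V)))).
    apply: le_measure; rewrite ?inE//.
      by apply: measurableU => //; apply: measurableU; exact: measurableC.
    move=> x Ax; have [cx|cx] := pselect (cube R d x); last by right; left.
    by have [Vx|Vx] := pselect (V x); [left|right; right].
  have h1 : (mu (B `|` (~` cube R d `|` ~` V)) <= mu B + mu (~` cube R d `|` ~` V))%E.
    by apply: measureU2 => //; apply: measurableU; exact: measurableC.
  have h2 : (mu (~` cube R d `|` ~` V) <= mu (~` cube R d) + mu (~` V))%E.
    by apply: measureU2; exact: measurableC.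
  rewrite (null _ mc mu_cube) (null _ mV mu_V) adde0 in h2.
  apply: (le_trans h1); rewrite -[leRHS]adde0; exact: leeD2l.
apply: (le_trans AB).
have [_ h0 hE] := h_density.
have Bc : B `<=` cube R d by move=> x [_ []].
rewrite hE//; apply: (@le_trans _ _ (\int[lebesgue_rV R d]_(x in B) (cst c%:E) x)%E).
  apply: ge0_le_integral => //.
  - by move=> x /Bc cx; rewrite lee_fin h0.
  - exact: h_meas.
  - by move=> x [_ [cx Vx]]; rewrite lee_fin; have /andP[] := h_V Vx cx.
rewrite integral_cst//; apply: lee_wpmul2l; first by rewrite lee_fin ltW.
by apply: le_measure; rewrite ?inE//; exact: subIsetl.
Qed.

Lemma density_ge A : measurable A -> A `<=` cube R d `&` V ->
  (c^-1%:E * lebesgue_rV R d A <= mu A)%E.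
Proof.
move=> mA AcV; have [_ h0 hE] := h_density.
have Ac : A `<=` cube R d by move=> x /AcV [].
rewrite hE// -integral_cst//.
apply: ge0_le_integral => //.
- by move=> x _; rewrite lee_fin invr_ge0 ltW.
- exact: h_meas.
- by move=> x /AcV[cx Vx]; rewrite lee_fin; have /andP[] := h_V Vx cx.
Qed.

End density.

(** * Hyperbolic neighbourhoods and their volumes *)

Section product_distance.
Context (R : realType).
Implicit Types d : nat.

Definition pdist d (x y : 'rV[R]_d) : R := \prod_i `|x ord0 i - y ord0 i|.

Lemma pdist_ge0 d (x y : 'rV[R]_d) : 0 <= pdist x y.
Proof. by apply: prodr_ge0 => i _. Qed.

(** Change the factors one at a time. *)
Lemma prod_lipschitz d (a b : 'I_d -> R) :
  (forall i, 0 <= a i <= 1) -> (forall i, 0 <= b i <= 1) ->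
  `|\prod_i a i - \prod_i b i| <= \sum_i `|a i - b i|.
Proof.
elim: d a b => [|d IH] a b a01 b01; first by rewrite !big_ord0 subrr normr0.
rewrite !big_ord_recl /=; set A := \prod_(i < d) _; set B := \prod_(i < d) b _.
have AB : `|A - B| <= \sum_(i < d) `|a (lift ord0 i) - b (lift ord0 i)|.
  by apply: IH.
have A01 : 0 <= A <= 1.
  by rewrite prodr_ge0 ?prodr_ile1// => i _; have /andP[] := a01 (lift ord0 i).
have -> : a ord0 * A - b ord0 * B = (a ord0 - b ord0) * A + b ord0 * (A - B) by ring.
apply: (le_trans (ler_normD _ _)); rewrite !normrM; apply: lerD.
  by rewrite ler_piMr// ger0_norm; have /andP[] := A01.
by apply: (le_trans _ AB); rewrite ler_piMl// ger0_norm; have /andP[] := b01 ord0.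
Qed.

Lemma cube_dist d (x y : 'rV[R]_d) i : cube R d x -> cube R d y ->
  0 <= `|x ord0 i - y ord0 i| <= 1.
Proof.
move=> /(_ i) /andP[x0 x1] /(_ i) /andP[y0 y1].
by rewrite normr_ge0 ler_norml; apply/andP; split; lra.
Qed.

Lemma pdist_lipschitz d (x y x' y' : 'rV[R]_d) :
  cube R d x -> cube R d y -> cube R d x' -> cube R d y' ->
  `|pdist x y - pdist x' y'| <= d%:R * (`|x - x'| + `|y - y'|).
Proof.
move=> cx cy cx' cy'.
apply: (le_trans (prod_lipschitz (fun i => cube_dist i cx cy) (fun i => cube_dist i cx' cy'))).
apply: (@le_trans _ _ (\sum_(i < d) (`|x - x'| + `|y - y'|))).
  apply: ler_sum => i _.
  have h1 : `|x ord0 i - x' ord0 i| <= `|x - x'|.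
    by have := norm_coord_le (x - x') i; rewrite !mxE.
  have h2 : `|y ord0 i - y' ord0 i| <= `|y - y'|.
    by have := norm_coord_le (y - y') i; rewrite !mxE.
  apply: le_trans (lerD h1 h2); apply: (le_trans (ler_dist_dist _ _)).
  have -> : x ord0 i - y ord0 i - (x' ord0 i - y' ord0 i) =
    (x ord0 i - x' ord0 i) - (y ord0 i - y' ord0 i) by ring.
  exact: ler_normB.
by rewrite sumr_const card_ord -[_ *+ d]mulr_natl.
Qed.

Lemma measurable_pdist d dX (X : measurableType dX) (D : set X) (f g : X -> 'rV[R]_d) :
  measurable_fun D f -> measurable_fun D g ->
  measurable_fun D (fun x => pdist (f x) (g x)).
Proof.
move=> mf mg; apply: (@measurable_prod _ X R D _ (index_enum 'I_d)
  (fun i x => `|f x ord0 i - g x ord0 i|)) => i _.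
have mfi : measurable_fun D (fun x => f x ord0 i).
  exact: (measurableT_comp (@measurable_coord R d i) mf).
have mgi : measurable_fun D (fun x => g x ord0 i).
  exact: (measurableT_comp (@measurable_coord R d i) mg).
exact: (measurableT_comp (@normr_measurable R setT) (measurable_funB mfi mgi)).
Qed.

(** For [v] in the cube this is the trace on the cube of the hyperboloid around
    [v]: the coordinates of a difference of points of the cube are at most 1. *)
Definition hyper d (v : 'rV[R]_d) (r : R) : set 'rV[R]_d :=
  cube R d `&` [set y | pdist y v < r].

Definition shell d (v : 'rV[R]_d) (a t : R) : set 'rV[R]_d :=
  cube R d `&` [set y | a <= pdist y v < a + t].

Lemma measurable_hyper d (v : 'rV[R]_d) r : measurable (hyper v r).
Proof.
apply: measurableI; first exact: measurable_cube.
have m : measurable_fun setT (fun y : 'rV[R]_d => pdist y v).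
  by apply: measurable_pdist; [exact: measurable_id|exact: measurable_cst].
have -> : [set y | pdist y v < r] = (fun y : 'rV[R]_d => pdist y v) @^-1` `]-oo, r[%classic.
  by apply/seteqP; split => y; rewrite /= in_itv.
by rewrite -[X in measurable X]setTI; exact: m.
Qed.

Lemma measurable_shell d (v : 'rV[R]_d) a t : measurable (shell v a t).
Proof.
apply: measurableI; first exact: measurable_cube.
have m : measurable_fun setT (fun y : 'rV[R]_d => pdist y v).
  by apply: measurable_pdist; [exact: measurable_id|exact: measurable_cst].
have -> : [set y | a <= pdist y v < a + t] =
    (fun y : 'rV[R]_d => pdist y v) @^-1` `[a, a + t[%classic.
  by apply/seteqP; split => y; rewrite /= in_itv.
by rewrite -[X in measurable X]setTI; exact: m.
Qed.

Lemma lebesgue_cube d : lebesgue_rV R d (cube R d) = 1%E.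
Proof.
pose a : 'rV[R]_d := 0; pose b : 'rV[R]_d := const_mx 1.
have -> : cube R d = [set x | forall i, a ord0 i <= x ord0 i <= b ord0 i].
  by apply/seteqP; split => x /= H i; have := H i; rewrite !mxE.
rewrite lebesgue_rV_box; last by move=> i; rewrite !mxE.
by rewrite big1// => i _; rewrite !mxE subr0.
Qed.

Definition row_tail d (v : 'rV[R]_d.+1) : 'rV[R]_d := \row_j v ord0 (lift ord0 j).

Lemma pdist_row_cons d (t : R) (w : 'rV[R]_d) (v : 'rV[R]_d.+1) :
  pdist (row_cons (t, w)) v = `|t - v ord0 ord0| * pdist w (row_tail v).
Proof.
rewrite /pdist big_ord_recl /row_cons !mxE unlift_none /=; congr (_ * _).
by apply: eq_bigr => i _; rewrite !mxE liftK.
Qed.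

Lemma cube_row_cons d (t : R) (w : 'rV[R]_d) :
  cube R d.+1 (row_cons (t, w)) <-> 0 <= t <= 1 /\ cube R d w.
Proof.
split=> [H|[H1 H2] i].
  split; first by have := H ord0; rewrite /row_cons !mxE unlift_none.
  by move=> i; have := H (lift ord0 i); rewrite /row_cons !mxE liftK.
by rewrite /row_cons !mxE; case: unliftP => [j|] _ /=.
Qed.

Lemma lebesgue_rVS d (A : set 'rV[R]_d.+1) :
  lebesgue_rV R d.+1 A = (lebesgue_measure \x lebesgue_rV R d)%E (@row_cons R d @^-1` A).
Proof. by []. Qed.

Lemma measurable_row_cons_preimage d (A : set 'rV[R]_d.+1) : measurable A ->
  measurable (@row_cons R d @^-1` A).
Proof.
by move=> mA; rewrite -[X in measurable X]setTI; exact: (@measurable_row_cons R d).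
Qed.

Lemma rectangle_le d (a b : R) (B : set 'rV[R]_d) (l s : R) :
  a <= b -> b - a <= l -> measurable B -> (lebesgue_rV R d B <= s%:E)%E ->
  ((lebesgue_measure \x lebesgue_rV R d) (`[a, b]%classic `*` B) <= (l * s)%:E)%E.
Proof.
move=> ab bal mB Bs; rewrite product_measure1E// EFinM; apply: lee_pmul => //.
by rewrite /= lebesgue_measure_itv /= lte_fin; case: ltP => _; rewrite -?EFinB lee_fin; lra.
Qed.

Lemma dyadic_scale (s : R) K : 2 ^- K < s <= 1 ->
  exists2 k, (k < K)%N & 2 ^- k.+1 < s <= 2 ^- k.
Proof.
elim: K => [|K IH] /andP[Ks s1].
  by move: Ks; rewrite expr0 invr1 => /(le_lt_trans s1); rewrite ltxx.
have [sK|sK] := ltP (2 ^- K) s.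
  have [|k kK sk] := IH; first by rewrite sK s1.
  by exists k => //; exact: ltnW.
by exists K => //; rewrite Ks.
Qed.

Lemma row_tail_cube d (v : 'rV[R]_d.+1) : cube R d.+1 v -> cube R d (row_tail v).
Proof. by move=> cv i; rewrite mxE. Qed.

Let p0 n : 0 < 2 ^- n :> R. Proof. by rewrite invr_gt0 exprn_gt0. Qed.

(** Slice according to the dyadic size [2 ^- k] of the distance between the first
    coordinates: on the slice the other coordinates lie in a hyperbolic
    neighbourhood of size [2 ^- (K - k - 1)]. *)
Lemma hyper_le_step d (b : nat -> R) :
  (forall v K, cube R d v -> (lebesgue_rV R d (hyper v (2 ^- K)) <= (b K)%:E)%E) ->
  forall v K, cube R d.+1 v -> (lebesgue_rV R d.+1 (hyper v (2 ^- K)) <=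
    (\sum_(k < K) 2 * 2 ^- k * b (K - k.+1)%N + 2 * 2 ^- K)%:E)%E.
Proof.
move=> bd v K cv; rewrite lebesgue_rVS; set c := v ord0 ord0; set w := row_tail v.
have cw : cube R d w by exact: row_tail_cube.
pose A (j : 'I_K + unit) : set (measurableTypeR R * 'rV[R]_d) :=
  if j is inl k then `[c - 2 ^- k, c + 2 ^- k]%classic `*` hyper w (2 ^- (K - k.+1))
  else `[c - 2 ^- K, c + 2 ^- K]%classic `*` cube R d.
have mc := @measurable_cube R d.
have mA j : measurable (A j).
  by case: j => [k|u]; rewrite /A; apply: measurableX => //; exact: measurable_hyper.
apply: (le_trans (measure_le_fin_cover _ mA _ _)).
- by apply: measurable_row_cons_preimage; exact: measurable_hyper.
- move=> [t x]; rewrite /preimage /= => -[/cube_row_cons[t01 cx]].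
  rewrite /= pdist_row_cons -/c -/w => lt.
  have c01 := cv ord0; rewrite -/c in c01.
  have [tK|tK] := leP `|t - c| (2 ^- K).
    exists (inr tt) => //; split => //=; rewrite in_itv /=.
    by move: tK; rewrite ler_norml => /andP[? ?]; apply/andP; split; lra.
  have [|k kK /andP[k1 k2]] := @dyadic_scale `|t - c| K.
    rewrite tK ler_norml; case/andP: t01 => ? ?; case/andP: c01 => ? ?.
    by apply/andP; split; lra.
  exists (inl (Ordinal kK)) => //; split => /=.
    rewrite in_itv /=.
    by move: k2; rewrite ler_norml => /andP[? ?]; apply/andP; split; lra.
  split => //=; rewrite -(@ltr_pM2l _ (2 ^- k.+1))//.
  rewrite -[ltRHS]invfM -exprD subnKC//; apply: le_lt_trans lt.
  by apply: ler_wpM2r; [exact: pdist_ge0|exact: ltW].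
apply: (@le_trans _ _ (\sum_(j : 'I_K + unit)
   (if j is inl k then 2 * 2 ^- k * b (K - k.+1)%N else 2 * 2 ^- K)%:E)%E).
  apply: lee_sum => -[k|u] _ /=.
    have pk := p0 k; apply: rectangle_le; [lra|lra|exact: measurable_hyper|exact: bd].
  have pk := p0 K; rewrite -[X in (X%:E)%E]mulr1.
  by apply: rectangle_le => //; [lra|lra|rewrite lebesgue_cube].
by rewrite sumEFin lee_fin big_sumType/= sumr_const card_unit mulr1n.
Qed.

Lemma hyper_le d : exists C : R, 0 <= C /\ forall (v : 'rV[R]_d) K, cube R d v ->
  (lebesgue_rV R d (hyper v (2 ^- K)) <= (C * K.+1%:R ^+ d.-1 * 2 ^- K)%:E)%E.
Proof.
elim: d => [|[_|d [C [C0 IH]]]].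
- exists 1; split => // v K cv; rewrite (_ : hyper v _ = set0) ?measure0.
    by rewrite lee_fin !mulr_ge0// ?exprn_ge0// ltW.
  rewrite -subset0 => y [_ /=]; rewrite /pdist big_ord0 ltNge.
  by rewrite invf_le1 ?exprn_gt0// exprn_ege1// ler1n.
- have h0 (v : 'rV[R]_0) K : cube R 0 v ->
      (lebesgue_rV R 0 (hyper v (2 ^- K)) <= 0%:E)%E.
    move=> _; rewrite (_ : hyper v _ = set0) ?measure0//.
    rewrite -subset0 => y [_ /=]; rewrite /pdist big_ord0 ltNge.
    by rewrite invf_le1 ?exprn_gt0// exprn_ege1// ler1n.
  exists 2; split => // v K cv; apply: (le_trans (hyper_le_step h0 K cv)).
  rewrite lee_fin expr0 mulr1 big1 ?add0r// => k _; exact: mulr0.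
exists (4 * C + 2); split; first by rewrite addr_ge0// mulr_ge0.
move=> v K cv; apply: (le_trans (hyper_le_step IH K cv)); rewrite lee_fin /=.
have K1 : 1 <= K.+1%:R :> R by rewrite ler1n.
apply: (@le_trans _ _ (\sum_(k < K) 4 * C * (K.+1%:R ^+ d * 2 ^- K) + 2 * 2 ^- K)).
  rewrite lerD2r; apply: ler_sum => k _.
  have -> : 2 ^- K = 2 ^- k.+1 * 2 ^- (K - k.+1) :> R.
    by rewrite -invfM -exprD subnKC.
  have -> : 2 ^- k = 2 * 2 ^- k.+1 :> R.
    by rewrite exprS invfM mulrA divff// mul1r.
  have h1 : (K - k.+1).+1%:R ^+ d <= K.+1%:R ^+ d :> R.
    by apply: lerXn2r; rewrite ?nnegrE// ler_nat ltnS leq_subr.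
  have := p0 k.+1; have := p0 (K - k.+1)%N.
  move: (2 ^- k.+1) (2 ^- (K - k.+1)) ((K - k.+1).+1%:R ^+ d) (K.+1%:R ^+ d) h1.
  move=> a b e f ef b0 a0.
  have : (4 * a * b * C) * e <= (4 * a * b * C) * f.
    by apply: ler_wpM2l => //; rewrite !mulr_ge0// ltW.
  lra.
rewrite sumr_const card_ord -[_ *+ K]mulr_natl exprS.
have K0 : K%:R <= K.+1%:R :> R by rewrite ler_nat.
have e1 : 1 <= K.+1%:R ^+ d :> R by exact: exprn_ege1.
have := p0 K.
have g0 := ler0n R K.
set a : R := 2 ^- K; set e : R := K.+1%:R ^+ d in e1 *.
set f : R := K.+1%:R in K1 K0 *; set g : R := K%:R in K0 g0 * => a0.
have ae : 0 <= C * e * a by apply: mulr_ge0 (ltW a0); apply: mulr_ge0 C0 (le_trans ler01 e1).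
have h1 : g * (C * e * a) <= f * (C * e * a) by exact: ler_wpM2r.
have h2 : a * 1 <= a * (f * e) by apply: ler_wpM2l; [exact: ltW|rewrite -[1]mulr1 ler_pM].
lra.
Qed.

End product_distance.

Section volume_lower_bound.
Context (R : realType).
Implicit Types d : nat.

(** A box with one vertex at [v]; the sign vector [s] selects its orthant. *)
Definition corner d (s : 'I_d -> bool) (r : nat) (v : 'rV[R]_d) : set 'rV[R]_d :=
  [set y | forall i, (if s i then v ord0 i - 2 ^- r else v ord0 i) <= y ord0 i <=
                     (if s i then v ord0 i else v ord0 i + 2 ^- r)].

Definition corner_hyper d (s : 'I_d -> bool) r v (a : R) : set 'rV[R]_d :=
  corner s r v `&` [set y | pdist y v < a].

Lemma measurable_corner_hyper d (s : 'I_d -> bool) r v a :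
  measurable (corner_hyper s r v a).
Proof.
apply: measurableI; first exact: measurable_box.
have m : measurable_fun setT (fun y : 'rV[R]_d => pdist y v).
  by apply: measurable_pdist; [exact: measurable_id|exact: measurable_cst].
have -> : [set y | pdist y v < a] = (fun y : 'rV[R]_d => pdist y v) @^-1` `]-oo, a[%classic.
  by apply/seteqP; split => y; rewrite /= in_itv.
by rewrite -[X in measurable X]setTI; exact: m.
Qed.

Let p0 n : 0 < 2 ^- n :> R. Proof. by rewrite invr_gt0 exprn_gt0. Qed.

Let pS n : 2 ^- n = 2 * 2 ^- n.+1 :> R.
Proof. by rewrite exprS invfM mulrA divff// mul1r. Qed.

Let p_le m n : (m <= n)%N -> 2 ^- n <= 2 ^- m :> R.
Proof. by move=> mn; rewrite lef_pV2 ?posrE ?exprn_gt0// ler_weXn2l// ler1n. Qed.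

Definition dyadic_ring (b : bool) (c : R) k : set (measurableTypeR R) :=
  if b then `[c - 2 ^- k, c - 2 ^- k.+1[%classic
  else `]c + 2 ^- k.+1, c + 2 ^- k]%classic.

Let ring_dist b c k t : dyadic_ring b c k t -> 2 ^- k.+1 < `|t - c| <= 2 ^- k.
Proof.
have := p0 k.+1; rewrite /dyadic_ring; case: b => /= a0; rewrite in_itv /= => /andP[h1 h2].
  by rewrite ltr0_norm; [apply/andP; split; lra|lra].
by rewrite gtr0_norm; [apply/andP; split; lra|lra].
Qed.

Let ring_measure b c k : lebesgue_measure (dyadic_ring b c k) = (2 ^- k.+1)%:E.
Proof.
have a0 := p0 k.+1; have e := pS k.
rewrite /dyadic_ring; case: b; rewrite lebesgue_measure_itv /= lte_fin.
- have -> : c - 2 ^- k < c - 2 ^- k.+1 by lra.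
  by rewrite -EFinB; congr (_%:E); lra.
- have -> : c + 2 ^- k.+1 < c + 2 ^- k by lra.
  by rewrite -EFinB; congr (_%:E); lra.
Qed.

Let ring_meas b c k : measurable (dyadic_ring b c k).
Proof. by rewrite /dyadic_ring; case: b. Qed.

Let ring_side b c k r t : (r <= k)%N -> dyadic_ring b c k t ->
  (if b then c - 2 ^- r else c) <= t <= (if b then c else c + 2 ^- r).
Proof.
move=> /p_le kr; have := p0 k.+1; have := p0 k; rewrite /dyadic_ring; case: b => /= a0 b0;
  rewrite in_itv /= => /andP[h1 h2]; apply/andP; split; lra.
Qed.

(** The slices are as in [hyper_le_step], restricted to one side of [v]; they are
    disjoint, so that their volumes add up. *)
Lemma corner_hyper_ge_step d r (l : nat -> R) :
  (forall (s : 'I_d -> bool) v K,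
     ((l K)%:E <= lebesgue_rV R d (corner_hyper s r v (2 ^- K)))%E) ->
  (forall K, 0 <= l K) ->
  forall (s : 'I_d.+1 -> bool) v K n, (r + n <= K)%N ->
  ((\sum_(k < n) 2 ^- (r + k).+1 * l (K - (r + k))%N)%:E <=
    lebesgue_rV R d.+1 (corner_hyper s r v (2 ^- K)))%E.
Proof.
move=> ld l0 s v K n rnK; rewrite lebesgue_rVS.
set c := v ord0 ord0; set w := row_tail v; pose s' i := s (lift ord0 i).
pose F k : set (measurableTypeR R * 'rV[R]_d) :=
  dyadic_ring (s ord0) c (r + k) `*` corner_hyper s' r w (2 ^- (K - (r + k))).
have mF k : measurable (F k).
  by apply: measurableX; [exact: ring_meas|exact: measurable_corner_hyper].
have mU : measurable (\big[setU/set0]_(k < n) F k) by exact: bigsetU_measurable.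
apply: (@le_trans _ _ ((lebesgue_measure \x lebesgue_rV R d)%E
    (\big[setU/set0]_(k < n) F k))); last first.
  apply: le_measure; rewrite ?inE//.
    by apply: measurable_row_cons_preimage; exact: measurable_corner_hyper.
  move=> [t x]; rewrite -bigcup_mkord => -[k /= kn [/= tk [sx xw]]].
  have rkK : (r + k <= K)%N by apply: leq_trans rnK; rewrite leq_add2l ltnW.
  split => /=.
    move=> i; rewrite /row_cons !mxE; case: unliftP => [j ->|->] /=.
      by have := sx j; rewrite /w /s' !mxE.
    by apply: ring_side tk; rewrite leq_addr.
  rewrite pdist_row_cons -/c -/w.
  have -> : 2 ^- K = 2 ^- (r + k) * 2 ^- (K - (r + k)) :> R.
    by rewrite -invfM -exprD subnKC.
  have /andP[_ h1] := ring_dist tk.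
  apply: le_lt_trans (_ : 2 ^- (r + k) * pdist x w < _).
    by apply: ler_wpM2r => //; exact: pdist_ge0.
  by rewrite ltr_pM2l.
rewrite measure_bigsetU//; last first.
  apply/trivIsetP => i j _ _ ij; rewrite -subset0 => -[t x] [[/= ti _] [/= tj _]].
  have /andP[i1 i2] := ring_dist ti; have /andP[j1 j2] := ring_dist tj.
  have lt a b : (a < b)%N -> 2 ^- (r + a).+1 < `|t - c| -> `|t - c| <= 2 ^- (r + b) -> False.
    move=> ab h1 h2; have := lt_le_trans h1 h2.
    by rewrite ltNge p_le// -addnS leq_add2l.
  have [lij|lji] := ltnP i j; first exact: (lt _ _ lij).
  by apply: (lt _ _ _ j1 i2); rewrite ltn_neqAle lji eq_sym ij.
rewrite -sumEFin; apply: lee_sum => k _.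
have h : (lebesgue_measure \x lebesgue_rV R d)%E (F k) =
    ((2 ^- (r + k).+1)%:E * lebesgue_rV R d (corner_hyper s' r w (2 ^- (K - (r + k)))))%E.
  rewrite /F product_measure1E//; last exact: measurable_corner_hyper.
  by rewrite [X in (X * _)%E]ring_measure.
apply: (@le_trans _ _ ((lebesgue_measure \x lebesgue_rV R d)%E (F k))); last exact: lexx.
by rewrite h EFinM; apply: lee_pmul => //; rewrite lee_fin// ltW.
Qed.

Lemma corner_hyper_ge d r : (0 < d)%N -> exists c : R, exists K0 : nat, 0 < c /\
  forall (s : 'I_d -> bool) v K, (K0 <= K)%N ->
  ((c * K%:R ^+ d.-1 * 2 ^- K)%:E <= lebesgue_rV R d (corner_hyper s r v (2 ^- K)))%E.
Proof.
case: d => // d _; elim: d => [|d [c [K0 [c0 IH]]]].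
  exists (4^-1), r; split => [|s v K rK]; first by rewrite invr_gt0.
  rewrite expr0 mulr1 lebesgue_rVS; set c := v ord0 ord0.
  pose F : set (measurableTypeR R * 'rV[R]_0) := dyadic_ring (s ord0) c K.+1 `*` cube R 0.
  have mc := @measurable_cube R 0.
  have FE : (lebesgue_measure \x lebesgue_rV R 0)%E F = (4^-1 * 2 ^- K)%:E.
    rewrite /F product_measure1E//.
    rewrite [X in (X * _)%E]ring_measure lebesgue_cube mule1; congr (_%:E).
    by rewrite (pS K) (pS K.+1); lra.
  rewrite -FE; apply: le_measure; rewrite ?inE//.
  - exact: measurableX.
  - by apply: measurable_row_cons_preimage; exact: measurable_corner_hyper.
  - move=> [t x] [/= tk cx]; split => /=.
      move=> i; rewrite /row_cons !mxE; case: unliftP => [[]//|->] /=.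
      by apply: ring_side tk; exact: leqW.
    rewrite pdist_row_cons -/c /pdist big_ord0 mulr1.
    have /andP[_ h1] := ring_dist tk; apply: (le_lt_trans h1).
    by rewrite (pS K) ltr_pMl// ltr1n.
pose l K : R := if (K0 <= K)%N then c * K%:R ^+ d * 2 ^- K else 0.
have l0 K : 0 <= l K.
  rewrite /l; case: ifP => // _; apply: mulr_ge0 (ltW (p0 K)).
  by apply: mulr_ge0 (ltW c0) _; rewrite exprn_ge0.
have ld (s : 'I_d.+1 -> bool) v K :
    ((l K)%:E <= lebesgue_rV R d.+1 (corner_hyper s r v (2 ^- K)))%E.
  by rewrite /l; case: ifPn => [K0K|_]; [exact: IH|exact: measure_ge0].
exists (c * 2^-1 ^+ d.+3), (4 * r + 2 * K0 + 4)%N; split.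
  by rewrite mulr_gt0// exprn_gt0// invr_gt0.
move=> s v K K0K; pose n := (K./2 - r)%N.
have hK := odd_double_half K; rewrite -addnn in hK.
have rn : (r + n <= K)%N by rewrite /n; move: hK K0K; case: (odd K) => /=; lia.
apply: le_trans (corner_hyper_ge_step ld l0 s v rn); rewrite lee_fin.
apply: (@le_trans _ _ (\sum_(k < n) c * 2^-1 ^+ d.+1 * K%:R ^+ d * 2 ^- K)).
  rewrite sumr_const card_ord -[_ *+ n]mulr_natl /=.
  have nK : K%:R / 4 <= n%:R :> R.
    rewrite ler_pdivrMr// -natrM ler_nat /n; move: hK K0K; case: (odd K) => /=; lia.
  have : K%:R / 4 * (c * 2^-1 ^+ d.+1 * K%:R ^+ d * 2 ^- K) <=
     n%:R * (c * 2^-1 ^+ d.+1 * K%:R ^+ d * 2 ^- K).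
    apply: ler_wpM2r => //; rewrite mulr_ge0 ?invr_ge0 ?exprn_ge0//.
    by rewrite !mulr_ge0 ?exprn_ge0 ?invr_ge0// ltW.
  apply: le_trans; rewrite le_eqVlt; apply/orP; left; apply/eqP.
  by rewrite !exprS; field; rewrite expf_neq0.
apply: ler_sum => k _; have kn := ltn_ord k.
have rkK : (r + k <= K./2)%N by move: kn; rewrite /n ltn_subRL => /ltnW.
rewrite /l ifT; last by move: hK K0K; case: (odd K) => /=; lia.
have -> : 2 ^- K = 2 ^- (r + k) * 2 ^- (K - (r + k)) :> R.
  by rewrite -invfM -exprD subnKC//; lia.
rewrite (pS (r + k)).
have hd : (2^-1 * K%:R) ^+ d <= (K - (r + k))%:R ^+ d :> R.
  apply: lerXn2r; rewrite ?nnegrE ?mulr_ge0 ?invr_ge0//.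
  rewrite mulrC ler_pdivrMr// -natrM ler_nat; move: hK; case: (odd K) => /=; lia.
rewrite exprMn in hd; rewrite exprS.
have := p0 (r + k).+1; have := p0 (K - (r + k))%N.
move: (2 ^- (r + k).+1) (2 ^- (K - (r + k))) hd => a b hd b0 a0.
have : (a * b * c) * (2^-1 ^+ d * K%:R ^+ d) <= (a * b * c) * (K - (r + k))%:R ^+ d.
  by apply: ler_wpM2l => //; rewrite !mulr_ge0// ltW.
lra.
Qed.

End volume_lower_bound.

Section shell_volume.
Context (R : realType).
Implicit Types d : nat.

(** Each coordinate takes one square root of the thickness of a shell. *)
Definition iter_sqrt n (t : R) : R := iter n Num.sqrt t.

Lemma iter_sqrt_itv n t : 0 <= t <= 1 -> t <= iter_sqrt n t <= 1.
Proof.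
move=> /andP[t0 t1]; elim: n => [|n /andP[IH1 IH2]]; first by rewrite /= lexx t1.
rewrite /iter_sqrt /= -/(iter_sqrt n t).
have i0 : 0 <= iter_sqrt n t by exact: le_trans IH1.
have s1 : Num.sqrt (iter_sqrt n t) <= 1 by rewrite -sqrtr1 ler_wsqrtr.
rewrite s1 andbT (le_trans IH1)// -[leLHS]sqr_sqrtr// expr2.
by rewrite ler_piMl// sqrtr_ge0.
Qed.

Lemma iter_sqrt_le n (s t : R) : s <= t -> iter_sqrt n s <= iter_sqrt n t.
Proof. by move=> st; elim: n => // n IH; rewrite /iter_sqrt /= ler_wsqrtr. Qed.

Lemma iter_sqrt_ge0 n (t : R) : 0 <= t -> 0 <= iter_sqrt n t.
Proof. by case: n => // n _; exact: sqrtr_ge0. Qed.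

Lemma iter_sqrtM n (s t : R) : 0 <= s -> iter_sqrt n (s * t) = iter_sqrt n s * iter_sqrt n t.
Proof.
move=> s0; elim: n => // n IH; rewrite /iter_sqrt /= in IH *; rewrite IH sqrtrM//.
by case: n {IH} => // n; exact: sqrtr_ge0.
Qed.

Lemma iter_sqrt_exp n (t : R) k : 0 <= t -> iter_sqrt n (t ^+ k) = iter_sqrt n t ^+ k.
Proof.
move=> t0; elim: n => // n; rewrite /iter_sqrt /= => ->.
have : 0 <= iter_sqrt n t by case: n => // n; exact: sqrtr_ge0.
rewrite /iter_sqrt; move: (iter n _ t) => s s0; elim: k => [|k IH].
  by rewrite !expr0 sqrtr1.
by rewrite !exprS sqrtrM// IH.
Qed.

Lemma iter_sqrt_lt1 n (t : R) : 0 <= t < 1 -> 0 <= iter_sqrt n t < 1.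
Proof.
move=> t01; elim: n => // n; rewrite /iter_sqrt /= => /andP[i0 i1].
by rewrite sqrtr_ge0/= -sqrtr1 ltr_sqrt.
Qed.

Let shell_le1 (v : 'rV[R]_1) a t : 0 <= a -> 0 <= t ->
  (lebesgue_rV R 1 (shell v a t) <= (2 * t)%:E)%E.
Proof.
move=> a0 t0; rewrite lebesgue_rVS; set c := v ord0 ord0.
pose A (j : bool) : set (measurableTypeR R * 'rV[R]_0) :=
  (if j then `[c - a - t, c - a]%classic else `[c + a, c + a + t]%classic) `*` cube R 0.
have mc := @measurable_cube R 0.
have mA j : measurable (A j) by apply: measurableX => //; case: j.
apply: (le_trans (measure_le_fin_cover _ mA _ _)).
- by apply: measurable_row_cons_preimage; exact: measurable_shell.
- move=> [s x] [/cube_row_cons[_ cx] /=].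
  rewrite pdist_row_cons -/c /pdist big_ord0 mulr1.
  have [sc|sc] := ltP (s - c) 0;
    [rewrite ltr0_norm//|rewrite ger0_norm//] => /andP[h1 h2].
    by exists true => //; split => //=; rewrite in_itv /=; apply/andP; split; lra.
  by exists false => //; split => //=; rewrite in_itv /=; apply/andP; split; lra.
apply: (@le_trans _ _ (\sum_(j : bool) t%:E)%E).
  apply: lee_sum => j _; rewrite -[X in (_ <= X%:E)%E]mulr1 /A.
  by case: j; apply: rectangle_le => //; [lra|lra|rewrite lebesgue_cube|lra|lra|rewrite lebesgue_cube].
by rewrite sumEFin lee_fin sumr_const card_bool -[_ *+ 2]mulr_natl.
Qed.

(** Slicing along the first coordinate: either its distance to [v] is at most
    [sqrt t], or the slice is a shell of thickness at most [sqrt t]. *)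
Lemma shell_le d (v : 'rV[R]_d.+1) a t : 0 <= a -> 0 <= t <= 1 ->
  (lebesgue_rV R d.+1 (shell v a t) <= (2 * d.+1%:R * iter_sqrt d t)%:E)%E.
Proof.
elim: d v a t => [|d IH] v a t a0 /andP[t0 t1].
  by rewrite mulr1; exact: shell_le1.
have [->|tn0] := eqVneq t 0.
  rewrite (_ : shell v a 0 = set0) ?measure0.
    rewrite lee_fin mulr_ge0// ?mulr_ge0//.
    by have /andP[] := @iter_sqrt_itv d.+1 0 (introT andP (conj (lexx 0) ler01)).
  by rewrite -subset0 => y [_ /= /andP[h1 h2]]; move: h2; rewrite addr0 ltNge h1.
rewrite lebesgue_rVS; set c := v ord0 ord0; set w := row_tail v.
pose q := Num.sqrt t.
have q0 : 0 < q by rewrite sqrtr_gt0 lt_def tn0.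
have qq : q * q = t by rewrite -expr2 sqr_sqrtr.
have q1 : q <= 1 by rewrite -sqrtr1 ler_wsqrtr.
have sE : iter_sqrt d.+1 t = iter_sqrt d q by rewrite /iter_sqrt iterSr.
have mc := @measurable_cube R d.+1.
pose S : set (measurableTypeR R * 'rV[R]_d.+1) := @row_cons R d.+1 @^-1` shell v a t.
have mS : measurable S by apply: measurable_row_cons_preimage; exact: measurable_shell.
pose A1 : set (measurableTypeR R * 'rV[R]_d.+1) := `[c - q, c + q]%classic `*` cube R d.+1.
have mA1 : measurable A1 by exact: measurableX.
pose A2 := S `\` A1.
have mA2 : measurable A2 by exact: measurableD.
set nu := (lebesgue_measure \x lebesgue_rV R d.+1)%E.
apply: (@le_trans _ _ (nu (A1 `|` A2))).
  apply: le_measure; rewrite ?inE//; first exact: measurableU.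
  by move=> p Sp; have [?|?] := pselect (A1 p); [left|right].
apply: (le_trans (measureU2 nu mA1 mA2)).
have h1 : (nu A1 <= (2 * q)%:E)%E.
  rewrite -[X in (_ <= X%:E)%E]mulr1; by apply: rectangle_le => //; [lra|lra|rewrite lebesgue_cube].
have h2 : (nu A2 <= (2 * d.+1%:R * iter_sqrt d q)%:E)%E.
  have -> : nu A2 = (\int[lebesgue_measure]_x lebesgue_rV R d.+1 (xsection A2 x))%E by [].
  set K := (2 * d.+1%:R * iter_sqrt d q)%:E.
  have K0 : (0 <= K)%E.
    rewrite lee_fin mulr_ge0// ?mulr_ge0//.
    have /andP[h3 _] := @iter_sqrt_itv d q (introT andP (conj (ltW q0) q1)).
    exact: le_trans (ltW q0) h3.
  pose J : set (measurableTypeR R) := `[0%R, 1%R]%classic.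
  apply: (@le_trans _ _ (\int[@lebesgue_measure R]_(x in J) (cst K) x)%E).
    rewrite [leRHS]integral_mkcond; apply: ge0_le_integral => //.
    - exact: (@measurable_fun_xsection _ _ _ _ _ (lebesgue_rV R d.+1) A2 mA2).
    - have mJ : measurable J by exact: measurable_itv.
      by apply/(measurable_restrictT (cst K) mJ); exact: measurable_cst.
    - move=> x _ /=.
      have msec : measurable (xsection A2 x) by exact: measurable_xsection.
      rewrite patchE; case: ifPn => [x01|x01]; last first.
        rewrite (_ : xsection A2 x = set0) ?measure0// -subset0 => y.
        rewrite /xsection /= inE => -[[/cube_row_cons[x01' _] _] _].
        by move: x01; rewrite notin_setE; apply; rewrite /J /= in_itv.
      have [[y0 y0P]|no] := pselect (exists y, xsection A2 x y); last first.
        rewrite (_ : xsection A2 x = set0) ?measure0// -subset0 => y xy.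
        by apply: no; exists y.
      have uq : q < `|x - c|.
        move: y0P; rewrite /xsection /= inE => -[[/cube_row_cons[_ cy] _] nA1].
        rewrite ltNge; apply/negP => h; apply: nA1; split => //=; rewrite in_itv /=.
        by move: h; rewrite ler_norml => /andP[? ?]; apply/andP; split; lra.
      set u := `|x - c| in uq *; have u0 : 0 < u by exact: lt_trans uq.
      apply: (@le_trans _ _ (lebesgue_rV R d.+1 (shell w (a / u) q))).
        apply: le_measure; rewrite ?inE//; first exact: measurable_shell.
        move=> y; rewrite /xsection /= inE => -[[/cube_row_cons[_ cy] py] _].
        move: py; rewrite /= pdist_row_cons -/c -/w -/u => /andP[p1 p2]; split => //=.
        rewrite ler_pdivrMr// mulrC p1 /= -ltrBlDl.
        rewrite -(ltr_pM2l u0) mulrBr mulrCA divff ?gt_eqF// mulr1.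
        have : t <= u * q by rewrite -qq ler_pM2r// ltW.
        lra.
      by apply: IH; [rewrite divr_ge0// ltW|rewrite q1 ltW].
  have J1 : @lebesgue_measure R J = 1%E.
    by rewrite /J lebesgue_measure_itv /= lte_fin ltr01 -EFinB subr0.
  have mJ : measurable J by exact: measurable_itv.
  have e : (\int[@lebesgue_measure R]_(x in J) (cst K) x = K * lebesgue_measure J)%E.
    exact: integral_cst.
  by rewrite e J1 mule1.
apply: (le_trans (leeD h1 h2)); rewrite -EFinD lee_fin sE.
have /andP[h3 _] := @iter_sqrt_itv d q (introT andP (conj (ltW q0) q1)).
rewrite -[X in _ <= 2 * X * _]natr1; lra.
Qed.

End shell_volume.

(** * Hyperbolic targets for a mixing and piecewise Lipschitz map *)

Section hyperbolic_targets.
Context (R : realType) (d' : nat).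
Local Notation d := d'.+1.
Variable mu : probability 'rV[R]_d R.
Hypothesis mu_cube : mu (cube R d) = 1%E.
Variable T : 'rV[R]_d -> 'rV[R]_d.
Hypothesis mT : measurable_fun setT T.
Hypothesis muT : forall A, measurable A -> mu (T @^-1` A) = mu A.
Hypothesis T_cube : forall x, cube R d (T x).
Variables c rho : R.
Hypothesis c_gt0 : 0 < c.
Hypothesis rho01 : 0 < rho < 1.
Hypothesis mixing : forall k (q : cell_index d k) n A, measurable A ->
  `|pr mu ([set x | dyadic_cell k x = q] `&` iter n T @^-1` A) -
    pr mu [set x | dyadic_cell k x = q] * pr mu A| <= c * rho ^+ n * pr mu A.
Variable cm : R.
Hypothesis cm_ge0 : 0 <= cm.
Hypothesis mu_le : forall A, measurable A -> (mu A <= cm%:E * lebesgue_rV R d A)%E.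
Variables (Nb : R -> set 'rV[R]_d) (L Cn : R).
Hypothesis L_ge1 : 1 <= L.
Hypothesis Cn_ge0 : 0 <= Cn.
Hypothesis mNb : forall s, measurable (Nb s).
Hypothesis Nb_le : forall s, 0 < s -> pr mu (Nb s) <= Cn * s.
Hypothesis T_lipschitz : forall s y z, cube R d y -> cube R d z -> ~ Nb s y ->
  `|y - z| < s -> `|T y - T z| <= L * `|y - z|.
Variables r b : nat.
Hypothesis r_gt0 : (0 < r)%N.
Hypothesis b_gt0 : (0 < b)%N.
Hypothesis rP : (2 ^+ d) ^+ 2 * rho ^+ r <= 1.
Hypothesis bP : 4 * L <= 2 ^+ b.

Local Notation mcell := (@measurable_dyadic_cell R d).
Local Notation refine := (@dyadic_cell_refine R d).

Definition phi n : R := c * rho ^+ n.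
(** The total mixing error of the cells of a level [k] with [r * k <= n]. *)
Definition tail_rate n : R := c * 2 ^+ d * Num.sqrt rho ^+ n.

Let rho0 : 0 < rho. Proof. by have /andP[] := rho01. Qed.
Let rho1 : rho < 1. Proof. by have /andP[] := rho01. Qed.
Let sqrt_rho : 0 <= Num.sqrt rho < 1.
Proof. by rewrite sqrtr_ge0 -sqrtr1 ltr_sqrt. Qed.

Let phi_ge0 n : 0 <= phi n.
Proof. by rewrite mulr_ge0 ?exprn_ge0// ltW. Qed.

Lemma tail_rate_ge0 n : 0 <= tail_rate n.
Proof. by rewrite !mulr_ge0 ?exprn_ge0 ?sqrtr_ge0// ltW. Qed.

Lemma tail_rate_sums : bounded_sums tail_rate.
Proof.
apply: bounded_sumsZ; first by rewrite mulr_ge0 ?exprn_ge0// ltW.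
exact: bounded_sums_geometric.
Qed.

Lemma tail_rate_linear : exists En, forall n, n%:R * tail_rate n <= En.
Proof.
have [B qB] := bounded_sums_geometric sqrt_rho; have /andP[q0 q1] := sqrt_rho.
exists (c * 2 ^+ d * B) => n; rewrite /tail_rate mulrCA.
apply: ler_wpM2l; first by rewrite mulr_ge0 ?exprn_ge0// ltW.
apply: le_trans (qB n).
apply: (@le_trans _ _ (\sum_(0 <= i < n) Num.sqrt rho ^+ n)).
  by rewrite sumr_const_nat subn0 mulr_natl.
rewrite !big_nat; apply: ler_sum => i /andP[_ i_n].
by apply: ler_wiXn2l; rewrite ?(ltW q1)// ltnW.
Qed.

(** The square of [2 ^ (d * k) * rho ^ n] is at most [rho ^ n], because
    [2 ^ (2 * d) * rho ^ r <= 1] and [n] is at least [r * k]. *)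
Lemma card_cells k n : (r * k <= n)%N ->
  #|cell_index d k|%:R * phi n <= tail_rate n.
Proof.
move=> rkn; rewrite /phi /tail_rate mulrCA -mulrA; apply: ler_wpM2l; first exact: ltW.
have h1 : #|cell_index d k|%:R <= 2 ^+ d * 2 ^+ (d * k) :> R.
  rewrite card_cell_index -exprD -mulnS mulnC exprM -natrX -natrX ler_nat.
  by rewrite leq_exp2r// expnS mul2n -addnn -addn1 leq_add2l expn_gt0.
apply: (@le_trans _ _ (2 ^+ d * 2 ^+ (d * k) * rho ^+ n)).
  by apply: ler_wpM2r => //; rewrite exprn_ge0// ltW.
rewrite -mulrA; apply: ler_wpM2l; first by rewrite exprn_ge0.
have q0 : 0 <= Num.sqrt rho ^+ n by rewrite exprn_ge0// sqrtr_ge0.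
have p0 : 0 <= 2 ^+ (d * k) * rho ^+ n.
  by rewrite mulr_ge0 ?exprn_ge0// ltW.
rewrite -(@ler_pXn2r _ 2)// [leRHS]exprAC sqr_sqrtr; last exact: ltW.
have -> : (2 ^+ (d * k) * rho ^+ n) ^+ 2 =
    ((2 ^+ d) ^+ 2 * rho ^+ r) ^+ k * rho ^+ (n - r * k) * rho ^+ n.
  have e : rho ^+ n = (rho ^+ r) ^+ k * rho ^+ (n - r * k).
    by rewrite -exprM -exprD subnKC.
  rewrite e exprM exprMn; move: (2 ^+ d) => x; rewrite [in RHS]exprMn.
  by rewrite -[(x ^+ 2) ^+ k]exprM (mulnC 2%N) exprM; ring.
apply: ler_piMl; first by rewrite exprn_ge0// ltW.
have a0 : 0 <= (2 ^+ d) ^+ 2 * rho ^+ r by rewrite mulr_ge0 ?exprn_ge0// ltW.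
rewrite -[leRHS]mulr1; apply: ler_pM; rewrite ?exprn_ge0// ?exprn_ile1//; exact: ltW.
Qed.

Definition Csh : R := cm * (2 * d%:R) + 1.
Local Notation sq := (iter_sqrt d').

Let Csh_ge0 : 0 <= Csh. Proof. by rewrite addr_ge0// mulr_ge0// mulr_ge0. Qed.

Lemma pr_shell (v : 'rV[R]_d) a t : 0 <= a -> 0 <= t ->
  pr mu (shell v a t) <= Csh * sq t.
Proof.
move=> a0 t0; have mS := measurable_shell v a t.
have [t1|t1] := leP t 1.
  have t01 : 0 <= t <= 1 by rewrite t0.
  have /andP[s0 _] := @iter_sqrt_itv R d' t t01.
  rewrite -lee_fin -prE//; apply: (le_trans (mu_le mS)).
  apply: (@le_trans _ _ (cm%:E * (2 * d%:R * sq t)%:E)%E).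
    by apply: lee_wpmul2l; [rewrite lee_fin|exact: shell_le].
  by have sq0 := le_trans t0 s0; rewrite -EFinM lee_fin /Csh; lra.
have s1 : 1 <= sq t.
  rewrite [leLHS](_ : 1 = sq 1); first by apply: iter_sqrt_le; exact: ltW.
  by rewrite /iter_sqrt; elim: d' => //= n <-; rewrite sqrtr1.
apply: (le_trans (pr_le1 _ mS)); rewrite -[leLHS]mulr1; apply: ler_pM => //.
by rewrite /Csh lerDr mulr_ge0// mulr_ge0.
Qed.

Let theta : R := sq 2^-1.

Let theta01 : 0 <= theta < 1.
Proof. by apply: iter_sqrt_lt1; rewrite invr_ge0 ler0n invf_lt1// ltr1n. Qed.

Let sq_pow2 (s : R) n : 0 <= s -> sq (s * 2 ^- n) = sq s * theta ^+ n.
Proof. by move=> s0; rewrite iter_sqrtM// -exprVn iter_sqrt_exp// invr_ge0. Qed.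

Let sq_ge0 (s : R) : 0 <= s -> 0 <= sq s.
Proof. exact: iter_sqrt_ge0. Qed.

(** The shell that surrounds a target covered by the cells of level [n %/ r], and
    the total mixing error of these cells. *)
Definition psi n : R := Csh * (sq d%:R * theta ^+ (n %/ r)) + tail_rate n.

Lemma psi_ge0 n : 0 <= psi n.
Proof.
rewrite addr_ge0 ?tail_rate_ge0// !mulr_ge0 ?sq_ge0//.
by rewrite exprn_ge0//; have /andP[] := theta01.
Qed.

Lemma psi_sums : bounded_sums psi.
Proof.
apply: bounded_sumsD; last exact: tail_rate_sums.
do 2 (apply: bounded_sumsZ; rewrite ?sq_ge0//).
exact: bounded_sums_floor.
Qed.

Let mix_le k (q : cell_index d k) n A : measurable A ->
  pr mu ([set x | dyadic_cell k x = q] `&` iter n T @^-1` A) <=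
  (pr mu [set x | dyadic_cell k x = q] + phi n) * pr mu A.
Proof. by move=> mA; have /ler_normlP[_] := mixing q n mA; rewrite /phi; lra. Qed.

Let mit n A : measurable A -> measurable (iter n T @^-1` A) :=
  @measurable_iter_preimage _ _ _ mT n A.

(** Cover the target by the cells of level [n %/ r] that it meets: their union
    exceeds it by a thin shell. *)
Lemma hyper_mixing (v : 'rV[R]_d) s n A : cube R d v -> 0 <= s -> measurable A ->
  pr mu (hyper v s `&` iter n T @^-1` A) <= (pr mu (hyper v s) + psi n) * pr mu A.
Proof.
move=> cv s0 mA; set k := (n %/ r)%N; pose w : R := d%:R * 2 ^- k.
have w0 : 0 <= w by rewrite mulr_ge0// invr_ge0 exprn_ge0.
pose S := [pred q : cell_index d k | `[< exists2 x, hyper v s x & dyadic_cell k x = q >]].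
pose Q q := [set x : 'rV[R]_d | dyadic_cell k x = q].
have mH := measurable_hyper v s; have mHA := measurableI _ _ mH (mit n mA).
have mSh := measurable_shell v s w; have mc := @measurable_cube R d.
have A0 := pr_ge0 mu A.
have step1 : pr mu (hyper v s `&` iter n T @^-1` A) <=
    \sum_(q in S) (pr mu (Q q) + phi n) * pr mu A.
  rewrite (pr_partition mu (@mcell k) mHA) [leRHS]big_mkcond /=.
  apply: ler_sum => q _; case: ifPn => qS.
    apply: le_trans (mix_le _ _ mA); apply: le_pr.
    - by apply: measurableI => //; exact: mcell.
    - by apply: measurableI; [exact: mcell|exact: mit].
    - by move=> x [qx [_ ?]].
  rewrite (_ : _ `&` _ = set0) ?pr0// -subset0 => x [qx [hx _]].
  by move: qS; rewrite /S inE /=; case/negP; apply/asboolP; exists x.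
have step2 : \sum_(q in S) pr mu (Q q) <= pr mu (hyper v s) + pr mu (shell v s w).
  apply: (@le_trans _ _ (pr mu ((hyper v s `|` shell v s w) `|` ~` cube R d))); last first.
    apply: (le_trans (pr_setU _ _ _)); first exact: measurableU.
      exact: measurableC.
    by rewrite (pr_setC_cube mu_cube) addr0; exact: pr_setU.
  have mU : measurable ((hyper v s `|` shell v s w) `|` ~` cube R d).
    by apply: measurableU; [exact: measurableU|exact: measurableC].
  rewrite (pr_partition mu (@mcell k) mU) [leLHS]big_mkcond /=.
  apply: ler_sum => q _; case: ifPn => qS; last exact: pr_ge0.
  apply: le_pr; [exact: mcell|by apply: measurableI => //; exact: mcell|].
  move=> x qx; split => //; have [cx|cx] := pselect (cube R d x); last by right.
  left; move: qS; rewrite /S inE => -[y [cy ys] qy].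
  have xy : `|x - y| <= 2 ^- k by apply: norm_dyadic_cell; rewrite // qx qy.
  have := pdist_lipschitz cx cv cy cv; rewrite subrr normr0 addr0.
  move=> /(le_trans (ler_norm _)) h.
  have {}h : pdist x v < s + w.
    have : d%:R * `|x - y| <= w by exact: ler_wpM2l.
    move: ys => /=; lra.
  by have [xs|xs] := ltP (pdist x v) s; [left|right]; split => //=; rewrite xs.
apply: (le_trans step1); rewrite -mulr_suml; apply: ler_wpM2r => //.
rewrite big_split /= sumr_const -[_ *+ _]mulr_natl.
have h3 : #|S|%:R * phi n <= tail_rate n.
  apply: le_trans (card_cells (k := k) _); last by rewrite mulnC leq_trunc_div.
  by apply: ler_wpM2r => //; rewrite ler_nat max_card.
have h4 : pr mu (shell v s w) <= Csh * (sq d%:R * theta ^+ k).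
  by rewrite -sq_pow2//; exact: pr_shell.
rewrite /psi -/k; lra.
Qed.


(** The level of the cells on which the centre of the [n]-th target is kept
    constant.  It grows so slowly that, up to time [r * b * m], the number of these
    cells is still outweighed by the mixing rate at time [m] ([level_near]); later
    on, so is the number of cells of level [b * m], which resolve the [m]-th
    event. *)
Definition level n := (n %/ (r * r * b))%N.

Let rrb_gt0 : (0 < r * r * b)%N. Proof. by rewrite !muln_gt0 r_gt0 b_gt0. Qed.

Lemma level_mono : {homo level : m n / (m <= n)%N >-> (m <= n)%N}.
Proof. by move=> m n; exact: leq_div2r. Qed.

Lemma level_near m n : (n < r * b * m)%N -> (r * level n <= m)%N.
Proof.
move=> h; have h1 : (level n * (r * r * b) <= n)%N by exact: leq_trunc_div.
have h2 : (r * b * (r * level n) < r * b * m)%N.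
  by apply: leq_ltn_trans h; apply: leq_trans h1; rewrite leq_eqVlt; apply/orP; left; apply/eqP; ring.
by move: h2; rewrite ltn_pmul2l ?muln_gt0 ?r_gt0//; exact: ltnW.
Qed.

Lemma level_small n : (r * level n <= n)%N.
Proof.
rewrite mulnC; apply: leq_trans (leq_trunc_div n (r * r * b)).
by rewrite leq_mul2l -mulnA leq_pmulr ?orbT// muln_gt0 r_gt0.
Qed.

Lemma level_b n : (level n <= b * n)%N.
Proof. by apply: leq_trans (leq_div _ _) _; rewrite leq_pmull. Qed.

(** The centre of the [n]-th target, absent on the cells without target. *)
Variable ctr : nat -> 'rV[R]_d -> option 'rV[R]_d.
Variable eta : nat -> R.
Hypothesis eta_ge0 : forall n, 0 <= eta n.
Hypothesis ctr_cube : forall n x y, ctr n x = Some y -> cube R d y.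
Hypothesis ctr_cell : forall n x y,
  dyadic_cell (level n) x = dyadic_cell (level n) y -> ctr n x = ctr n y.

Definition target n x := if ctr n x is Some y then hyper y (eta n) else set0.

Lemma measurable_target n x : measurable (target n x).
Proof. by rewrite /target; case: (ctr n x) => [y|//]; exact: measurable_hyper. Qed.

Lemma target_cell n x y :
  dyadic_cell (level n) x = dyadic_cell (level n) y -> target n x = target n y.
Proof. by move=> /ctr_cell; rewrite /target => ->. Qed.

Lemma target_mixing m x n A : measurable A ->
  pr mu (target m x `&` iter n T @^-1` A) <= (pr mu (target m x) + psi n) * pr mu A.
Proof.
move=> mA; rewrite /target; case e : (ctr m x) => [y|].
  by apply: hyper_mixing => //; exact: ctr_cube e.
by rewrite set0I pr0 add0r mulr_ge0 ?psi_ge0// pr_ge0.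
Qed.

Lemma measurable_hit_target n : measurable (hit T target n).
Proof.
exact: (measurable_hit mT mcell refine measurable_target target_cell).
Qed.

Lemma pr_hit_target (u : nat -> R) : (forall n x, pr mu (target n x) <= u n) ->
  forall n, pr mu (hit T target n) <= (1 + tail_rate n) * u n.
Proof.
move=> tu; exact: (pr_hit_le mT mcell refine phi_ge0 mixing card_cells level_small
  measurable_target target_cell tu).
Qed.

Let w m : R := d%:R * 4 ^- m.

Let w_ge0 m : 0 <= w m. Proof. by rewrite mulr_ge0// invr_ge0 exprn_ge0. Qed.

(** A neighbourhood of the boundary of the target; by [pdist_lipschitz], [w m]
    bounds the change of [pdist] under a displacement by [4 ^- m]. *)
Definition fringe m x := if ctr m x is Some y
  then shell y (Num.max 0 (eta m - w m)) (3 * w m) else set0.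

Let measurable_fringe n x : measurable (fringe n x).
Proof. by rewrite /fringe; case: (ctr n x) => [y|//]; exact: measurable_shell. Qed.

Let fringe_cell n x y :
  dyadic_cell (level n) x = dyadic_cell (level n) y -> fringe n x = fringe n y.
Proof. by move=> /ctr_cell; rewrite /fringe => ->. Qed.

Let fringe_rate m := Csh * (sq (3 * d%:R) * (theta ^+ 2) ^+ m).

Let fringe_le m x : pr mu (fringe m x) <= fringe_rate m.
Proof.
rewrite /fringe; case: (ctr m x) => [y|]; last first.
  rewrite pr0 !mulr_ge0 ?sq_ge0 ?mulr_ge0//.
  by rewrite exprn_ge0// exprn_ge0//; have /andP[] := theta01.
apply: (le_trans (pr_shell _ _ _)); [by rewrite le_max lexx|by rewrite mulr_ge0|].
apply: ler_wpM2l => //; rewrite -exprM -sq_pow2 ?mulr_ge0//.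
by rewrite exprM -natrX mulrA.
Qed.

Definition rough m := \bigcup_(j < m) (iter j T @^-1` Nb (2 * 4 ^- m)).

(** Two points of a cell of level [b * m] that disagree on the [m]-th event both
    lie here ([unresolved_straddle]). *)
Definition unresolved m := rough m `|` hit T fringe m.

Let measurable_rough m : measurable (rough m).
Proof. by apply: bigcup_measurable => j _; exact: mit. Qed.

Let pow4 m : 0 < 4 ^- m :> R. Proof. by rewrite invr_gt0 exprn_gt0. Qed.

Let rough_le m : pr mu (rough m) <= 2 * Cn * 2 ^- m.
Proof.
have mN : forall j, measurable (iter j T @^-1` Nb (2 * 4 ^- m)) by move=> j; exact: mit.
rewrite -lee_fin -prE//.
apply: (le_trans (measure_le_fin_cover mu (A := fun j : 'I_m =>
   iter j T @^-1` Nb (2 * 4 ^- m)) _ _ _)) => //.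
  by move=> x [j /= jm Nx]; exists (Ordinal jm).
apply: (@le_trans _ _ (\sum_(j < m) (Cn * (2 * 4 ^- m))%:E)%E).
  apply: lee_sum => j _.
  suff h : (mu (iter j T @^-1` Nb (2 * 4 ^- m)) <= (Cn * (2 * 4 ^- m))%:E)%E by exact: h.
  rewrite (mu_iter mT muT)// prE// lee_fin.
  by apply: Nb_le; rewrite mulr_gt0.
rewrite sumEFin lee_fin sumr_const card_ord -[_ *+ m]mulr_natl.
have -> : 4 ^- m = 2 ^- m * 2 ^- m :> R.
  by rewrite -invfM -exprMn; congr (_ ^- m); ring.
have h : m%:R * 2 ^- m <= 1 :> R.
  by rewrite ler_pdivrMr ?exprn_gt0// mul1r -natrX ler_nat ltnW// ltn_expl.
have p : 0 <= 2 * Cn * 2 ^- m by rewrite !mulr_ge0// invr_ge0 exprn_ge0.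
have := ler_wpM2l p h; lra.
Qed.

Definition unresolved_rate m : R :=
  2 * Cn * 2 ^- m + (1 + c * 2 ^+ d) * fringe_rate m.

Let fringe_rate_ge0 m : 0 <= fringe_rate m.
Proof. exact: le_trans (pr_ge0 mu (fringe m 0)) (fringe_le m 0). Qed.

Lemma measurable_unresolved m : measurable (unresolved m).
Proof.
apply: measurableU => //.
exact: (measurable_hit mT mcell refine measurable_fringe fringe_cell).
Qed.

Lemma pr_unresolved m : pr mu (unresolved m) <= unresolved_rate m.
Proof.
have mh := measurable_hit mT mcell refine measurable_fringe fringe_cell m.
apply: (le_trans (pr_setU _ _ _)) => //; apply: lerD => //.
have := pr_hit_le mT mcell refine phi_ge0 mixing card_cells level_small
  measurable_fringe fringe_cell fringe_le m.
move=> /le_trans; apply; apply: ler_wpM2r => //; rewrite lerD2l /tail_rate.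
rewrite ler_piMr ?mulr_ge0 ?exprn_ge0//; first exact: ltW.
by apply: exprn_ile1; have /andP[? ?] := sqrt_rho => //; exact: ltW.
Qed.

Lemma unresolved_sums : bounded_sums unresolved_rate.
Proof.
apply: bounded_sumsD.
  apply: bounded_sumsZ; first by rewrite mulr_ge0.
  under eq_fun do rewrite -exprVn.
  by apply: bounded_sums_geometric; rewrite invr_ge0 ler0n invf_lt1// ltr1n.
apply: bounded_sumsZ; first by rewrite addr_ge0// mulr_ge0 ?exprn_ge0// ltW.
do 2 (apply: bounded_sumsZ; rewrite ?sq_ge0 ?mulr_ge0//).
apply: bounded_sums_geometric; have /andP[t0 t1] := theta01.
by rewrite exprn_ge0//= exprn_ilt1.
Qed.

Let iter_cube n x : cube R d x -> cube R d (iter n T x).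
Proof. by case: n => // n _; exact: T_cube. Qed.

Let L_pow m : L ^+ m * 2 ^- (b * m) <= 4 ^- m.
Proof.
have -> : 2 ^- (b * m) = ((2 ^+ b)^-1) ^+ m :> R by rewrite exprM exprVn.
rewrite -[4 ^- m]exprVn -exprMn; apply: lerXn2r.
- by rewrite nnegrE mulr_ge0 ?invr_ge0 ?exprn_ge0// (le_trans ler01).
- by rewrite nnegrE invr_ge0.
- by rewrite ler_pdivrMr ?exprn_gt0// mulrC ler_pdivlMr// mulrC.
Qed.

Let iter_close m x y : cube R d x -> cube R d y -> ~ rough m x ->
  `|x - y| <= 2 ^- (b * m) ->
  forall j, (j <= m)%N -> `|iter j T x - iter j T y| <= L ^+ j * 2 ^- (b * m).
Proof.
move=> cx cy nx xy; elim=> [|j IH] jm; first by rewrite expr0 mul1r.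
have {}IH := IH (ltnW jm).
have L4 : L ^+ j * 2 ^- (b * m) <= 4 ^- m.
  have : L ^+ j <= L ^+ m by apply: ler_weXn2l => //; exact: ltnW.
  have b0 : 0 <= 2 ^- (b * m) :> R by rewrite invr_ge0 exprn_ge0.
  move=> /(ler_wpM2r b0)/le_trans; apply.
  exact: L_pow.
rewrite /= exprS -mulrA.
have lt : `|iter j T x - iter j T y| < 2 * 4 ^- m.
  by apply: (le_lt_trans IH); apply: (le_lt_trans L4); rewrite ltr_pMl// ltr1n.
apply: (@le_trans _ _ (L * `|iter j T x - iter j T y|)).
  apply: (T_lipschitz (s := 2 * 4 ^- m)) => //; try exact: iter_cube.
  by move=> Nj; apply: nx; exists j.
by apply: ler_wpM2l => //; exact: le_trans ler01 L_ge1.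
Qed.

(** Along an orbit that avoids the neighbourhoods of the boundaries of the
    pieces, [m] iterates stay close for points in the same cell; hence if just
    one of them hits the target, both land close to its boundary. *)
Lemma unresolved_straddle K m x y : (b * m <= K)%N ->
  dyadic_cell K x = dyadic_cell K y -> cube R d x -> cube R d y ->
  hit T target m x -> ~ hit T target m y -> unresolved m x /\ unresolved m y.
Proof.
move=> bmK xy cx cy hx hy.
have dxy : `|x - y| <= 2 ^- (b * m).
  by apply: norm_dyadic_cell => //; exact: refine xy.
have txy : ctr m x = ctr m y.
  by apply: ctr_cell; apply: refine xy; exact: leq_trans (level_b m) bmK.
suff H : ~ rough m x \/ ~ rough m y -> hit T fringe m x /\ hit T fringe m y.
  have [rx|rx] := pselect (rough m x); have [ry|ry] := pselect (rough m y).
  - by split; left.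
  - by have [? ?] := H (or_intror ry); split; right.
  - by have [? ?] := H (or_introl rx); split; right.
  - by have [? ?] := H (or_introl rx); split; right.
move=> nr.
have close : `|iter m T x - iter m T y| <= 4 ^- m.
  case: nr => nr; apply: le_trans (L_pow m).
    exact: iter_close.
  by rewrite distrC; apply: iter_close => //; rewrite distrC.
move: hx hy; rewrite /hit /= /target /fringe -txy.
case e : (ctr m x) => [v|//] -[cTx hx] hy.
have cTy : cube R d (iter m T y) by exact: iter_cube.
have cv := ctr_cube e.
have := pdist_lipschitz cTx cv cTy cv; rewrite subrr normr0 addr0 => h.
have {h} : `|pdist (iter m T x) v - pdist (iter m T y) v| <= w m.
  by apply: (le_trans h); exact: ler_wpM2l.
have {hy} : eta m <= pdist (iter m T y) v.
  by rewrite leNgt; apply/negP => h; apply: hy.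
have wm : 0 < w m by rewrite mulr_gt0// ltr0n.
have p0 := pdist_ge0 (iter m T x) v; have q0 := pdist_ge0 (iter m T y) v.
rewrite /= in hx.
set p := pdist (iter m T x) v in p0 hx *; set q := pdist (iter m T y) v in q0 *.
rewrite ler_norml => hq /andP[h1 h2].
have m2 : eta m - w m <= Num.max 0 (eta m - w m) by rewrite le_max lexx orbT.
split; split => //=; rewrite -/p -/q ge_max -andbA; apply/and3P; split => //; lra.
Qed.

(** All the error terms of the second moment estimate have bounded sums. *)
Lemma negligible_finitely_many_hits (u : nat -> R) (kappa : R) (Z : set 'rV[R]_d) N :
  (forall n x, pr mu (target n x) <= u n) -> ~ bounded_sums u -> 0 < kappa ->
  (forall x n, Z x -> (N <= n)%N ->
     ~ hit T target n x /\ kappa * u n <= pr mu (target n x)) ->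
  mu.-negligible Z.
Proof.
move=> tu uoo kappa0 ZN.
have [Bpsi hpsi] := psi_sums; have [Be he] := tail_rate_sums.
have [Ba ha] := unresolved_sums; have [En hEn] := tail_rate_linear.
have psi_le n : psi n <= Bpsi.
  apply: (le_trans _ (hpsi n.+1)); rewrite big_nat_recr//= lerDr.
  by apply: sumr_ge0 => i _; exact: psi_ge0.
exact: (negligible_never_hit mT mcell refine phi_ge0 mixing card_cells
  tail_rate_ge0 level_mono level_near level_small level_b measurable_target
  target_cell tu psi_ge0 target_mixing (@measurable_cube R d)
  (pr_setC_cube mu_cube) measurable_unresolved pr_unresolved unresolved_straddle
  psi_le hpsi he ha hEn kappa0 uoo ZN).
Qed.

End hyperbolic_targets.

(** * Measures of hyperbolic neighbourhoods and the logarithmic weight *)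

Section weights.
Context (R : realType) (d : nat).
Hypothesis d_gt0 : (0 < d)%N.
Local Notation w := (@log_weight R d).

Let pS n : 2 ^- n = 2 * 2 ^- n.+1 :> R.
Proof. by rewrite exprS invfM mulrA divff// mul1r. Qed.

Let p0 n : 0 < 2 ^- n :> R. Proof. by rewrite invr_gt0 exprn_gt0. Qed.

Let pS_le n : 2 ^- n.+1 <= 2^-1 :> R.
Proof.
rewrite exprS invfM ler_piMr ?invr_ge0// invf_le1 ?exprn_gt0// exprn_ege1//.
by rewrite ler1n.
Qed.

Lemma log_weight_ge0 t : 0 <= t <= 1 -> 0 <= w t.
Proof.
move=> /andP[t0 t1]; rewrite /log_weight mulr_ge0// exprn_ge0// oppr_ge0.
by rewrite ln_le0.
Qed.

Lemma exists_dyadic_lt (t : R) : 0 < t -> exists K, 2 ^- K < t.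
Proof.
move=> t0; have := cvg_geometric (1 : R) (_ : `|2^-1| < 1).
rewrite ger0_norm ?invr_ge0// invf_lt1 ?ltr1n// => /(_ isT) /cvgr_lt /(_ _ t0).
by move=> [k _ /(_ k (leqnn k))]; rewrite /geometric /= mul1r exprVn; exists k.
Qed.

(** The logarithm varies by a bounded factor between two consecutive negative
    powers of 2. *)
Lemma log_weight_dyadic t : 0 < t <= 2^-1 -> exists K : nat,
  [/\ (0 < K)%N, 2 ^- K.+1 < t <= 2 ^- K,
      (ln 2 ^+ d.-1) * (K%:R ^+ d.-1 * 2 ^- K.+1) <= w t &
      w t <= K.+1%:R ^+ d.-1 * 2 ^- K].
Proof.
move=> /andP[t0 t2].
have [M Mt] := exists_dyadic_lt t0.
have [|K KM /andP[K1 K2]] := @dyadic_scale R t M.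
  by rewrite Mt (le_trans t2)// invf_le1// ler1n.
have K0 : (0 < K)%N.
  case: K K1 {KM K2} => // /(lt_le_trans)/(_ t2); rewrite expr1 ltxx //.
have l2 : 0 < ln 2 :> R by rewrite ln_gt0// ltr1n.
have lnp n : - ln (2 ^- n) = n%:R * ln 2 :> R.
  by rewrite lnV ?posrE ?exprn_gt0// opprK lnXn// mulr_natl.
have l21 : ln 2 <= 1 :> R.
  by have -> : 2 = 1 + 1 :> R; [ring|apply: le_ln1Dx; lra].
have h1 : K%:R * ln 2 <= - ln t by rewrite -lnp lerN2 ler_ln ?posrE.
have h2 : - ln t <= K.+1%:R * ln 2 by rewrite -lnp lerN2 ler_ln ?posrE// ltW.
exists K; split; rewrite ?K1 ?K2// /log_weight.
  rewrite mulrA -exprMn mulrC; apply: ler_pM; rewrite ?(ltW (p0 _)) ?(ltW K1)//.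
    by rewrite exprn_ge0// mulr_ge0// ltW.
  by apply: lerXn2r; rewrite ?nnegrE 1?mulrC// ?(le_trans _ h1)// mulr_ge0// ltW.
rewrite mulrC; apply: ler_pM => //; rewrite ?(ltW t0)//.
  by rewrite exprn_ge0// (le_trans _ h1)// mulr_ge0// ltW.
apply: lerXn2r; rewrite ?nnegrE//.
  by rewrite (le_trans _ h1)// mulr_ge0// ltW.
by apply: (le_trans h2); rewrite ler_piMr.
Qed.

Lemma subset_hyper (v : 'rV[R]_d) s t : s <= t -> hyper v s `<=` hyper v t.
Proof. by move=> st x [cx /= xs]; split => //=; exact: lt_le_trans st. Qed.

Variable mu : probability 'rV[R]_d R.

Lemma pr_hyper_le (cm : R) : 0 <= cm ->
  (forall A, measurable A -> (mu A <= cm%:E * lebesgue_rV R d A)%E) ->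
  exists2 C, 0 < C & forall v t, cube R d v -> 0 < t <= 2^-1 ->
    pr mu (hyper v t) <= C * w t.
Proof.
move=> cm0 mu_le; have [C [C0 HC]] := hyper_le R d.
have l2 : 0 < ln 2 :> R by rewrite ln_gt0// ltr1n.
have l2d : 0 < ln 2 ^+ d.-1 :> R by rewrite exprn_gt0.
exists (cm * C * (2 * 2 ^+ d.-1) / ln 2 ^+ d.-1 + 1).
  by rewrite ltr_wpDl//; apply: divr_ge0 (ltW l2d); rewrite !mulr_ge0// exprn_ge0.
move=> v t cv t01; have [K [K0 /andP[_ tK] wK _]] := log_weight_dyadic t01.
have wt0 : 0 <= w t.
  by apply: log_weight_ge0; case/andP: t01 => a e; rewrite ltW//= (le_trans e)// invf_le1// ler1n.
have mH := @measurable_hyper R d v.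
rewrite mulrDl mul1r; apply: ler_wpDr => //.
apply: (@le_trans _ _ (pr mu (hyper v (2 ^- K)))).
  by apply: le_pr => //; exact: subset_hyper.
rewrite -lee_fin -prE//; apply: (le_trans (mu_le _ (mH _))).
apply: (@le_trans _ _ (cm%:E * (C * K.+1%:R ^+ d.-1 * 2 ^- K)%:E)%E).
  by apply: lee_wpmul2l; [rewrite lee_fin|exact: HC].
rewrite -EFinM lee_fin.
have hK : K.+1%:R ^+ d.-1 <= 2 ^+ d.-1 * K%:R ^+ d.-1 :> R.
  rewrite -exprMn; apply: lerXn2r; rewrite ?nnegrE ?mulr_ge0//.
  by rewrite -natrM ler_nat mul2n -addnn -addn1 leq_add2l.
rewrite [2 ^- K]pS.
have h1 : K%:R ^+ d.-1 * 2 ^- K.+1 <= w t / ln 2 ^+ d.-1.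
  by rewrite ler_pdivlMr// mulrC.
have h2 : cm * C * 2 * 2 ^- K.+1 * K.+1%:R ^+ d.-1 <=
   cm * C * 2 * 2 ^- K.+1 * (2 ^+ d.-1 * K%:R ^+ d.-1).
  by apply: ler_wpM2l => //; rewrite !mulr_ge0// ltW.
have h3 : cm * C * 2 * 2 ^+ d.-1 * (K%:R ^+ d.-1 * 2 ^- K.+1) <=
  cm * C * 2 * 2 ^+ d.-1 * (w t / ln 2 ^+ d.-1).
  by apply: ler_wpM2l => //; rewrite !mulr_ge0// exprn_ge0.
lra.
Qed.

Lemma pr_hyper_ge (V : set 'rV[R]_d) (c : R) r : 0 < c ->
  (forall A, measurable A -> A `<=` cube R d `&` V ->
     (c%:E * lebesgue_rV R d A <= mu A)%E) ->
  exists kappa t0, [/\ 0 < kappa, 0 < t0 <= 2^-1 & forall v (s : 'I_d -> bool) t,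
    corner s r v `<=` cube R d `&` V -> 0 < t < t0 ->
    kappa * w t <= pr mu (hyper v (t / 2))].
Proof.
move=> c0 mu_ge; have [C [K0 [C0 HC]]] := @corner_hyper_ge R d r d_gt0.
exists (c * C / 4), (2 ^- K0.+1); split.
- by rewrite divr_gt0// mulr_gt0.
- by rewrite p0 pS_le.
move=> v s t sV /andP[t_gt0 tt0].
have t01 : 0 < t <= 2^-1.
  by rewrite t_gt0 (le_trans (ltW tt0)).
have [K [_ /andP[Kt _] _ wK]] := log_weight_dyadic t01.
have K0K : (K0 <= K.+2)%N.
  rewrite leqNgt; apply/negP => h.
  have h2 : 2 ^- K0.+1 <= 2 ^- K.+1 :> R.
    rewrite lef_pV2 ?posrE ?exprn_gt0//; apply: ler_weXn2l; first by rewrite ler1n.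
    by rewrite ltnS; do 3! apply: ltnW.
  by have := lt_le_trans (lt_trans Kt tt0) h2; rewrite ltxx.
have mC := @measurable_corner_hyper R d s r v (2 ^- K.+2).
have sub : corner_hyper s r v (2 ^- K.+2) `<=` cube R d `&` V by move=> x [/sV].
apply: (@le_trans _ _ (pr mu (corner_hyper s r v (2 ^- K.+2)))); last first.
  apply: le_pr => //; first exact: measurable_hyper.
  move=> x [sx /= xK]; split; first by have [] := sV _ sx.
  by apply: lt_le_trans xK _; rewrite ler_pdivlMr// mulrC -pS ltW.
rewrite -lee_fin -prE//; apply: le_trans (mu_ge _ mC sub).
apply: (@le_trans _ _ (c%:E * (C * K.+2%:R ^+ d.-1 * 2 ^- K.+2)%:E)%E); last first.
  by apply: lee_wpmul2l; [rewrite lee_fin ltW|exact: HC].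
rewrite -EFinM lee_fin.
have h1 : K.+1%:R ^+ d.-1 <= K.+2%:R ^+ d.-1 :> R.
  by apply: lerXn2r; rewrite ?nnegrE// ler_nat.
have h2 : c * C / 4 * w t <= c * C / 4 * (K.+1%:R ^+ d.-1 * 2 ^- K).
  by apply: ler_wpM2l => //; rewrite divr_ge0// mulr_ge0// ltW.
apply: (le_trans h2); rewrite [2 ^- K]pS [2 ^- K.+1]pS.
have h3 : c * C * 2 ^- K.+2 * K.+1%:R ^+ d.-1 <= c * C * 2 ^- K.+2 * K.+2%:R ^+ d.-1.
  by apply: ler_wpM2l => //; rewrite !mulr_ge0// ltW.
lra.
Qed.

End weights.

Section series.
Context (R : realType).
Implicit Types v : nat -> R.

(** Nonnegativity from some rank on suffices to compare the real and the
    extended real sums; the first weights can be negative. *)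
Lemma bounded_sums_lty v N0 : (forall n, (N0 <= n)%N -> 0 <= v n) ->
  (bounded_sums v <-> (\sum_(1 <= n <oo) (v n)%:E < +oo)%E).
Proof.
move=> v0; pose N := N0.+1.
pose S := (\sum_(N <= n <oo) (v n)%:E)%E.
have vN n : (N <= n)%N -> (0 <= (v n)%:E)%E by move=> Nn; rewrite lee_fin v0// ltnW.
have cS : (\sum_(N <= n < M) (v n)%:E)%E @[M --> \oo] --> S.
  by apply: is_cvg_nneseries => n Nn _; exact: vN.
have e : (\sum_(1 <= n <oo) (v n)%:E = (\sum_(1 <= n < N) v n)%:E + S)%E.
  apply/cvg_lim => //; rewrite -sumEFin.
  apply: (@cvg_trans _ ((\sum_(1 <= n < N) (v n)%:E +
      \sum_(N <= n < M) (v n)%:E)%E @[M --> \oo])); last first.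
    by apply: cvgeD => //; [rewrite sumEFin fin_num_adde_defr|exact: cvg_cst].
  apply: near_eq_cvg; near=> M; rewrite -big_cat_nat//=; near: M.
  exact: nbhs_infty_ge.
have S_ge M : (N <= M)%N -> ((\sum_(N <= n < M) v n)%:E <= S)%E.
  move=> NM; rewrite -sumEFin; apply: nneseries_lim_ge => n Nn _; exact: vN.
rewrite e; split.
  move=> [B vB]; apply: (@le_lt_trans _ _ ((\sum_(1 <= n < N) v n)%:E +
      (B - \sum_(0 <= n < N) v n)%:E)%E); last by rewrite -EFinD ltry.
  apply: leeD2l; apply: lime_le; first by apply: cvgP cS.
  near=> M; rewrite sumEFin lee_fin lerBrDl -big_cat_nat//=; near: M.
  exact: nbhs_infty_ge.
move=> Soo; have Sfin : S \is a fin_num.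
  rewrite ge0_fin_numE; last first.
    by apply: (le_trans _ (S_ge N (leqnn N))); rewrite big_geq.
  rewrite ltey; apply/eqP => Sy; move: Soo; rewrite Sy addey// ltxx //.
apply: (@bounded_sums_eventually _ _ (fun n => if (N <= n)%N then v n else 0) N).
  by move=> n Nn; rewrite Nn.
exists (fine S) => M.
have [NM|MN] := leqP N M.
  rewrite (@big_cat_nat _ _ _ N)//= big_nat big1 ?add0r; last first.
    by move=> i /andP[_ iN]; rewrite leqNgt iN.
  rewrite big_nat (eq_bigr v); last by move=> i /andP[->].
  by rewrite -big_nat -lee_fin fineK// S_ge.
rewrite big_nat big1; last first.
  by move=> i /andP[_ iM]; rewrite leqNgt (ltn_trans iM MN).
rewrite fine_ge0//; apply: (le_trans _ (S_ge N (leqnn N))); by rewrite big_geq.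
Unshelve. all: by end_near.
Qed.

End series.

(** * The pieces of a piecewise expanding map *)

Section pieces.
Context (R : realType) (d : nat).
Variables (Q : nat) (U : 'I_Q -> set 'rV[R]_d) (T : 'rV[R]_d -> 'rV[R]_d).
Hypothesis U_open : forall i, open (U i).
Hypothesis U_cube : forall i, U i `<=` cube R d.
Hypothesis U_cover : \bigcup_i closure (U i) = cube R d.
Hypothesis T_C1 : forall i, exists W S, [/\ open W, closure (U i) `<=` W,
  C1_on W S & forall x, U i x -> S x = T x].

Lemma pieces_continuous i x : U i x -> {for x, continuous T}.
Proof.
move=> Ux; have [W [S [oW UW C1 ST]]] := T_C1 i.
have [dS _] := C1 _ (UW _ (subset_closure Ux)).
have cS := differentiable_continuous dS.
rewrite /prop_for /continuous_at -(ST _ Ux).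
apply: cvg_trans cS; apply: near_eq_cvg; first exact: nbhs_filter.
have nU : nbhs x (U i) by apply: open_nbhs_nbhs.
apply: (@filterS _ (nbhs x) (nbhs_filter x) (U i) _ _ nU).
by move=> y /ST.
Qed.

Lemma pieces_lipschitz : exists2 L : R, 1 <= L & forall i y z,
  (forall t : R, 0 <= t <= 1 -> U i (segment y z t)) -> `|T y - T z| <= L * `|y - z|.
Proof.
have H i : exists L : R, 0 <= L /\ forall y z,
    (forall t : R, 0 <= t <= 1 -> U i (segment y z t)) -> `|T y - T z| <= L * `|y - z|.
  have [W [S [oW UW C1 ST]]] := T_C1 i.
  have [L L0 HL] := lipschitz_along_segments C1 UW (compact_closure_cube (@U_cube i)).
  exists L; split => // y z Uyz.
  have Uy : U i y by have := Uyz 0; rewrite segment0; apply; rewrite lexx ler01.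
  have Uz : U i z by have := Uyz 1; rewrite segment1; apply; rewrite lexx ler01.
  by rewrite -!ST//; apply: HL => t t01; apply: subset_closure; exact: Uyz.
have [L HL] := choice H.
have L0 i : 0 <= L i by have [] := HL i.
exists (1 + \sum_i L i); first by rewrite lerDl sumr_ge0.
move=> i y z Uyz; have [_ /(_ y z Uyz)/le_trans] := HL i; apply.
apply: ler_wpM2r => //; rewrite (bigD1 i)//= addrCA lerDl.
by rewrite addr_ge0// sumr_ge0.
Qed.

Definition boundary_layer (s : R) := \bigcup_i neighbourhood (frontier (U i)) s.

Lemma measurable_boundary_layer s : measurable (boundary_layer s).
Proof.
apply: fin_bigcup_measurable => // i _; apply: open_measurable_mx.
exact: open_neighbourhood.
Qed.

(** A segment that starts away from the boundaries and is shorter than the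
    distance to them stays in one piece. *)
Lemma segment_in_piece s y z : cube R d y -> ~ boundary_layer s y -> `|y - z| < s ->
  exists i, forall t : R, 0 <= t <= 1 -> U i (segment y z t).
Proof.
move=> cy ny yz; have : cube R d y by [].
rewrite -U_cover => -[i _ Uy]; exists i.
have Uiy : U i y.
  apply: contrapT => nU; apply: ny; exists i => //; exists y.
    by split => // /interior_subset.
  by rewrite subrr normr0; apply: le_lt_trans yz.
move=> t t01; apply: contrapT => nUt; apply: ny; exists i => //.
have [t' t'01 ft'] := segment_frontier (@U_open i) Uiy nUt.
exists (segment y (segment y z t) t') => //.
apply: le_lt_trans yz; apply: (le_trans (segment_dist _ _ t'01)).
exact: segment_dist.
Qed.

Variable mu : probability 'rV[R]_d R.
Variable cm : R.
Hypothesis cm_ge0 : 0 <= cm.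
Hypothesis mu_le : forall A, measurable A -> (mu A <= cm%:E * lebesgue_rV R d A)%E.
Variable K : R.
Hypothesis U_content : forall i, (upper_content (frontier (U i)) <= K%:E)%E.

(** The content controls small neighbourhoods only; for the others the trivial
    bound 1 is at most [s / e0]. *)
Lemma pr_neighbourhood_frontier i : exists C : R, 0 <= C /\
  forall s, 0 < s -> pr mu (neighbourhood (frontier (U i)) s) <= C * s.
Proof.
have KK : (upper_content (frontier (U i)) <= `|K|%:E)%E.
  by apply: (le_trans (U_content i)); rewrite lee_fin ler_norm.
have [e0 e00 He] := upper_content_bound KK.
exists (cm * (`|K| + 1) + e0^-1); split.
  by rewrite addr_ge0 ?invr_ge0 ?mulr_ge0 ?addr_ge0// ltW.
move=> s s0; have mN : measurable (neighbourhood (frontier (U i)) s).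
  by apply: open_measurable_mx; exact: open_neighbourhood.
have a0 : 0 <= cm * (`|K| + 1) * s by rewrite !mulr_ge0 ?addr_ge0// ltW.
have b0 : 0 <= e0^-1 * s by rewrite mulr_ge0 ?invr_ge0// ltW.
rewrite mulrDl; have [se0|e0s] := ltP s e0.
  apply: ler_wpDr => //; rewrite -lee_fin -prE//; apply: (le_trans (mu_le mN)).
  rewrite -mulrA EFinM; apply: lee_wpmul2l; first by rewrite lee_fin.
  by apply: He; rewrite s0.
apply: ler_wpDl => //; apply: (le_trans (pr_le1 _ mN)).
by rewrite mulrC ler_pdivlMr// mul1r.
Qed.

Lemma pr_boundary_layer : exists2 C : R, 0 <= C &
  forall s, 0 < s -> pr mu (boundary_layer s) <= C * s.
Proof.
have [C HC] := choice pr_neighbourhood_frontier.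
exists (\sum_i C i); first by apply: sumr_ge0 => i _; have [] := HC i.
move=> s s0.
have mN i : measurable (neighbourhood (frontier (U i)) s).
  by apply: open_measurable_mx; exact: open_neighbourhood.
have h := measure_le_fin_cover mu mN (measurable_boundary_layer s) (@subset_refl _ _).
have mB := measurable_boundary_layer s.
have : (mu (boundary_layer s) <= \sum_i (C i * s)%:E)%E.
  apply: (le_trans h); apply: lee_sum => i _.
  suff : (mu (neighbourhood (frontier (U i)) s) <= (C i * s)%:E)%E by [].
  by rewrite prE// lee_fin; have [_] := HC i; exact.
by rewrite sumEFin -mulr_suml prE// lee_fin.
Qed.

Lemma pieces_full : mu (cube R d `\` \bigcup_i U i) = 0%E.
Proof.
have mU : measurable (\bigcup_i U i).
  by apply: fin_bigcup_measurable => // i _; exact: open_measurable_mx.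
have mD : measurable (cube R d `\` \bigcup_i U i).
  by apply: measurableD => //; exact: measurable_cube.
have [C C0 HC] := pr_boundary_layer.
rewrite prE//; congr (_%:E); apply/eqP; rewrite eq_le pr_ge0 andbT.
apply/ler_addgt0Pr => eps eps0; rewrite add0r.
have C1 : 0 < C + 1 by exact: ltr_wpDl.
have s0 : 0 < eps / (C + 1) by exact: divr_gt0.
apply: (@le_trans _ _ (C * (eps / (C + 1)))); last first.
  rewrite mulrCA ler_piMr ?(ltW eps0)// ler_pdivrMr// mul1r lerDl//.
apply: le_trans (HC _ s0); apply: le_pr => //; first exact: measurable_boundary_layer.
move=> x [cx nU]; have := cx; rewrite -U_cover => -[i _ Ux]; exists i => //.
exists x; last by rewrite subrr normr0.
by split => // /interior_subset Uix; apply: nU; exists i.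
Qed.

End pieces.

(** * Recurrence of a Borel map *)

Section borel_recurrence.
Context (R : realType) (d' : nat).
Local Notation d := d'.+1.
Local Notation w := (@log_weight R d).
Variable mu : probability 'rV[R]_d R.
Hypothesis mu_cube : mu (cube R d) = 1%E.
Variable T : 'rV[R]_d -> 'rV[R]_d.
Hypothesis mT : measurable_fun setT T.
Hypothesis muT : forall A, measurable A -> mu (T @^-1` A) = mu A.
Hypothesis T_cube : forall x, cube R d (T x).
Variables c rho : R.
Hypothesis c_gt0 : 0 < c.
Hypothesis rho01 : 0 < rho < 1.
Hypothesis mixing : forall k (q : cell_index d k) n A, measurable A ->
  `|pr mu ([set x | dyadic_cell k x = q] `&` iter n T @^-1` A) -
    pr mu [set x | dyadic_cell k x = q] * pr mu A| <= c * rho ^+ n * pr mu A.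
Variable cm : R.
Hypothesis cm_ge0 : 0 <= cm.
Hypothesis mu_le : forall A, measurable A -> (mu A <= cm%:E * lebesgue_rV R d A)%E.
Variables r b : nat.
Hypothesis r_gt0 : (0 < r)%N.
Hypothesis b_gt0 : (0 < b)%N.
Hypothesis rP : (2 ^+ d) ^+ 2 * rho ^+ r <= 1.

Variable f : 'rV[R]_d -> 'rV[R]_d.
Hypothesis f_cube : set_fun (cube R d) (cube R d) f.
Hypothesis f_measurable : measurable_fun (cube R d) f.
Variable delta : nat -> R.
Hypothesis delta_ge0 : forall n, 0 <= delta n.

Definition returns n := cube R d `&` [set x | pdist (iter n T x) (f x) < delta n].

Lemma measurable_returns n : measurable (returns n).
Proof.
have mc := @measurable_cube R d.
have m : measurable_fun (cube R d) (fun x => pdist (iter n T x) (f x)).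
  apply: measurable_pdist => //.
  exact: measurable_funS (measurable_iter mT n).
have -> : returns n = cube R d `&`
    (fun x => pdist (iter n T x) (f x)) @^-1` `]-oo, delta n[%classic.
  by apply/seteqP; split => y [cy yd]; split => //; move: yd; rewrite /= in_itv.
exact: m.
Qed.

Variables (A : set 'rV[R]_d) (p : R).
Hypothesis A_cube : A `<=` cube R d.
Hypothesis p_gt0 : 0 < p.
Hypothesis f_lipschitz : forall x y, A x -> A y -> `|f x - f y| <= p * `|x - y|.

Local Notation lev := (level r b).

Let slack n : R := d%:R * p * 2 ^- lev n.

Let slack_gt0 n : 0 < slack n.
Proof. by rewrite !mulr_gt0 ?invr_gt0 ?exprn_gt0// ltr0n. Qed.

Definition representatives n (x : 'rV[R]_d) : set 'rV[R]_d :=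
  [set y | A y /\ dyadic_cell (lev n) y = dyadic_cell (lev n) x].

(** Unlike [f], this is constant on cells; it is close to [f] on [A], because the
    representative is taken in [A], where [f] is Lipschitz. *)
Definition center (good : pred nat) n x : option 'rV[R]_d :=
  if good n && `[< representatives n x !=set0 >]
  then Some (f (xget 0 (representatives n x))) else None.

Lemma center_cell good n x y : dyadic_cell (lev n) x = dyadic_cell (lev n) y ->
  center good n x = center good n y.
Proof. by move=> xy; rewrite /center /representatives xy. Qed.

Lemma centerP good n x y : center good n x = Some y ->
  good n /\ exists2 z, A z & y = f z.
Proof.
rewrite /center; case: ifPn => // /andP[gn /asboolP[z rz]] [<-]; split => //.
exists (xget 0 (representatives n x)) => //.
by case: (xgetPex 0 (ex_intro _ z rz)).
Qed.

Lemma center_cube good n x y : center good n x = Some y -> cube R d y.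
Proof. by move=> /centerP[_ [z Az ->]]; exact/f_cube/A_cube. Qed.

Lemma center_some (good : pred nat) n x : good n -> A x ->
  exists z, [/\ A z, center good n x = Some (f z) & `|f x - f z| <= p * 2 ^- lev n].
Proof.
move=> gn Ax; have rx : representatives n x x by split.
rewrite /center gn /= asboolT; last by exists x.
have [Az zx] : representatives n x (xget 0 (representatives n x)).
  exact: (xgetPex 0 (ex_intro _ x rx)).
exists (xget 0 (representatives n x)); split => //.
apply: (le_trans (f_lipschitz Ax Az)); apply: ler_wpM2l; first exact: ltW.
by apply: norm_dyadic_cell => //; exact: A_cube.
Qed.

Let iter_cube n x : cube R d x -> cube R d (iter n T x).
Proof. by case: n => // n _; exact: T_cube. Qed.

Let pdist_center n x z : A x -> A z -> `|f x - f z| <= p * 2 ^- lev n ->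
  `|pdist (iter n T x) (f x) - pdist (iter n T x) (f z)| <= slack n.
Proof.
move=> Ax Az xz; have cx := A_cube Ax; have cz := A_cube Az.
have := pdist_lipschitz (iter_cube n cx) (f_cube cx) (iter_cube n cx) (f_cube cz).
rewrite subrr normr0 add0r => /le_trans; apply.
by rewrite /slack -mulrA; apply: ler_wpM2l.
Qed.

Let sqs n := Csh d' cm * iter_sqrt d' (slack n).

Let Csh_ge0 : 0 <= Csh d' cm.
Proof. by rewrite addr_ge0// mulr_ge0// mulr_ge0. Qed.

Let sqs_ge0 n : 0 <= sqs n.
Proof. by rewrite mulr_ge0// iter_sqrt_ge0// ltW. Qed.

Let sqs_sums : bounded_sums sqs.
Proof.
apply: bounded_sumsZ => //.
have t01 : 0 <= iter_sqrt d' (2^-1 : R) < 1.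
  by apply: iter_sqrt_lt1; rewrite invr_ge0 ler0n invf_lt1// ltr1n.
have dp0 : 0 <= d%:R * p by rewrite mulr_ge0// ltW.
have -> : (fun n => iter_sqrt d' (slack n)) =
    (fun n => iter_sqrt d' (d%:R * p) * iter_sqrt d' 2^-1 ^+ (n %/ (r * r * b))).
  apply/funext => n; rewrite /slack iter_sqrtM// -exprVn iter_sqrt_exp ?invr_ge0//.
apply: bounded_sumsZ; first exact: iter_sqrt_ge0.
by apply: bounded_sums_floor; rewrite // !muln_gt0 r_gt0 b_gt0.
Qed.

Let tail := tail_rate d' c rho.

(** Replace [f x] by the value of [f] at a representative of the cell of [x]; the
    error is absorbed by enlarging the target by [slack n], at the cost of a
    shell. *)
Lemma negligible_infinitely_many_returns (N0 : nat) :
  (forall n, (N0 <= n)%N -> delta n <= 2^-1) -> bounded_sums (fun n => w (delta n)) ->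
  mu.-negligible (A `&` lim_sup_set returns).
Proof.
move=> dN wB; have [C C0 HC] := pr_hyper_le cm_ge0 mu_le.
pose eta n := delta n + slack n.
have eta0 n : 0 <= eta n by rewrite addr_ge0// ltW.
pose ctr := center predT.
pose u n := if (N0 <= n)%N then C * w (delta n) + sqs n else 1.
have mt n x := measurable_target ctr eta n x.
have tu n x : pr mu (target ctr eta n x) <= u n.
  rewrite /u; case: ifPn => [Nn|_]; last exact: pr_le1.
  have w0 : 0 <= w (delta n).
    by apply: log_weight_ge0; rewrite delta_ge0 (le_trans (dN _ Nn))// invf_le1// ler1n.
  have r0 : 0 <= C * w (delta n) + sqs n by rewrite addr_ge0// mulr_ge0// ltW.
  rewrite /target; case e : (ctr n x) => [y|]; last by rewrite pr0.
  have cy := center_cube e.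
  apply: (@le_trans _ _ (pr mu (hyper y (delta n) `|` shell y (delta n) (slack n)))).
    have mH := @measurable_hyper R d y; have mS := @measurable_shell R d y.
    apply: le_pr => //; first exact: measurableU.
    move=> z [cz /= zy]; have [h|h] := ltP (pdist z y) (delta n); first by left.
    by right; split => //=; rewrite h.
  apply: (le_trans (pr_setU _ _ _)); [exact: measurable_hyper|exact: measurable_shell|].
  apply: lerD; last by apply: pr_shell => //; exact: ltW.
  have [d0|d0] := leP (delta n) 0; last by apply: HC => //; rewrite d0 dN.
  have -> : hyper y (delta n) = set0.
    rewrite -subset0 => z [_ /= h]; have := lt_le_trans h d0.
    by rewrite ltNge pdist_ge0.
  by rewrite pr0; apply: mulr_ge0 => //; exact: ltW.
have uB : bounded_sums u.
  apply: (@bounded_sums_eventually _ _ (fun n => C * w (delta n) + sqs n) N0).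
    by move=> n Nn; rewrite /u Nn.
  by apply: bounded_sumsD => //; apply: bounded_sumsZ => //; exact: ltW.
have u0 n : 0 <= u n := le_trans (pr_ge0 mu _) (tu n 0).
have hitle := pr_hit_target mT c_gt0 rho01 mixing r_gt0 b_gt0 rP
  (@center_cell predT) tu.
have [Be He] := tail_rate_sums d' c_gt0 rho01.
have tB n : tail n <= Be.
  apply: (le_trans _ (He n.+1)); rewrite big_nat_recr//= lerDr.
  by apply: sumr_ge0 => i _; exact: tail_rate_ge0.
have Be0 : 0 <= Be by have := He 0%N; rewrite big_nil.
have [B HB] : bounded_sums (fun n => pr mu (hit T (target ctr eta) n)).
  apply: (@bounded_sums_le _ _ (fun n => (1 + Be) * u n)).
    by move=> n; apply: (le_trans (hitle n)); apply: ler_wpM2r => //; rewrite lerD2l.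
  by apply: bounded_sumsZ => //; rewrite addr_ge0.
have mh n := measurable_hit_target mT eta (@center_cell predT) n : measurable (hit T (target ctr eta) n).
exists (lim_sup_set (hit T (target ctr eta))); split.
- by apply: bigcapT_measurable => n; apply: bigcup_measurable => k _; exact: mh.
- apply: lim_sup_set_cvg0 => //; apply: (@le_lt_trans _ _ B%:E); last by rewrite ltry.
  apply: lime_le; first by apply: is_cvg_nneseries.
  apply: nearW => n; apply: le_trans (_ : ((\sum_(0 <= k < n) pr mu (hit T (target ctr eta) k))%:E <= _)%E); last by rewrite lee_fin.
  by rewrite -sumEFin; apply: lee_sum => k _; rewrite -prE.
- move=> x [Ax lx] n _; have [k /= nk [cx /= xk]] := lx n Logic.I; exists k => //.
  have [z [Az e xz]] := @center_some predT k x isT Ax.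
  rewrite /hit /= /target /ctr e; split; first exact: iter_cube.
  have := pdist_center Ax Az xz; rewrite ler_norml /= /eta => /andP[h1 h2]; lra.
Qed.

Variables (Nb : R -> set 'rV[R]_d) (L Cn : R).
Hypothesis L_ge1 : 1 <= L.
Hypothesis Cn_ge0 : 0 <= Cn.
Hypothesis mNb : forall s, measurable (Nb s).
Hypothesis Nb_le : forall s, 0 < s -> pr mu (Nb s) <= Cn * s.
Hypothesis T_lipschitz : forall s y z, cube R d y -> cube R d z -> ~ Nb s y ->
  `|y - z| < s -> `|T y - T z| <= L * `|y - z|.
Hypothesis bP : 4 * L <= 2 ^+ b.

(** Here the targets are shrunk, to half their size.  This leaves room for the
    error [slack n] at the times in [good]; at the other times [delta n] is
    exponentially small, which does not affect the divergence. *)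
Lemma negligible_finitely_many_returns (V : set 'rV[R]_d) (cl : R) (k : nat) :
  0 < cl ->
  (forall B, measurable B -> B `<=` cube R d `&` V ->
     (cl%:E * lebesgue_rV R d B <= mu B)%E) ->
  (forall x, A x -> exists s : 'I_d -> bool, corner s k (f x) `<=` cube R d `&` V) ->
  (delta @ \oo --> (0 : R)) -> ~ bounded_sums (fun n => w (delta n)) ->
  mu.-negligible (A `&` ~` lim_sup_set returns).
Proof.
move=> cl0 mu_ge Acorner dcvg wB.
have [C C0 HC] := pr_hyper_le cm_ge0 mu_le.
have [kappa [t0 [kappa0 /andP[t00 t02] Hk]]] := pr_hyper_ge (ltn0Sn d') k cl0 mu_ge.
have [N0 _ dN] : \forall n \near \oo, delta n < t0 by exact: (cvgr_lt _ dcvg _ t00).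
pose good n := (0 < delta n) && (delta n < t0) && (slack n <= delta n / 2).
pose eta n := delta n / 2.
have eta0 n : 0 <= eta n by rewrite divr_ge0.
pose ctr := center good.
pose u n := if good n then C * w (delta n) else 0.
have w0 n : good n -> 0 <= w (delta n).
  move=> /andP[/andP[d0 d1] _]; apply: log_weight_ge0; rewrite delta_ge0/=.
  by rewrite (le_trans (ltW d1))// (le_trans t02)// invf_le1// ler1n.
have tu n x : pr mu (target ctr eta n x) <= u n.
  rewrite /target /u; case e : (ctr n x) => [y|]; last first.
    by rewrite pr0; case: ifPn => // gn; rewrite mulr_ge0 ?w0// ltW.
  have [gn [z Az yz]] := centerP e; rewrite gn; have cy := center_cube e.
  have /andP[/andP[d0 d1] _] := gn.
  apply: le_trans (HC y (delta n) cy _); last by rewrite d0 (le_trans (ltW d1)).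
  apply: le_pr; [exact: measurable_hyper|exact: measurable_hyper|].
  by apply: subset_hyper; rewrite /eta ler_pdivrMr// ler_peMr// ler1n.
have [->|/set0P[a Aa]] := eqVneq A set0; first by rewrite set0I; exact: negligible_set0.
have uB : ~ bounded_sums u.
  move=> uB; apply: wB.
  apply: (@bounded_sums_eventually _ _ (fun n => C^-1 * u n + kappa^-1 * sqs n) N0).
    move=> n /dN /= dt; rewrite /u; case: ifPn => gn.
      by rewrite mulrA mulVf ?gt_eqF// mul1r lerDl mulr_ge0// invr_ge0 ltW.
    rewrite mulr0 add0r mulrC ler_pdivlMr// mulrC.
    have [dn0|dn0] := leP (delta n) 0.
      have -> : delta n = 0 by apply/eqP; rewrite eq_le dn0 delta_ge0.
      by rewrite /log_weight mul0r mulr0.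
    move: gn; rewrite /good dn0 dt /= -ltNge => bad.
    have [s sV] := Acorner _ Aa.
    apply: (@le_trans _ _ (pr mu (hyper (f a) (delta n / 2)))).
      by apply: Hk sV _; rewrite dn0.
    apply: (@le_trans _ _ (pr mu (shell (f a) 0 (slack n)))).
      apply: le_pr; [exact: measurable_hyper|exact: measurable_shell|].
      move=> z [cz /= zf]; split => //=; rewrite pdist_ge0 add0r.
      exact: lt_trans bad.
    by apply: pr_shell => //; exact: ltW.
  apply: bounded_sumsD; apply: bounded_sumsZ => //; rewrite invr_ge0; exact: ltW.
pose Z N := [set x | A x /\ forall n, (N <= n)%N -> ~ returns n x].
have -> : A `&` ~` lim_sup_set returns = \bigcup_N Z N.
  apply/seteqP; split => [x [Ax nx]|x [N _ [Ax nx]]].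
    apply: contrapT => nZ; apply: nx => n _; apply: contrapT => nr; apply: nZ.
    by exists n => //; split => // m nm rm; apply: nr; exists m.
  by split => // /(_ N Logic.I)[m Nm rm]; exact: nx rm.
apply: negligible_bigcup => N.
apply: (negligible_finitely_many_hits mu_cube mT muT T_cube c_gt0 rho01 mixing
  cm_ge0 mu_le L_ge1 Cn_ge0 mNb Nb_le T_lipschitz r_gt0 b_gt0 rP bP
  eta0 (@center_cube good) (@center_cell good) (N := N) tu uB
  (divr_gt0 kappa0 C0)).
move=> x n [Ax nx] Nn; have [gn|gn] := boolP (good n); last first.
  rewrite /u (negbTE gn) mulr0; split; last exact: pr_ge0.
  by rewrite /hit /= /target /ctr /center (negbTE gn).
have /andP[/andP[d0 d1] sl] := gn.
have [z [Az e xz]] := center_some gn Ax.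
split.
  rewrite /hit /= /target /ctr e => -[_ /= h]; apply: (nx n Nn); split.
    exact: A_cube.
  have := pdist_center Ax Az xz; rewrite ler_norml /= => /andP[h1 h2].
  move: h; rewrite /eta; lra.
rewrite /u gn mulrA divfK ?gt_eqF// /target /ctr e.
by have [s sV] := Acorner _ Az; apply: Hk sV _; rewrite d0.
Qed.

End borel_recurrence.

(** * Recurrence of the original map *)

Section completion_and_corners.
Context (R : realType) (d : nat).

(** Intersect Borel covers of measure at most [1 / (n + 1)]. *)
Lemma completion_eq0_negligible (mu : probability 'rV[R]_d R) A :
  completion mu A = 0%E -> mu.-negligible A.
Proof.
move=> A0.
have cov n : exists B, [/\ measurable B, A `<=` B & (mu B <= n.+1%:R^-1%:E)%E].
  have : (mu^*%mu A < n.+1%:R^-1%:E)%E by rewrite [X in (X < _)%E]A0 lte_fin invr_gt0.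
  move=> /ereal_inf_lt[_ [F [mF AF] <-] Fn]; exists (\bigcup_k F k); split => //.
    exact: bigcupT_measurable.
  apply: le_trans (ltW Fn).
  by apply: measure_sigma_subadditive => //; exact: bigcupT_measurable.
have [B HB] := choice cov.
have mB n : measurable (B n) by have [] := HB n.
have mI : measurable (\bigcap_n B n) by exact: bigcapT_measurable.
exists (\bigcap_n B n); split => //; last by move=> x Ax n _; have [_ + _] := HB n; apply.
apply/eqP; rewrite eq_le measure_ge0 andbT; apply/lee_addgt0Pr => e e0; rewrite add0e.
have [n _ /(_ n (leqnn n)) ne] := near_infty_natSinv_lt (PosNum e0).
apply: (@le_trans _ _ (mu (B n))); last first.
  by have [_ _ h] := HB n; apply: (le_trans h); rewrite lee_fin ltW.
by apply: le_measure; rewrite ?inE// => x; exact.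
Qed.

Lemma infinite_set_natP (P : set nat) :
  infinite_set P <-> forall n, exists2 m, (n <= m)%N & P m.
Proof.
split => [Poo n|Pn Pfin].
  apply: contrapT => no; apply: Poo; apply: (sub_finite_set _ (finite_II n)).
  move=> m Pm; rewrite /= ltnNge; apply/negP => nm; apply: no; by exists m.
have /finite_seqP[F PF] := Pfin.
have [m Fm Pm] := Pn (\max_(i <- F) i).+1.
have mF : m \in F by move: Pm; rewrite PF.
have := @leq_bigmax_seq _ F xpredT (fun i : nat => i) m mF isT.
by rewrite leqNgt Fm.
Qed.

Lemma hyperboloid_pdist (x y : 'rV[R]_d) r : cube R d x -> cube R d y ->
  hyperboloid y r x <-> pdist x y < r.
Proof.
move=> cx cy; rewrite /hyperboloid /pdist; split => /=.
  move=> [z [z1 zr] zx]; rewrite normr_prod in zr; apply: le_lt_trans zr.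
  rewrite le_eqVlt; apply/orP; left; apply/eqP; apply: eq_bigr => i _.
  by rewrite -zx mxE; congr (`|_|); ring.
move=> h; exists (x - y); last by rewrite addrC subrK.
split.
  move=> i; rewrite !mxE; have /andP[x0 x1] := cx i; have /andP[y0 y1] := cy i.
  by apply/andP; split; lra.
rewrite normr_prod; apply: le_lt_trans h; rewrite le_eqVlt; apply/orP; left; apply/eqP.
by apply: eq_bigr => i _; rewrite !mxE.
Qed.

(** In each coordinate the box points towards the centre of the cube. *)
Lemma exists_corner (V : set 'rV[R]_d) y : open V -> V y -> cube R d y ->
  exists k (s : 'I_d -> bool), corner s k y `<=` cube R d `&` V.
Proof.
move=> oV Vy cy; have /nbhs_ballP[e /= e0 eV] : nbhs y V by apply: open_nbhs_nbhs.
have e1 : 0 < Num.min e 2^-1 by rewrite lt_min e0 invr_gt0 ltr0n.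
have [k] := exists_dyadic_lt e1; rewrite lt_min => /andP[ke k2].
have k0 : 0 <= 2 ^- k :> R by rewrite invr_ge0 exprn_ge0.
exists k, (fun i => 2^-1 < y ord0 i) => z zy.
have zc i : 0 <= z ord0 i <= 1 /\ `|y ord0 i - z ord0 i| <= 2 ^- k.
  have := zy i; have /andP[y0 y1] := cy i; case: ifPn => [yi|]; last rewrite -leNgt => yi.
    move=> /andP[h1 h2]; split; first by apply/andP; split; lra.
    by rewrite ger0_norm; lra.
  move=> /andP[h1 h2]; split; first by apply/andP; split; lra.
  by rewrite ler0_norm; lra.
split; first by move=> i; have [] := zc i.
apply: eV; rewrite ball_rVE /=; apply: le_lt_trans ke.
by apply: norm_rV_le => // i; rewrite !mxE; have [] := zc i.
Qed.

Lemma exists_mixing_scale (q rho : R) : 0 <= q -> 0 < rho < 1 ->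
  exists2 r, (0 < r)%N & q * rho ^+ r <= 1.
Proof.
move=> q0 /andP[r0 r1].
have t0 : 0 < (q + 1)^-1 by rewrite invr_gt0 ltr_wpDl.
have := cvg_geometric (1 : R) (_ : `|rho| < 1).
rewrite gtr0_norm// => /(_ r1) /cvgr_lt /(_ _ t0) [n _ /(_ n.+1 (leqnSn n))].
rewrite /geometric /= mul1r => h; exists n.+1 => //.
have h2 : q * rho ^+ n.+1 <= q * (q + 1)^-1 by apply: ler_wpM2l => //; exact: ltW.
apply: (le_trans h2); rewrite ler_pdivrMr ?ltr_wpDl// mul1r; lra.
Qed.

Lemma exists_pow2_ge (x : R) : exists2 b, (0 < b)%N & x <= 2 ^+ b.
Proof.
exists (Num.truncn x).+1 => //; apply: (le_trans (ltW (truncnS_gt x))).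
by rewrite -natrX ler_nat ltnW// ltn_expl.
Qed.

End completion_and_corners.

Section returns.
Context (R : realType) (d' : nat).
Local Notation d := d'.+1.

Lemma recurrence_set_returns (T : 'rV[R]_d -> 'rV[R]_d) (Tb f : 'rV[R]_d -> 'rV[R]_d)
    (delta : nat -> R) x :
  set_fun (cube R d) (cube R d) f ->
  (forall n, iter n T x = iter n Tb x /\ cube R d (iter n Tb x)) ->
  recurrence_set T f delta x <-> lim_sup_set (returns Tb f delta) x.
Proof.
move=> f_cube HT; have cx : cube R d x by have [_] := HT 0%N.
split.
  move=> [_ /infinite_set_natP oo] n _; have [m nm [_ h]] := oo n.
  exists m => //; split => //=; have [e cm] := HT m.
  by rewrite e in h; apply/(hyperboloid_pdist _ cm (f_cube _ cx)).
move=> H; split => //; apply/infinite_set_natP => n.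
have [m /= nm [_ h]] := H n.+1 Logic.I; exists m; first exact: ltnW.
split; first exact: leq_trans nm.
by have [-> cm] := HT m; apply/(hyperboloid_pdist _ cm (f_cube _ cx)).
Qed.

End returns.

Theorem theorem1p3 (R : realType) (d : nat) (d_gt0 : (0 < d)%N)
    (T : 'rV[R]_d -> 'rV[R]_d) (T_cube : set_fun (cube R d) (cube R d) T)
    (T_expanding : piecewise_expanding T)
    (mu : probability 'rV[R]_d R) (mu_cube : mu (cube R d) = 1%E)
    (mu_ac : mu `<< lebesgue_rV R d)
    (h : 'rV[R]_d -> R) (h_density : is_density mu h)
    (mu_invariant : invariant_measure mu T) (mu_mixing : exponentially_mixing mu T)
    (f : 'rV[R]_d -> 'rV[R]_d) (f_cube : set_fun (cube R d) (cube R d) f)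
    (f_measurable : measurable_fun (cube R d) f)
    (f_lipschitz : piecewise_lipschitz mu f)
    (condition :
       ((exists (V : set 'rV[R]_d) (c : R),
           [/\ open V, mu V = 1%E, 1 <= c &
               forall x, V x -> cube R d x -> c^-1 <= h x <= c]) /\
        null_preimages mu f) \/
       (exists2 c : R, 1 <= c & forall x, cube R d x -> c^-1 <= h x <= c))
    (delta : nat -> R) (delta_ge0 : forall n, 0 <= delta n)
    (delta_cvg0 : delta @ \oo --> (0 : R)) :
  completion_measurable mu (recurrence_set T f delta) /\
  ((\sum_(1 <= n <oo) (log_weight d (delta n))%:E < +oo)%E ->
     completion mu (recurrence_set T f delta) = 0%E) /\
  ((\sum_(1 <= n <oo) (log_weight d (delta n))%:E = +oo)%E ->
     completion mu (recurrence_set T f delta) = 1%E).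
Proof.
case: d d_gt0 T T_cube T_expanding mu mu_cube mu_ac h h_density mu_invariant
  mu_mixing f f_cube f_measurable f_lipschitz condition => // d' _ T T_cube
  T_expanding mu mu_cube _ h h_density mu_invariant mu_mixing f f_cube
  f_measurable f_lipschitz condition.
set d := d'.+1.
have mc := @measurable_cube R d.
(* Both conditions provide an open set of full measure on which the density is
   bounded, and almost every point is sent to it by [f]. *)
have [V [c [oV V1 c1 hV f_V]]] : exists (V : set 'rV[R]_d) (c : R),
    [/\ open V, mu V = 1%E, 1 <= c,
        forall x, V x -> cube R d x -> c^-1 <= h x <= c &
        mu.-negligible (cube R d `&` f @^-1` (cube R d `\` V))].
  case: condition => [[[V [c [oV V1 c1 hV]]] nf]|[c c1 hc]].
    exists V, c; split => //.
    have mD : measurable (cube R d `\` V).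
      by apply: measurableD => //; exact: open_measurable_mx.
    apply/(negligibleP mu); first exact: f_measurable.
    apply: nf => //.
    apply/eqP; rewrite eq_le measure_ge0 andbT.
    apply: (@le_trans _ _ (mu (~` V))).
      by apply: le_measure; rewrite ?inE//; apply: measurableC; exact: open_measurable_mx.
    by rewrite probability_setC ?V1 ?subee//; exact: open_measurable_mx.
  exists setT, c; split => //; [exact: openT|exact: probability_setT| |].
    by move=> x _; exact: hc.
  rewrite setDT preimage_set0 setI0; exact: negligible_set0.
have c0 : 0 < c by exact: lt_le_trans c1.
have mu_le := density_le mu_cube h_density oV V1 c1 hV.
have mu_ge := density_ge h_density c1 hV.
have [Q [U [[U_prop _ U_cover] [U_ext _] [_ [K U_content]]]]] := T_expanding.
have U_open i : open (U i) by have [] := U_prop i.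
have U_cube i : U i `<=` cube R d by have [] := U_prop i.
have T_C1 i : exists W S, [/\ open W, closure (U i) `<=` W,
  C1_on W S & forall x, U i x -> S x = T x] by have [] := U_ext i.
have T_cont := pieces_continuous U_open T_C1.
have [L L1 T_lip] := pieces_lipschitz U_cube T_C1.
have [Cn Cn0 Nb_le] := pr_boundary_layer (ltW c0) mu_le U_content.
have U_full := pieces_full U_open U_cover (ltW c0) mu_le U_content.
pose Tb := borel_map U T.
have mTb : measurable_fun setT Tb := measurable_borel_map U_open T_cont.
have Tb_cube x : cube R d (Tb x) := borel_map_cube T_cube U_cube x.
have muTb := mu_borel_map mu_cube T_cube U_open T_cont U_full mu_invariant.
have [c' [rho [c'0 rho01 mixing]]] := mixing_borel_map mu_cube T_cube U_open
  T_cont U_full mu_invariant mu_mixing.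
have [r r0 rP] := @exists_mixing_scale R ((2 ^+ d) ^+ 2) rho (exprn_ge0 _ (exprn_ge0 _ (ler0n R 2))) rho01.
have [b b0 bP] := exists_pow2_ge (4 * L).
have Tb_lip s y z : cube R d y -> cube R d z -> ~ boundary_layer U s y ->
    `|y - z| < s -> `|Tb y - Tb z| <= L * `|y - z|.
  move=> cy cz ny yz; have [i Ui] := segment_in_piece U_open U_cover cy ny yz.
  have Uy : U i y by have := Ui 0; rewrite segment0; apply; rewrite lexx ler01.
  have Uz : U i z by have := Ui 1; rewrite segment1; apply; rewrite lexx ler01.
  by rewrite /Tb (borel_mapE _ Uy) (borel_mapE _ Uz); exact: T_lip Ui.
pose LS := lim_sup_set (returns Tb f delta).
have mLS : measurable LS.
  apply: bigcapT_measurable => n; apply: bigcup_measurable => k _.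
  exact: measurable_returns.
have [mrec ->] : completion_measurable mu (recurrence_set T f delta) /\
    completion mu (recurrence_set T f delta) = mu LS.
  apply: (completion_ae mLS (measurable_irregular U_open T_cont)).
    exact: (mu_irregular mu_cube T_cube U_open T_cont U_full mu_invariant).
  move=> x nx; apply: recurrence_set_returns => // n.
  by have [] := iter_borel_map n nx.
split => //.
have [p [N [Uf [p0 Uf_cube Uf_full f_lip]]]] := f_lipschitz.
have Uf_negl : mu.-negligible (cube R d `\` \bigcup_j Uf j).
  exact: completion_eq0_negligible.
have mu_negl (A : set 'rV[R]_d) : measurable A -> mu.-negligible (cube R d `&` A) -> mu A = 0%E.
  move=> mA nA; apply/(negligibleP mu mA).
  have nc : mu.-negligible (~` cube R d).
    have e : mu (~` cube R d) = 0%E by rewrite probability_setC// mu_cube subee.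
    by apply/(negligibleP mu); [exact: measurableC|exact: e].
  apply: (negligibleS _ (negligibleU nc nA)) => x Ax.
  by have [cx|cx] := pselect (cube R d x); [right|left].
have negl_fin (F : 'I_N -> set 'rV[R]_d) : (forall j, mu.-negligible (F j)) ->
    mu.-negligible (\bigcup_j F j).
  move=> nF; pose G n := if insub n is Some j then F j else set0.
  apply: (negligibleS (A := \bigcup_n G n)).
    by move=> x [j _ Fx]; exists (val j) => //; rewrite /G valK.
  apply: negligible_bigcup => n; rewrite /G; case: insubP => [j _ _|_] //.
  exact: negligible_set0.
have t20 : 0 < 2^-1 :> R by rewrite invr_gt0.
have [N0 _ dN] : \forall n \near \oo, delta n < 2^-1.
  exact: (cvgr_lt _ delta_cvg0 _ t20).
have wP := @bounded_sums_lty R (fun n => log_weight d (delta n)) N0.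
have w0 n : (N0 <= n)%N -> 0 <= log_weight d (delta n).
  move=> /dN /= /ltW d2; apply: log_weight_ge0; rewrite delta_ge0 (le_trans d2)//.
  by rewrite invf_le1// ler1n.
split=> sum_w.
  apply: mu_negl => //; apply: (negligibleS (A :=
    (cube R d `\` \bigcup_j Uf j) `|` \bigcup_j (Uf j `&` LS))).
    move=> x [cx Lx]; have [[j _ Ux]|nU] := pselect ((\bigcup_j Uf j) x).
      by right; exists j.
    by left.
  apply: negligibleU => //; apply: negl_fin => j.
  apply: (negligible_infinitely_many_returns mTb Tb_cube c'0 rho01 mixing (ltW c0)
    mu_le r0 b0 rP f_cube delta_ge0 (proj2 (Uf_cube j)) p0 (f_lip j) (N0 := N0)).
    by move=> n /dN /ltW.
  exact/(wP w0).
have nLS : mu (~` LS) = 0%E.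
  apply: mu_negl; first exact: measurableC.
  pose A j k := Uf j `&` [set x | exists s : 'I_d -> bool,
    corner s k (f x) `<=` cube R d `&` V].
  apply: (negligibleS (A := ((cube R d `\` \bigcup_j Uf j) `|`
    (cube R d `&` f @^-1` (cube R d `\` V))) `|`
    \bigcup_j \bigcup_k (A j k `&` ~` LS))).
    move=> x [cx Lx]; have [[j _ Ux]|nU] := pselect ((\bigcup_j Uf j) x); last by left; left.
    have [Vfx|nV] := pselect (V (f x)); last first.
      by left; right; split => //; split => //; exact: f_cube.
    right; exists j => //; have [k [s ks]] := exists_corner oV Vfx (f_cube _ cx).
    by exists k => //; split => //; split => //; exists s.
  apply: negligibleU; first exact: negligibleU.
  apply: negl_fin => j; apply: negligible_bigcup => k.
  have A_cube : A j k `<=` cube R d by move=> x [Ux _]; exact: (proj2 (Uf_cube j)) x Ux.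
  have A_lip x y : A j k x -> A j k y -> `|f x - f y| <= p * `|x - y|.
    by move=> [Ux _] [Uy _]; exact: (f_lip j).
  have A_corner x : A j k x -> exists s : 'I_d -> bool,
    corner s k (f x) `<=` cube R d `&` V by case.
  have w_unbounded : ~ bounded_sums (fun n => log_weight d (delta n)).
    by move=> /(wP w0); rewrite sum_w ltxx.
  have ci0 : 0 < c^-1 by rewrite invr_gt0.
  exact: (negligible_finitely_many_returns mu_cube mTb muTb Tb_cube c'0 rho01 mixing
    (ltW c0) mu_le r0 b0 rP f_cube delta_ge0 A_cube p0 A_lip L1 Cn0
    (measurable_boundary_layer U) Nb_le Tb_lip bP ci0 mu_ge A_corner
    delta_cvg0 w_unbounded).
have := probability_setC mu mLS; rewrite nLS => e.
have LSfin : mu LS \is a fin_num by exact: fin_num_measure.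
move: e; rewrite (prE mu mLS) => /eqP; rewrite -EFinB eqe eq_sym subr_eq0 => /eqP <- //.
Qed.
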